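(* Let $s\in\mathbb{N}$, $\alpha\in\mathbb{N}_0$, $0<\lambda\le1$, and let $f\in C^{(\alpha,\dots,\alpha)}([0,1]^s)$ satisfy $N_{\alpha,\lambda}(f)<\infty$. Let $\mu=\int_{[0,1]^s}f(\boldsymbol{x})\,d\boldsymbol{x}$. For each $m\in\mathbb{N}$ put $n=2^m$, let $r=r_m\ge m$ be an integer, and let $\hat\mu^{(r)}_\infty$ be the sample median of $2r-1$ independently generated copies of the randomized digital net estimator $\hat\mu_\infty$ (with $2^m$ points), where the randomization is asymptotically full-rank. Then for every $\epsilon>0$, as $m\to\infty$, $$\mathbb{E}\big((\hat\mu^{(r)}_\infty-\mu)^2\big)=O\big(n^{-2\alpha-2\lambda-1+\epsilon}\big).$$
   Context: Notation: $\mathbb{N}=\{1,2,\dots\}$, $\mathbb{N}_0=\mathbb{N}\cup\{0\}$, $\mathbb{N}_*^s=\mathbb{N}_0^s\setminus\{\boldsymbol{0}\}$, $\mathbb{Z}_{\le\alpha}=\{0,1,\dots,\alpha\}$, $1{:}s=\{1,\dots,s\}$, $u^c=1{:}s\setminus u$, $\boldsymbol x_u=(x_j)_{j\in u}$. For positive sequences, $a_m=O(b_m)$ means there is $C<\infty$ with $a_m\le Cb_m$ for all but finitely many $m$. Randomized digital nets. For $i\in\{0,\dots,2^m-1\}$ with $i=\sum_{\ell=1}^m i_\ell2^{\ell-1}$ write $\vec{i}=(i_1,\dots,i_m)^{\mathsf T}\in\{0,1\}^m$. For $k=\sum_{\ell\ge1}a_\ell2^{\ell-1}\in\mathbb{N}_0$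 write $\vec{k}=(a_1,a_2,\dots)^{\mathsf T}$ (finitely many nonzero entries). For each $m$ let $C_1,\dots,C_s\in\{0,1\}^{\infty\times m}$ be random matrices, and let $\vec D_1,\dots,\vec D_s\in\{0,1\}^\infty$ be random vectors all of whose entries are independent and uniform on $\{0,1\}$, independent of $(C_1,\dots,C_s)$. The points $\boldsymbol{x}_i=(x_{i1},\dots,x_{is})\in[0,1]^s$ are given by $x_{ij}=\sum_{\ell\ge1}(\vec x_{ij})_\ell2^{-\ell}$ with $\vec x_{ij}=C_j\vec i+\vec D_j \bmod 2$, and $\hat\mu_\infty=2^{-m}\sum_{i=0}^{2^m-1}f(\boldsymbol{x}_i)$. For $\boldsymbol{k}\in\mathbb{N}_*^s$ let $Z(\boldsymbol{k})$ be the indicator of the event $\sum_{j=1}^s\vec k_j^{\mathsf T}C_j=\boldsymbol{0}\bmod 2$. The randomization is asymptotically full-rank if there is a constant $R$ independent of $m$ and $\boldsymbol{k}$ such that $\Pr(Z(\boldsymbol{k})=1)\le2^{-m+R}$ for all $m\in\mathbb{N}$, $\boldsymbol{k}\in\mathbb{N}_*^s$. Derivatives: $f^{(\boldsymbol\alpha)}=\partial^{\alpha_1+\cdots+\alpha_s}f/\partial x_1^{\alpha_1}\cdots\partial x_s^{\alpha_s}$, $f^{(\boldsymbol 0)}=f$; $f\in C^{(\alpha,\dots,\alpha)}([0,1]^s)$ means $f^{(\boldsymbol\alpha)}\in C([0,1]^s)$ for all $\boldsymbol\alpha\in\mathbb{Z}_{\le\alpha}^s$. Fractional variation. For a cube $J=\prod_{j=1}^s[d_j,e_j)$,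 $\Delta(f,J)=\sum_{u\subseteq1{:}s}(-1)^{s-|u|}f((\boldsymbol d_u,\boldsymbol e_{u^c}))$, where $(\boldsymbol d_u,\boldsymbol e_{u^c})$ has $j$th component $d_j$ if $j\in u$ and $e_j$ otherwise. For $0<\lambda\le1$, $$V^{(s)}_\lambda(f)=\sup_{\mathcal P}\Big(\sum_{J\in\mathcal P}\mathrm{Vol}(J)\Big|\frac{\Delta(f,J)}{\mathrm{Vol}(J)^\lambda}\Big|^2\Big)^{1/2},$$ the supremum being over all partitions $\mathcal P$ of $[0,1)^s$ into subcubes of the form $\prod_{j=1}^s[a_j,b_j)$ (with $a_j<b_j$). For nonempty $u\subseteq1{:}s$, $I_u(f)(\boldsymbol x_u)=\int_{[0,1]^{s-|u|}}f(\boldsymbol x)\,d\boldsymbol x_{u^c}$ ($I_{1:s}$ is the identity), $D_{u^c}$ is the set of functions $\rho_{u^c}(\boldsymbol x)=\prod_{j\in u^c}\rho_j(x_j)$ with $\rho_j\in C([0,1])$, $\rho_j\ge0$, $\|\rho_j\|_\infty\le1$, and $V^u_\lambda(f)=\sup_{\rho_{u^c}\in D_{u^c}}V^{(|u|)}_\lambda(I_u(f\rho_{u^c}))$, with $V^{1:s}_\lambda(f)=V^{(s)}_\lambda(f)$. Finally $$N_{\alpha,\lambda}(f)=\sup_{\varnothing\ne u\subseteq1{:}s}\Big(\sum_{\boldsymbol\alpha\in\mathbb{Z}_{\le\alpha}^s}\big(V^u_\lambda(f^{(\boldsymbol\alpha)})\big)^2\Big)^{1/2}.$$ *)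

(* Defs.v *)
From HB Require Import structures.
From mathcomp Require Import all_boot all_order all_algebra finmap.
From mathcomp Require Import all_classical all_reals all_analysis.
Set Implicit Arguments.
Unset Strict Implicit.
Unset Printing Implicit Defensive.
Import Order.TTheory GRing.Theory Num.Theory.
Import numFieldNormedType.Exports.
Local Open Scope classical_set_scope.
Local Open Scope ring_scope.

Section calculus_on_the_cube.
Context {R : realType} {s : nat}.
Implicit Types (f g : 'rV[R]_s -> R) (x y d e : 'rV[R]_s) (u v : {set 'I_s}).

Definition unit_cube : set 'rV[R]_s := [set x | forall j, 0 <= x 0 j <= 1].

Definition subst_coord (j : 'I_s) (t : R) x : 'rV[R]_s :=
  \row_i (if i == j then t else x 0 i).

(* Functions are total on R^s, but only their values on the closed cube matter:
   partial derivatives are taken relative to [0,1], hence one-sided where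
   x_j = 0 or x_j = 1. *)
Definition diff_quot (j : 'I_s) f x (t : R) : R :=
  (f (subst_coord j t x) - f x) / (t - x 0 j).

Definition cube_nbhs (j : 'I_s) x : set_system R :=
  within `[0, 1]%classic ((x 0 j)^').

Definition partial (j : 'I_s) f x : R := lim (diff_quot j f x @ cube_nbhs j x).

Definition partial_exists (j : 'I_s) f x : Prop :=
  cvg (diff_quot j f x @ cube_nbhs j x).

(* The differential operator in coordinate s is applied first, the one in
   coordinate 1 last, as in d^|a| f / dx_1^(a_1) ... dx_s^(a_s). *)
Definition mixed_partial (a : 'I_s -> nat) f : 'rV[R]_s -> R :=
  foldr (fun j g => iter (a j) (partial j) g) f (enum 'I_s).

(* [partial] and [mixed_partial] are total, so the existence of the
   derivatives is a separate clause.  When a_i = 0 for all i < j, one has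
   mixed_partial (a + e_j) f = partial j (mixed_partial a f); the clause thus
   covers each differentiation performed in forming some f^(a) with all
   a_j <= alpha. *)
Definition mixed_C (alpha : nat) f : Prop :=
  forall a : 'I_s -> nat, (forall j, (a j <= alpha)%N) ->
    {within unit_cube, continuous (mixed_partial a f)} /\
    (forall j : 'I_s, (forall i : 'I_s, (i < j)%N -> a i = 0%N) ->
       (a j < alpha)%N ->
       forall x, unit_cube x -> partial_exists j (mixed_partial a f) x).

Definition int_coord (j : 'I_s) f x : R :=
  \int[lebesgue_measure]_(t in `[0, 1]) f (subst_coord j t x).

(* Integration over the coordinates in v, as an iterated Lebesgue integral
   (applied below to continuous integrands on the cube, so that by Fubini it is
   the integral over [0,1]^|v|).  The result, a function of the remaining
   coordinates, is kept as a function on R^s not depending on those in v. *)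
Definition int_coords v f : 'rV[R]_s -> R := foldr int_coord f (enum v).

Definition cube_integral f : R := int_coords [set: 'I_s] f 0.

Definition select v d e : 'rV[R]_s :=
  \row_j (if j \in v then d 0 j else e 0 j).

(* A box in the coordinates u is given by its pair of corners (d, e), of which
   only the coordinates in u are relevant. *)
Definition box u (J : 'rV[R]_s * 'rV[R]_s) : set 'rV[R]_s :=
  [set x | forall j, j \in u -> J.1 0 j <= x 0 j < J.2 0 j].

Definition volume u (J : 'rV[R]_s * 'rV[R]_s) : R :=
  \prod_(j in u) (J.2 0 j - J.1 0 j).

Definition box_partition u (Q : set ('rV[R]_s * 'rV[R]_s)) : Prop :=
  [/\ forall J, Q J -> forall j, j \in u -> J.1 0 j < J.2 0 j,
      trivIset Q (box u) &
      \bigcup_(J in Q) box u J = box u (const_mx 0, const_mx 1)].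

Definition alt_sum u g (J : 'rV[R]_s * 'rV[R]_s) : R :=
  \sum_(v : {set 'I_s} | v \subset u)
    (-1) ^+ (#|u| - #|v|) * g (select v J.1 J.2).

(* V_lambda^(|u|) of a function g of x_u. *)
Definition fractional_variation (lambda : R) u g : \bar R :=
  ereal_sup [set ((\esum_(J in Q)
      (volume u J * (`|alt_sum u g J / volume u J `^ lambda|) ^+ 2)%:E)
      `^ (2^-1))%E | Q in box_partition u].

Definition weights v : set ('I_s -> R -> R) :=
  [set rho : 'I_s -> R -> R | forall j, j \in v ->
     {within `[0, 1]%classic, continuous (rho j)} /\
     (forall t : R, 0 <= t <= 1 -> 0 <= rho j t <= 1)].

(* V_lambda^u(f).  For u = [set: 'I_s] no coordinate is integrated and the weight
   is an empty product, so this is V_lambda^(s)(f). *)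
Definition weighted_variation (lambda : R) u f : \bar R :=
  ereal_sup [set fractional_variation lambda u
      (int_coords (~: u) (fun x => f x * \prod_(j in ~: u) rho j (x 0 j)))
    | rho in weights (~: u)].

(* N_{alpha,lambda}(f). *)
Definition variation_norm (alpha : nat) (lambda : R) f : \bar R :=
  ereal_sup [set ((\sum_(a : {ffun 'I_s -> 'I_alpha.+1})
      (weighted_variation lambda u (mixed_partial (fun j => a j) f)) ^+ 2)
      `^ (2^-1))%E | u in [set u : {set 'I_s} | u != finset.set0]].

End calculus_on_the_cube.

(* {0,1}^I with its product sigma-algebra. *)
Definition coord_events (I : Type) : set (set (I -> bool)) :=
  [set [set b : I -> bool | b i] | i in [set: I]].
Notation bits I := (g_sigma_algebraType (@coord_events I)).

(* C (j, l, p) is the entry of C_j in row l and column p, and D (j, l) is entry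
   l of D_j; rows and columns are numbered from 0. *)
Notation gen_matrices s m := (bits ('I_s * nat * 'I_m)%type).
Notation shifts s := (bits ('I_s * nat)%type).

(* The coefficient of 2^l in k. *)
Definition digit (k l : nat) : bool := odd (k %/ 2 ^ l).

Section digital_nets.
Context {R : realType} {s m : nat}.
Implicit Types (C : 'I_s * nat * 'I_m -> bool) (D : 'I_s * nat -> bool).

(* The digits of k_j at positions l >= k_j vanish. *)
Definition Z (k : 'I_s -> nat) C : bool :=
  [forall p : 'I_m, ~~ \big[addb/false]_(j < s) \big[addb/false]_(l < k j)
     (digit (k j) l && C (j, nat_of_ord l, p))].

Definition net_digit C D (i : nat) (j : 'I_s) (l : nat) : bool :=
  (\big[addb/false]_(p < m) (C (j, l, p) && digit i p)) (+) D (j, l).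

Definition net_point C D (i : nat) : 'rV[R]_s :=
  \row_j limn (series (fun l => (net_digit C D i j l)%:R * 2 ^- l.+1 : R)).

Definition net_estimator (f : 'rV[R]_s -> R) C D : R :=
  2 ^- m * \sum_(i < 2 ^ m) f (net_point C D i).

End digital_nets.

(* The middle order statistic of a sequence of odd size. *)
Definition median {R : realType} (t : seq R) : R :=
  nth 0 (sort <=%O t) (size t)./2.

Section randomization.
Context {R : realType}.

Definition mutually_independent d (T : measurableType d) (P : probability T R)
    (I : choiceType) d' (T' : measurableType d') (X : I -> T -> T') : Prop :=
  forall (J : {fset I}) (A : I -> set T'), (forall i, measurable (A i)) ->
    (P (\bigcap_(i in [set` J]) (X i @^-1` A i)) =
     \prod_(i <- enum_fset J) P (X i @^-1` A i))%E.

(* N independent copies (C i, D i) of the random matrices and digital shifts,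
   the matrices having law Q. *)
Record net_copies (s m N : nat) (Q : probability (gen_matrices s m) R)
    d (T : measurableType d) (P : probability T R)
    (C : 'I_N -> T -> gen_matrices s m) (D : 'I_N -> T -> shifts s) : Prop :=
  NetCopies {
    measurable_C : forall i, measurable_fun [set: T] (C i) ;
    measurable_D : forall i, measurable_fun [set: T] (D i) ;
    law_C : forall i (A : set (gen_matrices s m)), measurable A ->
      P (C i @^-1` A) = Q A ;
    uniform_D : forall i jl, P [set w | D i w jl = true] = (2^-1)%:E ;
    independent_D : forall i,
      mutually_independent P (fun (jl : 'I_s * nat) w => D i w jl : bool) ;
    independent_CD : forall i (A : set (gen_matrices s m)) (B : set (shifts s)),
      measurable A -> measurable B ->
      (P ((C i @^-1` A) `&` (D i @^-1` B)) =
       P (C i @^-1` A) * P (D i @^-1` B))%E ;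
    independent_copies :
      mutually_independent P (fun i w => (C i w, D i w)) }.

Definition asymptotically_full_rank (s : nat)
    (Q : forall m, probability (gen_matrices s m) R) : Prop :=
  exists R0 : R, forall (m : nat) (k : 'I_s -> nat),
    (0 < m)%N -> (exists j, k j <> 0%N) ->
    (Q m [set C | Z k C] <= (2 `^ (- m%:R + R0))%:E)%E.

End randomization.

(* Main.v *)
(* Write A = alpha + lambda.  The discrete Walsh coefficients c_k of f on a fine
   dyadic grid approximate f uniformly, so up to an arbitrarily small error the
   estimator is c_0 + \sum_(k != 0) c_k Z(k) (-1)^(k.D), with c_0 close to mu.

   Size of c_k.  For each coordinate, sum by parts in the alpha finest digits of
   k_j: digit l turns a difference of f into a derivative and gains 2^-l.  Flipping
   the next digit in every coordinate that has one turns the average into box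
   differences of that derivative, integrated over the other coordinates against
   continuous weights.  By Bessel's inequality over all k with the same alpha + 1
   finest digits (a block), the sum of c_k^2 over the block is controlled by the
   fractional variation, hence by the square of a weight w(k).  A block of weight w
   has at most w^(-1/A) elements, and the powers w^delta are summable over blocks.

   One copy.  Let K be the set of k <> 0 with w(k) >= theta, where theta is about
   n^(-A).  By full rank and the union bound, no Z(k) with k in K occurs, except
   with probability p0.  The digital shift makes the remaining terms uncorrelated,
   so their second moment is at most 2^R0 / n times the sum of c_k^2 off K, about
   n^(-2A-1), and Chebyshev's inequality applies.

   Median.  It is far from mu only if r of the 2r - 1 copies are, which has
   probability at most 2^(2r-1) (2 p0)^r <= (8 p0)^m; p0 is chosen so that this is
   n^(-2A-1).  On this event the error is bounded because f is. *)
Require Import Defs.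
From HB Require Import structures.
From mathcomp Require Import all_boot all_order all_algebra finmap.
From mathcomp Require Import all_classical all_reals all_analysis.
Set Implicit Arguments.
Unset Strict Implicit.
Unset Printing Implicit Defensive.
Import Order.TTheory GRing.Theory Num.Theory.
Import numFieldNormedType.Exports.
Local Open Scope classical_set_scope.
Local Open Scope ring_scope.
From mathcomp Require Import measurable_realfun ring lra zify.

(** * Averages and Walsh functions *)

(** Fractional variation is a mean-square quantity: it bounds sums over boxes of a partition, not
    single box differences. Coefficients are therefore estimated in groups, and all members of a
    group must come from one and the same function before Bessel's inequality is applied. This
    dictates the blocks: the [alpha] finest digits fix the derivative and the weights, the next
    digit fixes the sides of the boxes, and coarser digits only select the character.

    A grid average runs over all translates of a box, whereas the variation admits only partitions.
    Translates with equal residue tile the cube up to boundary cells, and the number of residue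
    classes is the grid size times the volume of a box, which restores the normalization.

    No infinite Walsh series occurs. The digit depth L is chosen from the accuracy [eta], then the
    grid exponent N so large that the errors of the midpoint rule and of difference quotients
    disappear next to the smallest block weight of depth L. The constant B is fixed before [eta], L
    and N, so counting and tail bounds are uniform in the depth. The loss of [eps] comes only from
    the power [del] that makes block weights summable. *)

Section average.
Context {R : realFieldType}.

Definition avg (T : finType) (G : T -> R) : R := #|T|%:R^-1 * \sum_t G t.

Lemma avg_le (T : finType) (G G' : T -> R) :
  (forall t, G t <= G' t) -> avg G <= avg G'.
Proof.
by move=> h; rewrite ler_wpM2l ?invr_ge0 //; apply: ler_sum.
Qed.

Lemma eq_avg (T : finType) (G G' : T -> R) : G =1 G' -> avg G = avg G'.
Proof. by move=> h; congr (_ * _); apply: eq_bigr. Qed.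

Lemma avg_const (T : finType) (c : R) : (0 < #|T|)%N -> avg (fun _ : T => c) = c.
Proof.
by move=> T0; rewrite /avg sumr_const -[c *+ _]mulr_natl mulrA mulVf ?mul1r // pnatr_eq0 -lt0n.
Qed.

Lemma avgD (T : finType) (G G' : T -> R) :
  avg (fun t => G t + G' t) = avg G + avg G'.
Proof. by rewrite /avg big_split mulrDr. Qed.

Lemma avgB (T : finType) (G G' : T -> R) :
  avg (fun t => G t - G' t) = avg G - avg G'.
Proof. by rewrite /avg sumrB mulrBr. Qed.

Lemma avgZ (T : finType) (c : R) (G : T -> R) :
  avg (fun t => c * G t) = c * avg G.
Proof. by rewrite /avg -mulr_sumr mulrCA. Qed.

Lemma avg_sum (T : finType) (I : Type) (r : seq I) (Q : pred I) (G : I -> T -> R) :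
  avg (fun t => \sum_(i <- r | Q i) G i t) = \sum_(i <- r | Q i) avg (G i).
Proof. by rewrite /avg exchange_big mulr_sumr. Qed.

Lemma le_norm_avg (T : finType) (G : T -> R) : `|avg G| <= avg (fun t => `|G t|).
Proof.
by rewrite /avg normrM ger0_norm ?invr_ge0 // ler_wpM2l ?invr_ge0 // ler_norm_sum.
Qed.

Lemma norm_avg_le (T : finType) (G : T -> R) (c : R) :
  (0 < #|T|)%N -> (forall t, `|G t| <= c) -> `|avg G| <= c.
Proof.
move=> T0 h; apply: le_trans (le_norm_avg _) _.
by rewrite -[leRHS](@avg_const T) //; apply: avg_le.
Qed.

Definition upd (I J : finType) (p : {ffun I -> J}) (j : I) (t : J) : {ffun I -> J} :=
  [ffun i => if i == j then t else p i].

(** Exchanging the entry [p j] with the fresh value [t] is an involution on pairs, so resampling one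
    coordinate preserves the average. This isolates a single coordinate of a grid average. *)
Lemma avg_upd (I J : finType) (j : I) (G : {ffun I -> J} -> R) : (0 < #|J|)%N ->
  avg G = avg (fun p => avg (fun t => G (upd p j t))).
Proof.
move=> J0; rewrite /avg -mulr_sumr; congr (_ * _).
apply: (@mulfI _ #|J|%:R); first by rewrite pnatr_eq0 -lt0n.
rewrite mulrA divff ?mul1r; last by rewrite pnatr_eq0 -lt0n.
have -> : #|J|%:R * \sum_t G t = \sum_(t : J) \sum_p G p.
  by rewrite sumr_const -[RHS]mulr_natl.
rewrite exchange_big pair_big [RHS]pair_big /=.
pose h (x : {ffun I -> J} * J) := (upd x.1 j x.2, x.1 j).
have hh : involutive h.
  case=> p t; rewrite /h /= ffunE eqxx; congr (_, _).
  by apply/ffunP => i; rewrite !ffunE; case: eqP => // ->.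
by rewrite (reindex_inj (can_inj hh)).
Qed.

End average.

Section walsh.
Context {R : realFieldType}.

(* A set k of digit positions stands for the integer \sum_(l in k) 2 ^ l, so
   that [chi1 k] is the Walsh function of that index; [b l] is the digit of
   weight 2 ^- l.+1 of its argument. *)
Definition chi1 (L : nat) (k : {set 'I_L}) (b : nat -> bool) : R :=
  \prod_(l in k) (-1) ^+ b l.

Definition chi (s L : nat) (k : {ffun 'I_s -> {set 'I_L}}) (b : 'I_s -> nat -> bool) : R :=
  \prod_j chi1 (k j) (b j).

Lemma chi1_normr L (k : {set 'I_L}) b : `|chi1 k b| = 1.
Proof. by rewrite normr_prod big1 // => l _; rewrite normrX normrN1 expr1n. Qed.

Lemma chi0 s L b : chi [ffun _ : 'I_s => finset.set0 : {set 'I_L}] b = 1.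
Proof. by rewrite /chi big1 // => j _; rewrite ffunE /chi1 big_set0. Qed.

(** The Walsh-Dirichlet kernel of depth [L]: 2^(s L) when all digits at positions below [L] agree,
    and 0 otherwise. *)
Definition wkernel (s L : nat) (b b' : 'I_s -> nat -> bool) : R :=
  \prod_j \prod_(l < L) (1 + (-1) ^+ b j l * (-1) ^+ b' j l).

Lemma wkernelE s L (b b' : 'I_s -> nat -> bool) :
  wkernel L b b' = \sum_(k : {ffun 'I_s -> {set 'I_L}}) chi k b * chi k b'.
Proof.
rewrite /wkernel; under eq_bigr => j _.
  under eq_bigr => l _ do rewrite addrC.
  rewrite bigA_distr.
  over.
rewrite bigA_distr_bigA; apply: eq_bigr => k _.
rewrite /chi -big_split /=; apply: eq_bigr => j _.
rewrite /chi1 -big_split /= [RHS]big_mkcond; apply: eq_bigr => l _.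
by [].
Qed.

Lemma wkernel_ge0 s L (b b' : 'I_s -> nat -> bool) : 0 <= wkernel L b b'.
Proof.
apply: prodr_ge0 => j _; apply: prodr_ge0 => l _.
by case: (b j l); case: (b' j l); rewrite ?expr0 ?expr1; lra.
Qed.

Lemma wkernel_neq0 s L (b b' : 'I_s -> nat -> bool) :
  wkernel L b b' != 0 -> forall j (l : 'I_L), b j l = b' j l.
Proof.
move/prodf_neq0 => h j l; have /prodf_neq0/(_ l isT) := h j isT.
by case: (b j l); case: (b' j l); rewrite ?expr0 ?expr1 ?mulN1r ?mul1r ?subrr ?eqxx.
Qed.

Lemma wkernelC s L (b b' : 'I_s -> nat -> bool) : wkernel L b b' = wkernel L b' b.
Proof. by apply: eq_bigr => j _; apply: eq_bigr => l _; rewrite mulrC. Qed.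

End walsh.

Section orthonormal.
Context {R : realFieldType} {s L : nat} {T : finType}.
Variable B : T -> 'I_s -> nat -> bool.
Hypothesis T0 : (0 < #|T|)%N.
Hypothesis avg_chi : forall k : {ffun 'I_s -> {set 'I_L}},
  avg (fun t => chi k (B t)) = (k == [ffun _ => finset.set0])%:R :> R.

Lemma avg_wkernel b : avg (fun t => wkernel L b (B t)) = 1 :> R.
Proof.
rewrite (eq_avg (fun t => wkernelE L b (B t))) avg_sum.
under eq_bigr do rewrite avgZ avg_chi.
rewrite (bigD1 [ffun _ => finset.set0]) //= eqxx mulr1 chi0 big1 ?addr0 // => k /negPf ->.
by rewrite mulr0.
Qed.

Lemma avg_sq_wkernel (a : T -> R) :
  avg (fun t => avg (fun t' => a t ^+ 2 * wkernel L (B t) (B t'))) = avg (fun t => a t ^+ 2).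
Proof. by apply: eq_avg => t; rewrite avgZ avg_wkernel mulr1. Qed.

(** Schur's test: by [wkernelE] the left side is the quadratic form of a nonnegative symmetric
    kernel whose row averages are all 1. *)
Lemma bessel (a : T -> R) :
  \sum_(k : {ffun 'I_s -> {set 'I_L}}) avg (fun t => a t * chi k (B t)) ^+ 2
    <= avg (fun t => a t ^+ 2).
Proof.
have -> : \sum_(k : {ffun 'I_s -> {set 'I_L}}) avg (fun t => a t * chi k (B t)) ^+ 2 =
    avg (fun t => avg (fun t' => a t * a t' * wkernel L (B t) (B t'))).
  transitivity (avg (fun t => \sum_(k : {ffun 'I_s -> {set 'I_L}})
     a t * chi k (B t) * avg (fun t' => a t' * chi k (B t')))).
    rewrite avg_sum; apply: eq_bigr => k _; rewrite expr2 -avgZ; apply: eq_avg => t.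
    by rewrite mulrC.
  apply: eq_avg => t; under eq_bigr do rewrite -avgZ.
  rewrite -avg_sum; apply: eq_avg => t'; rewrite wkernelE mulr_sumr.
  by apply: eq_bigr => k _; rewrite mulrACA.
have swap : avg (fun t => avg (fun t' => a t' ^+ 2 * wkernel L (B t) (B t'))) =
    avg (fun t => a t ^+ 2).
  rewrite -avg_sq_wkernel /avg -!mulr_sumr exchange_big; congr (_ * (_ * _)).
  by apply: eq_bigr => t _; apply: eq_bigr => t' _; rewrite wkernelC.
(* AM-GM: [2 a t a t' <= a t ^+ 2 + a t' ^+ 2], against a nonnegative kernel. *)
rewrite -(ler_pM2l (ltr0n R 2)) [leRHS]mulr_natl mulr2n.
rewrite -[X in _ <= X + _]avg_sq_wkernel -[X in _ <= _ + X]swap -avgD -avgZ.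
apply: avg_le => t; rewrite -avgD -avgZ; apply: avg_le => t'.
rewrite -mulrDl mulrA ler_wpM2r ?wkernel_ge0 //.
have := sqr_ge0 (a t - a t'); lra.
Qed.

(** With F the Walsh sum, the average of F^2 is the pairing of [d] with the coefficients of F. By
    AM-GM and [bessel] it is at most half of the right side plus half of itself. It bounds second
    moments over the digital shift. *)
Lemma bessel_dual (d : {ffun 'I_s -> {set 'I_L}} -> R) :
  avg (fun t => (\sum_k d k * chi k (B t)) ^+ 2) <= \sum_k d k ^+ 2.
Proof.
set F := fun t => \sum_k d k * chi k (B t).
have := bessel F; set S := \sum_k avg _ ^+ 2 => hS.
have hF : avg (fun t => F t ^+ 2) = \sum_k d k * avg (fun t => F t * chi k (B t)).
  under [RHS]eq_bigr do rewrite -avgZ.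
  rewrite -avg_sum; apply: eq_avg => t; rewrite expr2 {1}/F mulr_suml.
  by apply: eq_bigr => k _; rewrite mulrAC -mulrA.
rewrite [leLHS]hF; rewrite hF in hS.
have : 2 * \sum_k d k * avg (fun t => F t * chi k (B t)) <= \sum_k d k ^+ 2 + S.
  rewrite mulr_sumr -big_split /=; apply: ler_sum => k _.
  move: (d k) (avg _) => x y; have := sqr_ge0 (x - y); nra.
by lra.
Qed.

End orthonormal.

(** * Digit flips and summation by parts *)

(* The digit of weight 2 ^- l.+1 of p / 2 ^ N. *)
Definition bit (N p l : nat) : bool := odd (p %/ 2 ^ (N - l.+1)).

Definition flip (N l p : nat) : nat :=
  if bit N p l then (p - 2 ^ (N - l.+1))%N else (p + 2 ^ (N - l.+1))%N.

Lemma expn_half N l : (l < N)%N -> (2 ^ (N - l) = 2 * 2 ^ (N - l.+1))%N.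
Proof. by move=> h; rewrite -expnS; congr (2 ^ _)%N; lia. Qed.

Lemma bit_coarser N p p' l l' : (l' < l)%N ->
  (p %/ 2 ^ (N - l) = p' %/ 2 ^ (N - l))%N -> bit N p l' = bit N p' l'.
Proof.
move=> hl e; rewrite /bit.
have -> : (N - l'.+1 = (N - l) + ((N - l'.+1) - (N - l)))%N by lia.
by rewrite expnD !divnMA e.
Qed.

Lemma divn_parity (p H : nat) : (0 < H)%N ->
  (p = (p %/ (2 * H)) * (2 * H) + odd (p %/ H) * H + p %% H)%N.
Proof.
move=> H0; rewrite {1}(divn_eq p H); congr addn.
rewrite (mulnC 2) divnMA divn2 {1}(divn_eq (p %/ H) 2) modn2 divn2.
by rewrite mulnDl -mulnA (mulnC 2).
Qed.

Lemma flipE N l p : (l < N)%N ->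
  flip N l p = ((p %/ 2 ^ (N - l)) * 2 ^ (N - l)
    + ~~ bit N p l * 2 ^ (N - l.+1) + p %% 2 ^ (N - l.+1))%N.
Proof.
move=> hl; rewrite /flip (expn_half hl).
have H0 : (0 < 2 ^ (N - l.+1))%N by rewrite expn_gt0.
have := divn_parity p H0; rewrite /bit; set H := (2 ^ (N - l.+1))%N.
move: (_ * (2 * H))%N (p %% H)%N => c r.
by case: odd => /= ->; rewrite ?mul0n ?mul1n ?addn0; lia.
Qed.

Lemma decomp_div (H c r : nat) (b : bool) : (r < H)%N ->
  ((c * (2 * H) + b * H + r) %/ (2 * H) = c)%N.
Proof.
move=> h; rewrite -addnA divnMDl; last by lia.
by rewrite divn_small ?addn0 //; case: b => /=; lia.
Qed.

Lemma decomp_mod (H c r : nat) (b : bool) : (r < H)%N ->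
  ((c * (2 * H) + b * H + r) %% H = r)%N.
Proof.
by move=> h; rewrite mulnA -mulnDl modnMDl modn_small.
Qed.

Lemma decomp_odd (H c r : nat) (b : bool) : (r < H)%N ->
  odd ((c * (2 * H) + b * H + r) %/ H) = b.
Proof.
move=> h; rewrite mulnA -mulnDl divnMDl; last by lia.
by rewrite divn_small // addn0 oddD oddM andbF oddb.
Qed.

Section flip.
Variables N l : nat.
Hypothesis hl : (l < N)%N.

Let r_lt p : (p %% 2 ^ (N - l.+1) < 2 ^ (N - l.+1))%N.
Proof. by rewrite ltn_pmod ?expn_gt0. Qed.

Lemma flip_div p : (flip N l p %/ 2 ^ (N - l) = p %/ 2 ^ (N - l))%N.
Proof. by rewrite flipE // [in LHS](expn_half hl) decomp_div // -(expn_half hl). Qed.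

Lemma flip_mod p : (flip N l p %% 2 ^ (N - l.+1) = p %% 2 ^ (N - l.+1))%N.
Proof. by rewrite flipE // [in LHS](expn_half hl) decomp_mod. Qed.

Lemma bit_flip p : bit N (flip N l p) l = ~~ bit N p l.
Proof. by rewrite flipE // [in LHS](expn_half hl) /bit decomp_odd. Qed.

Lemma flipK : involutive (flip N l).
Proof.
move=> p; rewrite (flipE _ hl) flip_div bit_flip flip_mod negbK /bit (expn_half hl).
by rewrite -divn_parity ?expn_gt0.
Qed.

Lemma flip_lt p : (p < 2 ^ N)%N -> (flip N l p < 2 ^ N)%N.
Proof.
move=> hp; have e : (2 ^ N = 2 ^ l * 2 ^ (N - l))%N by rewrite -expnD; congr (2 ^ _)%N; lia.
by rewrite e -ltn_divLR ?expn_gt0 // flip_div ltn_divLR ?expn_gt0 // -e.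
Qed.

Definition flipo (p : 'I_(2 ^ N)) : 'I_(2 ^ N) := insubd p (flip N l p).

Lemma val_flipo (p : 'I_(2 ^ N)) : flipo p = flip N l p :> nat.
Proof. by rewrite val_insubd flip_lt ?ltn_ord. Qed.

Lemma flipoK : involutive flipo.
Proof. by move=> p; apply: val_inj; rewrite /= !val_flipo flipK. Qed.

End flip.

Lemma bit_flip_coarser N l l' p : (l < N)%N -> (l' < l)%N ->
  bit N (flip N l p) l' = bit N p l'.
Proof. by move=> hl hl'; apply: bit_coarser hl' _; rewrite flip_div. Qed.

Section grid_orthogonality.
Context {R : realFieldType}.

(** Flipping the finest digit in [k] permutes the grid and negates every term. It is taken finest so
    that the other digits in [k] are coarser and [bit_flip_coarser] applies to them. *)
Lemma sum_chi1 N L (k : {set 'I_L}) : (L <= N)%N -> k != finset.set0 ->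
  \sum_(t < 2 ^ N) chi1 k (bit N t) = 0 :> R.
Proof.
move=> LN /finset.set0Pn[l0 kl0].
have [l kl lmax] := @arg_maxnP _ l0 (mem k) (@nat_of_ord L) kl0.
have hl : (l < N)%N by apply: leq_trans LN.
set S := \sum_(t < _) _; suff : S + S = 0.
  by move/eqP; rewrite -mulr2n mulrn_eq0 => /eqP.
rewrite {2}/S (reindex_inj (can_inj (flipoK hl))) -big_split big1 //= => t _.
have chi1D1 b : chi1 k b = (-1) ^+ b l * \prod_(i in k | i != l) (-1) ^+ b i :> R.
  by rewrite /chi1 (bigD1 l).
rewrite !chi1D1 !val_flipo // bit_flip //.
have -> : \prod_(i in k | i != l) (-1) ^+ bit N (flip N l t) i =
   \prod_(i in k | i != l) (-1) ^+ bit N t i :> R.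
  apply: eq_bigr => i /andP[ki il]; rewrite bit_flip_coarser //.
  by have := lmax _ ki; rewrite -val_eqE /= in il *; rewrite ltn_neqAle il.
by rewrite -mulrDl; case: bit; rewrite ?expr0 ?expr1 ?addNr ?subrr mul0r.
Qed.

Lemma avg_ffun_prod (I J : finType) (F : I -> J -> R) :
  avg (fun p : {ffun I -> J} => \prod_j F j (p j)) = \prod_j avg (F j).
Proof.
rewrite /avg -bigA_distr_bigA card_ffun big_split /= prodr_const.
by rewrite natrX exprVn.
Qed.

Lemma avg_chi_grid N s L (k : {ffun 'I_s -> {set 'I_L}}) : (L <= N)%N ->
  avg (fun p : {ffun 'I_s -> 'I_(2 ^ N)} => chi k (fun j => bit N (p j)))
   = (k == [ffun _ => finset.set0])%:R :> R.
Proof.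
move=> LN; rewrite /chi (avg_ffun_prod (fun j (t : 'I_(2 ^ N)) => chi1 (k j) (bit N t))).
have [->|kn0] := eqVneq k.
  rewrite big1 // => j _; rewrite ffunE -[RHS](@avg_const _ 'I_(2 ^ N)) ?card_ord ?expn_gt0 //.
  by apply: eq_avg => t; rewrite /chi1 big_set0.
have [j kj] : exists j, k j != finset.set0.
  apply/existsP; rewrite -negb_forall; apply: contra kn0 => /forallP h.
  by apply/eqP/ffunP => j; rewrite ffunE; apply/eqP/h.
by rewrite (bigD1 j) //= /avg sum_chi1 // mulr0 mul0r.
Qed.

End grid_orthogonality.

Section summation_by_parts.
Context {R : realFieldType}.

Lemma abel_sum (h V : nat -> R) n : V 0%N = 0 ->
  \sum_(q < n) h q * (V q.+1 - V q) =
  h n * V n - \sum_(q < n) (h q.+1 - h q) * V q.+1.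
Proof.
move=> V0; elim: n => [|n IH]; first by rewrite !big_ord0 V0 mulr0 subr0.
by rewrite !big_ord_recr /= IH; ring.
Qed.

(** The discrete primitive of [w] times one period of a square wave, which is 1 on the first H
    points and -1 on the next H. *)
Definition haar_primitive (H : nat) (w : nat -> R) (n : nat) : R :=
  \sum_(y < n) (-1) ^+ (H <= y)%N * w y.

(** For H-periodic [w] the primitive vanishes at the end of the period 2H, so it extends
    periodically. Division by H brings the values back into [0, 1], so that a tent can serve as the
    weight of the next summation by parts. For w = 1 this is the usual tent function. *)
Definition tent (H : nat) (w : nat -> R) (p : nat) : R :=
  haar_primitive H w (p %% (2 * H)).+1 / H%:R.

Variables (H : nat) (w : nat -> R).
Hypotheses (H0 : (0 < H)%N) (w_periodic : forall y, w (y + H)%N = w y)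
  (w01 : forall y, 0 <= w y <= 1).

Lemma haar_primitive_low n : (n <= H)%N -> haar_primitive H w n = \sum_(y < n) w y.
Proof.
move=> nH; apply: eq_bigr => y _; rewrite leqNgt (leq_trans (ltn_ord y)) //.
by rewrite mul1r.
Qed.

Lemma haar_primitive_high n :
  haar_primitive H w (H + n) = \sum_(y < H) w y - \sum_(y < n) w y.
Proof.
elim: n => [|n IH]; first by rewrite addn0 big_ord0 subr0 haar_primitive_low.
rewrite addnS /haar_primitive big_ord_recr /= -/(haar_primitive H w _) IH.
by rewrite leq_addr expr1 [in RHS]big_ord_recr /= addnC w_periodic; ring.
Qed.

Lemma haar_primitive_end : haar_primitive H w (2 * H) = 0.
Proof. by rewrite mul2n -addnn haar_primitive_high subrr. Qed.

Lemma sum_w_bounds n : 0 <= \sum_(y < n) w y <= n%:R.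
Proof.
apply/andP; split; first by apply: sumr_ge0 => y _; case/andP: (w01 y).
apply: (@le_trans _ _ (\sum_(y < n) 1)); last by rewrite sumr_const card_ord.
by apply: ler_sum => y _; case/andP: (w01 y).
Qed.

Lemma haar_primitive_bounds n : (n <= 2 * H)%N -> 0 <= haar_primitive H w n <= H%:R.
Proof.
move=> n2H; case: (leqP n H) => nH.
  rewrite haar_primitive_low //; case/andP: (sum_w_bounds n) => -> h /=.
  by rewrite (le_trans h) // ler_nat.
have mono a b : (a <= b)%N -> \sum_(y < a) w y <= \sum_(y < b) w y.
  move/subnKC <-; rewrite big_split_ord /= lerDl sumr_ge0 // => y _.
  by case/andP: (w01 (a + y)).
rewrite -(subnKC (ltnW nH)) haar_primitive_high.
have /andP[a b] := sum_w_bounds H; have /andP[c d] := sum_w_bounds (n - H).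
apply/andP; split; last by lra.
by rewrite subr_ge0 mono //; lia.
Qed.

Let H1 : (0 : R) < H%:R. Proof. by rewrite ltr0n. Qed.

Lemma tent_bounds p : 0 <= tent H w p <= 1.
Proof.
have /haar_primitive_bounds /andP[a b] : ((p %% (2 * H)).+1 <= 2 * H)%N.
  by rewrite ltn_pmod // muln_gt0.
by rewrite /tent divr_ge0 ?ler0n //= ler_pdivrMr // mul1r.
Qed.

Lemma tent_last p : (p %% (2 * H)).+1 = (2 * H)%N -> tent H w p = 0.
Proof. by move=> e; rewrite /tent e haar_primitive_end mul0r. Qed.

(** An increment is a value of [w] divided by H, up to sign. Across the end of a period the same
    holds because the last value is 0. *)
Lemma tent_lip p : `|tent H w p.+1 - tent H w p| <= H%:R^-1.
Proof.
have norm_w e y : `|(-1) ^+ e * w y| <= 1.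
  by rewrite normrM normrX normrN1 expr1n mul1r ger0_norm; case/andP: (w01 y).
have [e|ne] := eqVneq (p %% (2 * H)).+1 (2 * H)%N.
  rewrite (tent_last e) subr0 /tent.
  have -> : (p.+1 %% (2 * H) = 0)%N by rewrite -addn1 -modnDml addn1 e modnn.
  rewrite /haar_primitive big_ord_recl big_ord0 addr0 normrM normfV (ger0_norm (ltW H1)).
  by rewrite ler_piMl ?invr_ge0 ?(ltW H1) ?norm_w.
have -> : tent H w p.+1 = tent H w p + (-1) ^+ (H <= (p %% (2 * H)).+1)%N * w (p %% (2 * H)).+1 / H%:R.
  have e : (p.+1 %% (2 * H) = (p %% (2 * H)).+1)%N.
    rewrite -addn1 -modnDml addn1 modn_small //.
    by rewrite ltn_neqAle ne ltn_pmod // muln_gt0.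
  by rewrite /tent e /haar_primitive big_ord_recr /= mulrDl.
rewrite addrAC subrr add0r normrM normfV (ger0_norm (ltW H1)).
by rewrite ler_piMl ?invr_ge0 ?(ltW H1) ?norm_w.
Qed.

Lemma sum_parts_block (h : nat -> R) :
  \sum_(q < 2 * H) h q * ((-1) ^+ (H <= q)%N * w q) =
  - (H%:R * \sum_(q < 2 * H) (h q.+1 - h q) * tent H w q).
Proof.
have V0 : haar_primitive H w 0 = 0 by rewrite /haar_primitive big_ord0.
have := abel_sum h (2 * H) V0.
rewrite haar_primitive_end mulr0 sub0r => e.
transitivity (\sum_(q < 2 * H) h q * (haar_primitive H w q.+1 - haar_primitive H w q)).
  apply: eq_bigr => q _; congr (_ * _).
  by rewrite /haar_primitive big_ord_recr /= addrAC subrr add0r.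
rewrite e mulr_sumr; congr (- _); apply: eq_bigr => q _.
by rewrite /tent modn_small //; field; rewrite (lt0r_neq0 H1).
Qed.

(** Abel summation on each period of length 2H: there are no boundary terms since the primitive
    vanishes at both ends, and [c], made of coarser digits, is constant on the period. *)
Lemma summation_by_parts n (h c : nat -> R) :
  (forall p p', (p %/ (2 * H) = p' %/ (2 * H))%N -> c p = c p') ->
  \sum_(p < n * (2 * H)) h p * w p * (-1) ^+ odd (p %/ H) * c p =
  - (H%:R * \sum_(p < n * (2 * H)) (h p.+1 - h p) * tent H w p * c p).
Proof.
move=> hc; elim: n => [|n IH]; first by rewrite mul0n !big_ord0 mulr0 oppr0.
rewrite mulSnr !(@big_split_ord _ _ _ (n * (2 * H)) (2 * H)) /= IH mulrDr opprD; congr (_ + _).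
have w_per k y : w (y + k * H)%N = w y.
  by elim: k => [|k IHk]; rewrite ?addn0 // mulSn addnCA addnC w_periodic.
set m := (n * (2 * H))%N.
have hcm (q : 'I_(2 * H)) : c (m + q)%N = c m.
  by apply: hc; rewrite /m divnMDl ?mulnK ?muln_gt0 // divn_small ?addn0.
transitivity (c m * \sum_(q < 2 * H) h (m + q)%N * ((-1) ^+ (H <= q)%N * w q)).
  rewrite mulr_sumr; apply: eq_bigr => q _; rewrite hcm.
  have -> : w (m + q)%N = w q by rewrite addnC /m mulnA w_per.
  have -> : odd ((m + q) %/ H) = (H <= q)%N.
    rewrite /m mulnA divnMDl // oddD oddM andbF /=.
    case: (leqP H q) => Hq; last by rewrite divn_small.
    rewrite -(subnKC Hq) divnDl // divnn H0 divn_small //.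
    by have := ltn_ord q; lia.
  by ring.
rewrite (sum_parts_block (fun q => h (m + q)%N)) mulrN mulrCA; congr (- (_ * _)).
rewrite mulr_sumr; apply: eq_bigr => q _; rewrite hcm addnS.
have -> : tent H w (m + q)%N = tent H w q by rewrite /tent /m modnMDl.
by ring.
Qed.

End summation_by_parts.

Section iterated_parts.
Context {R : realFieldType}.

(* Midpoints of the dyadic cells: grid points are never 0, so that the boxes
   cut off at the boundary of the cube stay nondegenerate. *)
Definition gridpt (N p : nat) : R := (p%:R + 2^-1) / 2 ^+ N.

(** The weight left after summation by parts in the digits [t]. Lists are increasing, so the finest
    digit, which is treated first, gives the innermost tent. *)
Fixpoint tentw (N : nat) (t : seq nat) : nat -> R :=
  if t is l :: t' then tent (2 ^ (N - l.+1)) (tentw N t') else fun _ => 1.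

(** The outer tent, for digit l', has period 2^(N-l'), which divides 2^(N-l-1) as soon as l < l'. *)
Lemma tentw_periodic N l t : all (ltn l) t -> all (gtn N) t ->
  forall y, tentw N t (y + 2 ^ (N - l.+1)) = tentw N t y.
Proof.
case: t => [//|l' t] /= /andP[ll' _] /andP[l'N _] y; rewrite /tent.
rewrite -(expn_half l'N) (_ : N - l.+1 = (N - l') + (l' - l.+1))%N; last by lia.
by rewrite expnD addnC mulnC modnMDl.
Qed.

Lemma tentw_bounds N t : sorted ltn t -> all (gtn N) t ->
  forall y, 0 <= tentw N t y <= 1.
Proof.
elim: t => [|l t IH] /=; first by rewrite ler01 lexx.
move=> p /andP[lN tN] y; apply: tent_bounds; first by rewrite expn_gt0.
  by apply: tentw_periodic => //; apply: order_path_min p; apply: ltn_trans.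
by move=> z; apply: IH => //; apply: path_sorted p.
Qed.

(** On the grid of mesh 2^-N this is a Lipschitz bound with constant 2^L, the same for every N. The
    extension [mcshane] inherits this constant. *)
Lemma tentw_lip N L t : sorted ltn t -> all (gtn N) t -> all (gtn L) t ->
  forall y, `|tentw N t y.+1 - tentw N t y| <= 2 ^+ L / 2 ^+ N.
Proof.
case: t => [|l t] /=; first by rewrite subrr normr0 mulr_ge0 ?invr_ge0 ?exprn_ge0.
move=> p /andP[lN tN] /andP[lL _] y; apply: le_trans (tent_lip _ _ _ _) _.
- by rewrite expn_gt0.
- by apply: tentw_periodic => //; apply: order_path_min p; apply: ltn_trans.
- by apply: tentw_bounds => //; apply: path_sorted p.
rewrite natrX -[leLHS]mul1r ler_pdivrMr ?exprn_gt0 // mulrAC ler_pdivlMr ?exprn_gt0 //.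
by rewrite mul1r -exprD ler_weXn2l ?ler1n //; lia.
Qed.

Lemma parts_step N l (h h' : R -> R) (w c : nat -> R) (om : R) : (l < N)%N ->
  (forall y, w (y + 2 ^ (N - l.+1))%N = w y) -> (forall y, 0 <= w y <= 1) ->
  (forall p p', (p %/ 2 ^ (N - l) = p' %/ 2 ^ (N - l))%N -> c p = c p') ->
  (forall p, `|c p| <= 1) ->
  (forall t, (t.+1 < 2 ^ N)%N ->
     `|h (gridpt N t.+1) - h (gridpt N t) - h' (gridpt N t) / 2 ^+ N| <= om / 2 ^+ N) ->
  0 <= om ->
  `|avg (fun p : 'I_(2 ^ N) => h (gridpt N p) * w p * (-1) ^+ bit N p l * c p)
    + 2 ^- l.+1 * avg (fun p : 'I_(2 ^ N) =>
        h' (gridpt N p) * tent (2 ^ (N - l.+1)) w p * c p)| <= 2 ^- l.+1 * om.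
Proof.
move=> lN wper w01 hc c1 hh om0; set H := (2 ^ (N - l.+1))%N.
have H0 : (0 < H)%N by rewrite expn_gt0.
have P0 : 0 < (2 : R) ^+ N by rewrite exprn_gt0.
have eN : (2 ^ N = 2 ^ l * (2 * H))%N.
  by rewrite -(expn_half lN) -expnD; congr (2 ^ _)%N; lia.
have eH : 2 ^- l.+1 = H%:R / 2 ^+ N :> R.
  apply: (@mulfI _ (2 ^+ l.+1)); first by rewrite expf_neq0 ?pnatr_eq0.
  rewrite divff ?expf_neq0 ?pnatr_eq0 // mulrA natrX -exprD subnKC // divff ?lt0r_neq0 //.
have hc' p p' : (p %/ (2 * H) = p' %/ (2 * H))%N -> c p = c p'.
  by rewrite -(expn_half lN); apply: hc.
have := summation_by_parts H0 wper (2 ^ l) (fun p => h (gridpt N p)) hc'.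
rewrite -eN => e; rewrite /avg  {1}[X in _ * X]e card_ord natrX eH.
rewrite [X in X + _]mulrC mulNr.
set S2 := \sum_(p < _) _; set S3 := \sum_(p < _) _.
have eS : \sum_(p < 2 ^ N) (h' (gridpt N p) / 2 ^+ N - (h (gridpt N p.+1) - h (gridpt N p)))
     * tent H w p * c p = S3 / 2 ^+ N - S2.
  by rewrite mulr_suml -sumrB; apply: eq_bigr => p _; ring.
have -> : - (H%:R * S2 / 2 ^+ N) + H%:R / 2 ^+ N * ((2 ^+ N)^-1 * S3) =
    H%:R / 2 ^+ N * (S3 / 2 ^+ N - S2) by ring.
rewrite -eS.
have HN : 0 <= H%:R / 2 ^+ N :> R by rewrite divr_ge0 ?(ltW P0).
rewrite normrM (ger0_norm HN) ler_wpM2l //.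
apply: le_trans (ler_norm_sum _ _ _) _.
apply: (@le_trans _ _ (\sum_(p < 2 ^ N) om / 2 ^+ N)); last first.
  by rewrite sumr_const card_ord -[leLHS]mulr_natl natrX mulrC divfK ?lt0r_neq0.
apply: ler_sum => p _; rewrite 2!normrM.
have /andP[t0 t1] := @tent_bounds R H w H0 wper w01 p.
have om0' : 0 <= om / 2 ^+ N by rewrite divr_ge0 ?(ltW P0).
have [pl|pl] := ltnP p.+1 (2 ^ N).
  rewrite -[leRHS]mulr1 ler_pM // ?mulr_ge0 //.
  rewrite (ger0_norm t0) -[leRHS]mulr1 ler_pM //.
  by rewrite distrC hh.
(* At the last grid point the successor lies outside the cube, where [h] is not controlled. The tent
   vanishes there. *)
rewrite (@tent_last _ H) ?normr0 ?mulr0 ?mul0r //.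
have -> : nat_of_ord p = ((2 ^ l).-1 * (2 * H) + (2 * H).-1)%N.
  have e2 : p.+1 = (2 ^ N)%N by apply/eqP; rewrite eqn_leq pl andbT.
  apply: succn_inj; rewrite e2 eN -addnS prednK ?muln_gt0 //.
  by rewrite -mulSnr prednK ?expn_gt0.
by rewrite modnMDl modn_small ?prednK ?muln_gt0 // ltnW // ltnS leq_pred.
Qed.

Lemma parts_iter N (h : nat -> R -> R) (t : seq nat) (c : nat -> R) (om : R) :
  sorted ltn t -> all (gtn N) t ->
  (forall l, l \in t -> forall p p',
     (p %/ 2 ^ (N - l) = p' %/ 2 ^ (N - l))%N -> c p = c p') ->
  (forall p, `|c p| <= 1) ->
  (forall i q, (i < size t)%N -> (q.+1 < 2 ^ N)%N ->
     `|h i (gridpt N q.+1) - h i (gridpt N q) - h i.+1 (gridpt N q) / 2 ^+ N| <= om / 2 ^+ N) ->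
  0 <= om ->
  `|avg (fun p : 'I_(2 ^ N) => h 0%N (gridpt N p) * (\prod_(l <- t) (-1) ^+ bit N p l) * c p)
    - (-1) ^+ size t * (\prod_(l <- t) 2 ^- l.+1) *
      avg (fun p : 'I_(2 ^ N) => h (size t) (gridpt N p) * tentw N t p * c p)|
  <= (size t)%:R * om.
Proof.
move=> st tN hc c1 hh om0; elim: t => [|l t IH] in c st tN hc c1 hh *.
  rewrite /= !big_nil !mul1r mul0r (_ : _ - _ = 0) ?normr0 //.
  by apply/eqP; rewrite subr_eq0; apply/eqP/eq_avg => p; rewrite big_nil.
move: tN => /= /andP[lN tN].
have tl : all (ltn l) t by apply: order_path_min st; apply: ltn_trans.
have st' := path_sorted st.
pose d : R := (-1) ^+ size t * \prod_(l <- t) 2 ^- l.+1.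
have d1 : `|d| <= 1.
  rewrite normrM normrX normrN1 expr1n mul1r normr_prod; apply: prodr_ile1 => i _.
  by rewrite normr_ge0 normfV normrX ger0_norm // invf_le1 ?exprn_gt0 // exprn_ege1 // ler1n.
(* The finer digits come first; the sign of digit [l] is coarser than all of them and is absorbed
   into the factor [c]. *)
have h1 := IH (fun p => (-1) ^+ bit N p l * c p) st' tN.
have {}h1 := h1 _ _ _.
have /= {}h1 : `|avg (fun p : 'I_(2 ^ N) => h 0%N (gridpt N p) * (\prod_(l <- t) (-1) ^+ bit N p l) *
      ((-1) ^+ bit N p l * c p))
    - d * avg (fun p : 'I_(2 ^ N) => h (size t) (gridpt N p) * tentw N t p * ((-1) ^+ bit N p l * c p))|
  <= (size t)%:R * om.
  apply: h1.
  - move=> l' l't p p' e; have ll' := allP tl _ l't; rewrite (bit_coarser ll' e).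
    congr (_ * _); apply: (hc l'); rewrite ?inE ?l't ?orbT //.
  - by move=> p; rewrite normrM normrX normrN1 expr1n mul1r.
  - by move=> i q it; apply: hh; rewrite ltnS ltnW.
have h2 := @parts_step N l (h (size t)) (h (size t).+1) (tentw N t) c om lN
  (tentw_periodic tl tN) (tentw_bounds st' tN) (hc l (mem_head _ _)) c1 (fun q => hh (size t) q (ltnSn _)) om0.
set A1 := avg _ in h1 *; set A2 := avg _ in h1; set A3 := avg _ in h2; set A4 := avg _ in h2.
have -> : avg (fun p : 'I_(2 ^ N) => h 0%N (gridpt N p) * (\prod_(l0 <- l :: t) (-1) ^+ bit N p l0) * c p) = A1.
  by apply: eq_avg => p; rewrite big_cons; ring.
have e23 : A2 = A3 by apply: eq_avg => p; rewrite !mulrA.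
rewrite big_cons exprS -/A4 e23 in h1 *.
rewrite (_ : A1 - _ = (A1 - d * A3) + d * (A3 + 2 ^- l.+1 * A4)); last by rewrite /d; ring.
have -> : (size t).+1%:R * om = (size t)%:R * om + om by rewrite -[in LHS]natr1 mulrDl mul1r.
apply: le_trans (ler_normD _ _) _; rewrite lerD // normrM.
rewrite -[leRHS]mul1r ler_pM //; apply: le_trans h2 _.
by rewrite ler_piMl // invf_le1 ?exprn_gt0 // exprn_ege1 // ler1n.
Qed.

End iterated_parts.

(** * Leading digits *)

Section leading_digits.
Context {L : nat}.
Implicit Types (k : {set 'I_L}) (l : 'I_L).

Definition above k l : {set 'I_L} := [set l' in k | (l < l')%N].

(* Larger positions are finer digits: rank 0 is the finest digit of k. *)
Definition rk k l : nat := #|above k l|.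

Definition tops (a : nat) k : {set 'I_L} := [set l in k | (rk k l <= a)%N].

Definition lead (a : nat) k : {set 'I_L} := [set l in k | (rk k l < a)%N].

Lemma rk_lt k l l' : l' \in k -> (l < l')%N -> (rk k l' < rk k l)%N.
Proof.
move=> kl' ll'; apply: proper_card; apply/fintype.properP; split.
  by apply/fintype.subsetP => x; rewrite !inE => /andP[-> /=]; apply: ltn_trans.
by exists l'; rewrite !inE ?kl' ?ltnn.
Qed.

Lemma rk_inj k : {in k &, injective (rk k)}.
Proof.
move=> l l' kl kl' e; apply: val_inj; case: (ltngtP l l') => // h.
  by have := rk_lt kl' h; rewrite e ltnn.
by have := rk_lt kl h; rewrite e ltnn.
Qed.

Lemma tops_sub a k : tops a k \subset k.
Proof. by apply/fintype.subsetP => l; rewrite inE => /andP[]. Qed.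

Lemma lead_sub_tops a k : lead a k \subset tops a k.
Proof. by apply/fintype.subsetP => l; rewrite !inE => /andP[-> /ltnW]. Qed.

Lemma lead_sub a k : lead a k \subset k.
Proof. exact: fintype.subset_trans (lead_sub_tops a k) (tops_sub a k). Qed.

Lemma rk_tops a k l : l \in tops a k -> rk (tops a k) l = rk k l.
Proof.
rewrite inE => /andP[kl la]; apply: eq_card => x; rewrite !inE.
case kx: (x \in k); case lx: (l < x)%N => //=; rewrite ?andbF //.
by rewrite (leq_trans (ltnW (rk_lt kx lx))).
Qed.

Lemma topsK a k : tops a (tops a k) = tops a k.
Proof.
apply/finset.setP => l; rewrite [LHS]inE; case tl: (l \in tops a k) => //=.
by rewrite rk_tops //; move: tl; rewrite inE => /andP[].
Qed.

Lemma lead_tops a k : lead a (tops a k) = lead a k.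
Proof.
apply/finset.setP => l; rewrite [LHS]inE [RHS]inE.
case tl: (l \in tops a k) => /=.
  by rewrite rk_tops //; move: tl; rewrite inE => /andP[->].
by apply/esym/negP => /andP[kl h]; move: tl; rewrite inE kl (ltnW h).
Qed.

Lemma below_lead a k l l' : l \in k -> l \notin lead a k -> l' \in lead a k -> (l < l')%N.
Proof.
move=> kl; rewrite !inE kl /= -leqNgt => al /andP[kl' l'a].
case: (ltngtP l l') => // h; last by move: l'a; rewrite -(val_inj h) ltnNge al.
by have := ltn_trans (rk_lt kl h) l'a; rewrite ltnNge al.
Qed.

Lemma below_tops a k l l' : l \in k -> l \notin tops a k -> l' \in tops a k -> (l < l')%N.
Proof.
move=> kl; rewrite !inE kl /= -ltnNge => al /andP[kl' l'a].
case: (ltngtP l l') => // h; last by move: l'a; rewrite -(val_inj h) leqNgt al.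
by have := leq_trans (rk_lt kl h) l'a; rewrite ltnNge (ltnW al).
Qed.

Lemma card_lead a k : (#|lead a k| <= a)%N.
Proof.
case: a => [|a].
  by rewrite leqn0 cards_eq0; apply/eqP/finset.setP => l; rewrite !inE ltn0 andbF.
rewrite -[leqRHS]card_ord -(@card_in_image _ _ (fun l => inord (rk k l) : 'I_a.+1)) ?max_card //.
move=> l l'; rewrite !inE => /andP[kl la] /andP[kl' la'] e.
apply: (rk_inj kl kl'); have := congr1 (@nat_of_ord _) e.
by rewrite !inordK.
Qed.

(** Ranks in [k] are consecutive: either none reaches [a], or exactly one digit, the pivot, has rank
    [a]. *)
Lemma lead_full_or_pivot a k :
  lead a k = k \/ exists2 l, tops a k :\: lead a k = [set l]%SET & l \in k.
Proof.
case: (boolP [exists l, (l \in k) && (rk k l == a)]) => [/existsP[l /andP[kl /eqP la]]|].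
  right; exists l => //; apply/finset.setP => x; rewrite !inE.
  apply/idP/eqP => [/andP[h /andP[kx xa]]|->]; last by rewrite kl la ltnn leqnn.
  by apply: (rk_inj kx kl); apply/eqP; rewrite la eqn_leq xa leqNgt; move: h; rewrite kx.
rewrite negb_exists => /forallP none; left; apply/eqP; rewrite finset.eqEsubset lead_sub /=.
apply/fintype.subsetP => l kl; rewrite inE kl /= ltnNge; apply/negP => al.
(* If ranks jumped over [a], let m be the finest digit of rank at least [a]. The next finer digit x
   of [k] has rank exactly one less, still at least [a], against the choice of m. *)
pose Q := [pred x : 'I_L | (x \in k) && (a <= rk k x)%N].
have Ql : Q l by rewrite /= kl.
have [m /andP[km am] mmax] := @arg_maxnP _ l Q (@nat_of_ord L) Ql.
have {}am : (a < rk k m)%N by rewrite ltn_neqAle am andbT eq_sym; have := none m; rewrite km.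
have /card_gt0P[x0 x0m] : (0 < #|above k m|)%N by apply: leq_ltn_trans am.
have [x xm xmin] := @arg_minnP _ x0 (mem (above k m)) (@nat_of_ord L) x0m.
move: xm; rewrite !inE => /andP[kx mx].
have e : above k m = x |: above k x.
  apply/finset.setP => y; rewrite !inE; have [->|yx] := eqVneq y x; first by rewrite kx mx.
  case ky: (y \in k) => //=; apply/idP/idP => [my|xy]; last exact: ltn_trans xy.
  by rewrite ltn_neqAle eq_sym -val_eqE /= in yx *; rewrite yx xmin // !inE ky my.
have : (a <= rk k x)%N by move: am; rewrite /rk e cardsU1 !inE ltnn andbF add1n ltnS.
by move=> ax; have := mmax x; rewrite /= kx ax => /(_ isT); rewrite leqNgt mx.
Qed.

(** Sets with the same [a + 1] finest digits differ only below the pivot l, which leaves at most 2^l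
    of them; without a pivot the set is determined. The second alternative records what is needed to
    compare 2^e with the weight of [t]. *)
Lemma card_fiber_tops a (t : {set 'I_L}) :
  exists2 e : nat, (#|[set k | tops a k == t]%SET| <= 2 ^ e)%N &
    e = 0%N \/ exists2 l, tops a t :\: lead a t = [set l]%SET & (e <= l.+1)%N /\ (#|lead a t| = a).
Proof.
have [full|[l tl lt]] := lead_full_or_pivot a t.
  exists 0%N; last by left.
  rewrite expn0 -(cards1 t); apply: subset_leq_card; apply/fintype.subsetP => k; rewrite !inE => /eqP kt.
  have lk : lead a k = t by rewrite -lead_tops kt.
  have [fk|[l tl _]] := lead_full_or_pivot a k; first by rewrite -fk lk.
  by have := finset.set11 l; rewrite -tl lk kt finset.setDv inE.
exists (nat_of_ord l); last first.
  right; exists l => //; split => //.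
  apply/eqP; rewrite eqn_leq card_lead /=.
  have la : rk t l = a.
    have : l \in tops a t :\: lead a t by rewrite tl finset.set11.
    by rewrite !inE lt /= -leqNgt => h; apply/eqP; rewrite eqn_leq andbC.
  apply: (@leq_trans (rk t l)); first (by rewrite la); apply: subset_leq_card; apply/fintype.subsetP => x.
  by rewrite !inE => /andP[tx lx]; rewrite tx /= -la rk_lt.
have h : #|[set x : 'I_L | (x < l)%N]%SET| = l.
  rewrite -[RHS]card_ord -(fintype.card_image (_ : injective (widen_ord (ltnW (ltn_ord l))))).
    apply: eq_card => x; rewrite inE; apply/idP/fintype.imageP => [xl|[y _ ->]]; last exact: (ltn_ord y).
    by exists (Ordinal xl) => //; apply: val_inj.
  by move=> x y e; apply: val_inj; have := congr1 (@nat_of_ord _) e.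
rewrite -[X in (_ <= 2 ^ X)%N]h -card_powerset.
rewrite -(@card_in_imset _ _ (fun k => k :\: t)).
  apply: subset_leq_card; apply/fintype.subsetP => _ /imsetP[k + ->]; rewrite !inE => /eqP kt.
  apply/fintype.subsetP => x; rewrite !inE => /andP[xt kx]; rewrite -kt in xt lt.
  exact: below_tops xt lt.
move=> k k'; rewrite !inE => /eqP kt /eqP k't e.
have sk : t \subset k by rewrite -kt tops_sub.
have sk' : t \subset k' by rewrite -k't tops_sub.
by rewrite -(finset.setID k t) -(finset.setID k' t) e (finset.setIidPr sk) (finset.setIidPr sk').
Qed.

End leading_digits.

(** * Uniform continuity and midpoint sums *)

Section uniform_continuity.
Context {R : realType} {s : nat}.
Implicit Types (f g : 'rV[R]_s -> R) (x y : 'rV[R]_s).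

Definition ucont f : Prop := forall e, 0 < e -> exists2 d, 0 < d &
  forall x y, unit_cube x -> unit_cube y -> (forall j, `|x 0 j - y 0 j| <= d) ->
  `|f x - f y| <= e.

Lemma compact_unit_cube : compact (@unit_cube R s).
Proof.
have := @rV_compact R s (fun _ => `[0, 1]%classic) (fun _ => @segment_compact R 0 1).
by congr compact; apply/seteqP; split => x /= h j; have := h j; rewrite /= in_itv.
Qed.

Lemma continuous_ucont f : {within unit_cube, continuous f} -> ucont f.
Proof.
move=> /subspace_continuousP cf e e0.
have e20 : 0 < e / 2 by rewrite divr_gt0.
have cov := iffRL (near_covering_withinP _) (iffLR (compact_near_coveringP _) compact_unit_cube).
pose P (d : R) x := forall y, unit_cube y -> (forall j, `|x 0 j - y 0 j| <= d) -> `|f x - f y| <= e.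
have : \forall d \near 0^'+, unit_cube `<=` P d.
  apply: cov => x cx.
  have /cvgrPdist_lt/(_ _ e20) := cf _ cx.
  rewrite near_withinE => /nbhs_ballP[d /= d0 hd].
  have d20 : 0 < d / 2 by rewrite divr_gt0.
  exists (ball x (d / 2), [set t | 0 < t < d / 2]) => /=.
    split; first exact: nbhsx_ballx.
    near=> t; apply/andP; split; near: t; [exact: nbhs_right_gt|exact: nbhs_right_lt].
  move=> [x' t] /= [[_ bx'] /andP[t0 td]] cx' y cy hy.
  have h1 : `|f x - f x'| < e / 2.
    apply: hd => //; split => // i j; apply: le_ball (bx' i j); lra.
  have h2 : `|f x - f y| < e / 2.
    apply: hd => //; split => // i j; rewrite (ord1 i).
    have := bx' 0 j; rewrite /ball /= => hb.
    rewrite (_ : x 0 j - y 0 j = (x 0 j - x' 0 j) + (x' 0 j - y 0 j)); last by ring.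
    apply: le_lt_trans (ler_normD _ _) _; have := hy j; lra.
  rewrite (_ : f x' - f y = (f x - f y) - (f x - f x')); last by ring.
  by apply: le_trans (ler_normB _ _) _; lra.
rewrite /at_right near_withinE => /nbhs_ballP[d /= d0 hd].
exists (d / 2); first by rewrite divr_gt0.
move=> x y cx cy hxy; apply: (hd (d / 2)) => //=; last by rewrite divr_gt0.
by rewrite /ball /= sub0r normrN gtr0_norm ?divr_gt0 //; lra.
Unshelve. all: by end_near. Qed.

(** Walk from 0 to x along the segment in n > 1/d steps; each changes [f] by at most 1. *)
Lemma ucont_bounded f : ucont f -> exists2 M, 0 <= M & forall x, unit_cube x -> `|f x| <= M.
Proof.
move=> /(_ 1 ltr01)[d d0 hd].
have [n hn] : exists n : nat, 1 / d < n%:R.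
  by exists (Num.bound (1 / d)); rewrite archi_boundP // divr_ge0 // ltW.
have n0 : 0 < n%:R :> R by apply: le_lt_trans hn; rewrite divr_ge0 // ltW.
have c0 : unit_cube (0 : 'rV[R]_s) by move=> j; rewrite mxE lexx ler01.
exists (`|f 0| + n%:R) => [|x cx]; first by rewrite addr_ge0.
pose z k : 'rV[R]_s := (k%:R / n%:R) *: x.
have cz k : (k <= n)%N -> unit_cube (z k).
  move=> kn j; rewrite mxE; have /andP[x0 x1] := cx j.
  have q1 : k%:R / n%:R <= 1 :> R by rewrite ler_pdivrMr // mul1r ler_nat.
  have q0 : 0 <= k%:R / n%:R :> R by rewrite divr_ge0.
  by rewrite mulr_ge0 //= mulr_ile1.
have hz k : (k <= n)%N -> `|f (z k)| <= `|f 0| + k%:R.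
  elim: k => [|k IH] kn; first by rewrite /z mul0r scale0r addr0.
  rewrite -natr1 addrA (_ : f _ = f (z k) + (f (z k.+1) - f (z k))); last by ring.
  apply: le_trans (ler_normD _ _) _; apply: lerD; first exact/IH/ltnW.
  apply: hd; [exact: cz|exact/cz/ltnW|] => j; rewrite !mxE.
  have /andP[x0 x1] := cx j; have ni0 : 0 <= n%:R^-1 :> R by rewrite invr_ge0 ltW.
  rewrite (_ : _ - _ = n%:R^-1 * x 0 j); last by rewrite -natr1; ring.
  rewrite ger0_norm ?mulr_ge0 //; apply: (@le_trans _ _ n%:R^-1); first by rewrite ler_piMr.
  by rewrite -(invrK d) lef_pV2 ?posrE ?invr_gt0 // -[leLHS]mul1r ltW.
have := hz n (leqnn n); rewrite /z divff ?scale1r //; exact: lt0r_neq0.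
Qed.

End uniform_continuity.

Section iterated_integrals.
Context {R : realType} {s : nat}.
Implicit Types (f g G : 'rV[R]_s -> R) (x y : 'rV[R]_s) (j : 'I_s).
Local Notation mu := (@lebesgue_measure R).

Definition modulus G (om d : R) : Prop := forall x y, unit_cube x -> unit_cube y ->
  (forall j, `|x 0 j - y 0 j| <= d) -> `|G x - G y| <= om.

Lemma subst_coordE j t x i : subst_coord j t x 0 i = if i == j then t else x 0 i.
Proof. by rewrite mxE. Qed.

Lemma subst_cube j t x : unit_cube x -> 0 <= t <= 1 -> unit_cube (subst_coord j t x).
Proof. by move=> cx t01 i; rewrite subst_coordE; case: eqP. Qed.

Lemma subst_dist j t x y d : 0 <= d -> (forall i, `|x 0 i - y 0 i| <= d) ->
  forall i, `|subst_coord j t x 0 i - subst_coord j t y 0 i| <= d.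
Proof. by move=> d0 h i; rewrite !subst_coordE; case: eqP; rewrite ?subrr ?normr0. Qed.

Lemma subst_dist_same j t t' x i : `|subst_coord j t x 0 i - subst_coord j t' x 0 i| <= `|t - t'|.
Proof. by rewrite !subst_coordE; case: eqP; rewrite ?subrr ?normr0. Qed.

Lemma section_continuous j G x : ucont G -> unit_cube x ->
  {within `[0, 1]%classic, continuous (fun t => G (subst_coord j t x))}.
Proof.
move=> uG cx; apply/subspace_continuousP => t; rewrite /= in_itv /= => t01.
apply/cvgrPdist_le => e e0; have [d d0 hd] := uG _ e0.
rewrite near_withinE; apply/nbhs_ballP; exists d => //= t' tt'.
rewrite in_itv /= => t'01; apply: hd; try exact: subst_cube.
by move=> i; apply: le_trans (subst_dist_same _ _ _ _ _) _; apply/ltW.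
Qed.

Lemma integrable_unit_itv (h : R -> R) : {within `[0, 1]%classic, continuous h} ->
  mu.-integrable `[0, 1] (EFin \o h).
Proof. by apply: continuous_compact_integrable; apply: segment_compact. Qed.

Lemma integrable_cst_itv (i : interval R) (c : R) : (mu [set` i] < +oo)%E ->
  mu.-integrable [set` i] (EFin \o fun=> c).
Proof.
move=> fin; apply: measurable_bounded_integrable => //.
by exists `|c|; split; [exact: num_real|move=> M cM x _; rewrite ltW].
Qed.

Lemma integrable_sub (D : set (measurableTypeR R)) (h h' : R -> R) : measurable D ->
  mu.-integrable D (EFin \o h) -> mu.-integrable D (EFin \o h') ->
  mu.-integrable D (EFin \o (fun t => h t - h' t)).
Proof.
move=> mD ih ih'; have := integrableB mD ih ih'.
by apply: eq_integrable => // t _; rewrite /= EFinB.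
Qed.

Lemma Rintegral_close (a b : itv_bound R) (h : R -> R) (c om : R) :
  (mu [set` Interval a b] < +oo)%E ->
  mu.-integrable [set` Interval a b] (EFin \o h) ->
  (forall t, t \in Interval a b -> `|h t - c| <= om) ->
  `|\int[mu]_(t in [set` Interval a b]) h t - c * fine (mu [set` Interval a b])|
    <= om * fine (mu [set` Interval a b]).
Proof.
move=> fin ih hc; have mI : measurable ([set` Interval a b] : set (measurableTypeR R)) by exact: measurable_itv.
rewrite -!Rintegral_cst //; have ic r := @integrable_cst_itv (Interval a b) r fin.
rewrite -RintegralB //; apply: le_trans (le_normr_Rintegral _ _) _ => //.
  exact: integrable_sub.
apply: le_Rintegral => //.
exact: (integrable_norm (integrable_sub mI ih (ic c))).
Qed.

Lemma Rintegral_unit_dist (h h' : R -> R) (om : R) :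
  {within `[0, 1]%classic, continuous h} -> {within `[0, 1]%classic, continuous h'} ->
  (forall t : R, 0 <= t <= 1 -> `|h t - h' t| <= om) ->
  `|\int[mu]_(t in `[0, 1]) h t - \int[mu]_(t in `[0, 1]) h' t| <= om.
Proof.
move=> ch ch' hh; have [ih ih'] := (integrable_unit_itv ch, integrable_unit_itv ch').
rewrite -RintegralB //.
have fin : (mu `[0%R, 1%R]%classic < +oo)%E by rewrite lebesgue_measure_itv /= lte01 ltry.
have := @Rintegral_close (BLeft 0) (BRight 1) (fun t => h t - h' t) 0 om fin.
rewrite mul0r subr0 lebesgue_measure_itv /= lte01 /= oppr0 addr0 mulr1; apply.
  exact: integrable_sub.
by move=> t; rewrite in_itv /= addr0; apply: hh.
Qed.

Lemma gridpt_itv N (p : nat) : (p < 2 ^ N)%N -> 0 < (gridpt N p : R) < 1.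
Proof.
move=> pN; have P0 : 0 < (2 : R) ^+ N by rewrite exprn_gt0.
have p1 : p%:R + 1 <= 2 ^+ N :> R by rewrite natr1 -natrX ler_nat.
have p0 : 0 <= p%:R :> R by [].
by rewrite divr_gt0 ?ltr_pdivrMr //=; lra.
Qed.

Lemma riemann_midpoint N (h : R -> R) (om : R) :
  {within `[0, 1]%classic, continuous h} ->
  (forall t t' : R, 0 <= t <= 1 -> 0 <= t' <= 1 -> `|t - t'| <= 2 ^- N -> `|h t - h t'| <= om) ->
  `|\int[mu]_(t in `[0, 1]) h t - avg (fun p : 'I_(2 ^ N) => h (gridpt N p))| <= om.
Proof.
move=> ch hom; have ih := integrable_unit_itv ch.
have P0 : 0 < (2 : R) ^+ N by rewrite exprn_gt0.
suff step k : (k <= 2 ^ N)%N ->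
   `|\int[mu]_(t in `[0, k%:R / 2 ^+ N]) h t - (\sum_(p < k) h (gridpt N p)) / 2 ^+ N|
      <= k%:R * om / 2 ^+ N.
  have := step _ (leqnn _); rewrite natrX divff ?lt0r_neq0 // mulrAC divff ?lt0r_neq0 // mul1r.
  by rewrite /avg card_ord natrX mulrC.
elim: k => [|k IH] kN; first by rewrite !mul0r big_ord0 mul0r set_itv1 Rintegral_set1 subrr normr0.
have {IH} := IH (ltnW kN); set I0 := \int[mu]_(t in _) _ => IH.
have kk : k%:R / 2 ^+ N < k.+1%:R / 2 ^+ N :> R by rewrite ltr_pM2r ?invr_gt0 // ltr_nat.
have k1 : k.+1%:R / 2 ^+ N <= 1 :> R by rewrite ler_pdivrMr // mul1r -natrX ler_nat.
have k0 : 0 <= k%:R / 2 ^+ N :> R by rewrite divr_ge0 ?(ltW P0).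
have ih1 : mu.-integrable `[0, k.+1%:R / 2 ^+ N] (EFin \o h).
  by apply: integrableS ih => //; apply: subset_itvl; rewrite bnd_simp.
have := Rintegral_itvB ih1 (_ : (BLeft 0 <= BRight (k%:R / 2 ^+ N))%O) (_ : (BRight (k%:R / 2 ^+ N) <= _)%O).
rewrite !bnd_simp k0 ltW // => /(_ isT isT); rewrite -/I0 => eI.
have muI : fine (mu `](k%:R / 2 ^+ N), (k.+1%:R / 2 ^+ N)]%classic) = 2 ^- N.
  by rewrite lebesgue_measure_itv /= lte_fin kk /= -natr1; ring.
have finI : (mu `](k%:R / 2 ^+ N)%R, (k.+1%:R / 2 ^+ N)%R]%classic < +oo)%E.
  by rewrite lebesgue_measure_itv /= lte_fin kk ltry.
have := @Rintegral_close (BRight (k%:R / 2 ^+ N)) (BRight (k.+1%:R / 2 ^+ N)) h (h (gridpt N k)) om finI.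
rewrite -eI muI => H.
have {}H : `|\int[mu]_(t in `[0, k.+1%:R / 2 ^+ N]) h t - I0 - h (gridpt N k) / 2 ^+ N| <= om / 2 ^+ N.
  apply: H => [|t]; first by apply: integrableS ih1 => //; apply: subset_itvr; rewrite bnd_simp.
  rewrite in_itv /= => /andP[t1 t2]; apply: hom.
  - by apply/andP; split; [apply/ltW; apply: le_lt_trans t1|apply: le_trans k1].
  - by have /andP[/ltW-> /ltW->] := gridpt_itv kN.
  have g1 : gridpt N k = k%:R / 2 ^+ N + 2 ^- N / 2 :> R by rewrite /gridpt; field; rewrite lt0r_neq0.
  have g2 : k.+1%:R / 2 ^+ N = k%:R / 2 ^+ N + 2 ^- N :> R by rewrite -natr1; ring.
  have q0 : 0 < 2 ^- N :> R by rewrite invr_gt0.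
  by rewrite ler_norml g1; rewrite g2 in t2; apply/andP; split; lra.
rewrite big_ord_recr /=.
move: H IH; set I1 := \int[mu]_(t in _) _; set S := \sum_(i < k) _ => H IH.
rewrite (_ : I1 - _ = (I1 - I0 - h (gridpt N k) / 2 ^+ N) + (I0 - S / 2 ^+ N)); last by ring.
rewrite (_ : _ * om / _ = om / 2 ^+ N + k%:R * om / 2 ^+ N); last by rewrite -natr1; ring.
by apply: le_trans (ler_normD _ _) _; apply: lerD.
Qed.

Lemma modulus_int_coord j G om d : 0 <= d -> ucont G -> modulus G om d ->
  modulus (int_coord j G) om d.
Proof.
move=> d0 uG mG x y cx cy xy; apply: Rintegral_unit_dist; try exact: section_continuous.
by move=> t t01; apply: mG; try exact: subst_cube; exact: subst_dist.
Qed.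

Lemma ucont_int_coord j G : ucont G -> ucont (int_coord j G).
Proof.
move=> uG e e0; have [d d0 hd] := uG e e0; exists d => // x y cx cy xy.
exact: (@modulus_int_coord j G e d (ltW d0) uG hd x y cx cy xy).
Qed.

Lemma ucont_fold G v : ucont G -> ucont (foldr int_coord G v).
Proof. by move=> uG; elim: v => //= j v; apply: ucont_int_coord. Qed.

Lemma modulus_fold G v om d : 0 <= d -> ucont G -> modulus G om d ->
  modulus (foldr int_coord G v) om d.
Proof.
move=> d0 uG mG; elim: v => //= j v; apply: modulus_int_coord => //; exact: ucont_fold.
Qed.

Definition gridrow N (p : {ffun 'I_s -> 'I_(2 ^ N)}) : 'rV[R]_s := \row_j gridpt N (p j).

Lemma gridrow_cube N p : unit_cube (@gridrow N p).
Proof. by move=> j; rewrite mxE; have /andP[/ltW-> /ltW->] := gridpt_itv (ltn_ord (p j)). Qed.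

Lemma gridrow_upd N (p : {ffun 'I_s -> 'I_(2 ^ N)}) j t :
  gridrow (upd p j t) = subst_coord j (gridpt N t) (gridrow p).
Proof. by apply/rowP => i; rewrite !mxE ffunE; case: eqP. Qed.

(** Each coordinate of [v] costs one midpoint error [om]: [psi] is constant in it, and integrating
    in one coordinate preserves the modulus of continuity for the next. *)
Lemma avg_fold_int_coord N G (v : seq 'I_s) om (psi : {ffun 'I_s -> 'I_(2 ^ N)} -> R) :
  ucont G -> modulus G om (2 ^- N) -> (forall p, `|psi p| <= 1) ->
  (forall p j t, j \in v -> psi (upd p j t) = psi p) ->
  `|avg (fun p => G (gridrow p) * psi p)
    - avg (fun p => foldr int_coord G v (gridrow p) * psi p)| <= (size v)%:R * om.
Proof.
move=> uG mG psi1; have N0 : 0 <= 2 ^- N :> R by rewrite invr_ge0 exprn_ge0.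
have card0 : (0 < #|'I_(2 ^ N)|)%N by rewrite card_ord expn_gt0.
have card1 : (0 < #|{ffun 'I_s -> 'I_(2 ^ N)}|)%N by rewrite card_ffun expn_gt0 card0.
elim: v => [|j v IH] hpsi; first by rewrite /= subrr normr0 mul0r.
have {}IH : `|avg (fun p => G (gridrow p) * psi p)
    - avg (fun p => foldr int_coord G v (gridrow p) * psi p)| <= (size v)%:R * om.
  by apply: IH => p i t iv; apply: hpsi; rewrite inE iv orbT.
rewrite /=; set F := foldr int_coord G v in IH *.
have uF : ucont F by exact: ucont_fold.
have mF : modulus F om (2 ^- N) by exact: modulus_fold.
have -> : (size v).+1%:R * om = (size v)%:R * om + om by rewrite -[in LHS]natr1 mulrDl mul1r.
set A := avg _ in IH *; set B := avg _ in IH; set C := avg _.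
rewrite (_ : A - C = (A - B) + (B - C)); last by ring.
apply: le_trans (ler_normD _ _) _; apply: lerD => //.
rewrite /B (avg_upd j) // /C -avgB; apply: norm_avg_le => // p.
have -> : avg (fun t => F (gridrow (upd p j t)) * psi (upd p j t)) =
  psi p * avg (fun t : 'I_(2 ^ N) => F (subst_coord j (gridpt N t) (gridrow p))).
  by rewrite -avgZ; apply: eq_avg => t; rewrite gridrow_upd hpsi ?mem_head // mulrC.
rewrite mulrC -mulrBl mulrC normrM -[leRHS]mul1r ler_pM //.
rewrite distrC; apply: riemann_midpoint.
  by apply: section_continuous => //; apply: gridrow_cube.
move=> t t' t01 t'01 tt'; apply: mF; try by apply: subst_cube => //; apply: gridrow_cube.
by move=> i; apply: le_trans tt'; apply: subst_dist_same.
Qed.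

Lemma fold_int_coord_local G v x y : (forall i, i \notin v -> x 0 i = y 0 i) ->
  foldr int_coord G v x = foldr int_coord G v y.
Proof.
elim: v x y => [|j v IH] x y h /=; first by congr G; apply/rowP => i; apply: h.
apply: eq_Rintegral => t _; apply: IH => i iv; rewrite !subst_coordE.
by case: eqP => // /eqP ij; apply: h; rewrite inE negb_or ij.
Qed.

End iterated_integrals.

(** * Fractional variation on dyadic grids *)

Section increasing_breakpoints.
Context {R : realFieldType}.
Variables (b : nat -> R) (n : nat).
Hypothesis b_incr : forall i, (i <= n)%N -> b i < b i.+1.

Lemma breakpoints_mono i j : (i < j)%N -> (j <= n.+1)%N -> b i < b j.
Proof.
elim: j => // j IH; rewrite ltnS leq_eqVlt => /predU1P[->|ij] jn; first exact: b_incr.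
by apply: lt_trans (b_incr _) => //; apply: IH => //; apply: ltnW.
Qed.

Lemma breakpoints_cover x : b 0%N <= x < b n.+1 ->
  exists2 i, (i <= n)%N & b i <= x < b i.+1.
Proof.
elim: n => [|m IH] /andP[x0 x1]; first by exists 0%N => //; rewrite x0.
have [xm|xm] := ltP x (b m.+1); last by exists m.+1 => //; rewrite xm.
by have [|i im hi] := IH; [rewrite x0|exists i => //; apply: leqW].
Qed.

Lemma breakpoints_disjoint i j x : (i <= n)%N -> (j <= n)%N ->
  b i <= x < b i.+1 -> b j <= x < b j.+1 -> i = j.
Proof.
have aux i' j' : (j' <= n)%N -> x < b i'.+1 -> b j' <= x -> (j' <= i')%N.
  move=> jn xi xj; rewrite leqNgt; apply/negP => ij.
  suff : b i'.+1 <= b j' by move=> h; have := lt_le_trans xi (le_trans h xj); rewrite ltxx.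
  move: ij; rewrite leq_eqVlt => /predU1P[->//|ij]; apply/ltW/breakpoints_mono => //.
  exact: leqW.
move=> iN jN /andP[xi xi1] /andP[xj xj1].
by apply/eqP; rewrite eqn_leq (aux j i) // (aux i j).
Qed.

End increasing_breakpoints.

Section variation.
Context {R : realType} {s : nat}.
Implicit Types (g : 'rV[R]_s -> R) (u : {set 'I_s}).

(** Only some cells of a partition are of interest, since the cells cut off at the boundary of the
    cube are not grid boxes; hence a finite subfamily, injectively indexed by [A]. *)
Lemma variation_sum (T : finType) (A : {set T}) (J : T -> 'rV[R]_s * 'rV[R]_s)
    (Q : set ('rV[R]_s * 'rV[R]_s)) (lambda : R) u g (V : R) :
  box_partition u Q -> (forall t, t \in A -> Q (J t)) -> {in A &, injective J} ->
  (fractional_variation lambda u g <= V%:E)%E ->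
  \sum_(t in A) volume u (J t) * (`|alt_sum u g (J t) / volume u (J t) `^ lambda|) ^+ 2 <= V ^+ 2.
Proof.
move=> pQ QJ Jinj hV.
pose a t := volume u (J t) * (`|alt_sum u g (J t) / volume u (J t) `^ lambda|) ^+ 2.
rewrite -[leLHS]/(\sum_(t in A) a t).
pose F I : \bar R := (volume u I * (`|alt_sum u g I / volume u I `^ lambda|) ^+ 2)%:E.
have vol0 I : Q I -> 0 <= volume u I.
  by case: pQ => pos _ _ /pos h; apply: prodr_ge0 => j /h; rewrite subr_ge0; apply: ltW.
have S0 : 0 <= \sum_(t in A) a t.
  by apply: sumr_ge0 => t tA; apply: mulr_ge0; [exact/vol0/QJ|exact: sqr_ge0].
have h1 : ((\sum_(t in A) a t)%:E <= \esum_(I in Q) F I)%E.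
  apply: esum_ge; exists [set` [seq J t | t <- enum A]].
    split; first exact: finite_seq.
    by move=> I /= /mapP[t]; rewrite mem_enum => tA ->; apply: QJ.
  rewrite -fsbig_seq ?map_inj_in_uniq ?enum_uniq //; last first.
    by move=> t t'; rewrite !mem_enum; apply: Jinj.
  by rewrite big_map big_enum /= sumEFin.
have h2 : (((\sum_(t in A) a t)%:E `^ 2^-1)%E <= V%:E)%E.
  apply: le_trans hV; apply: le_trans (ereal_sup_ubound _); last by exists Q.
  apply: gt0_ler_poweR => //; rewrite ?in_itv /= ?leey ?lee_fin ?andbT //.
  by apply: le_trans h1; rewrite lee_fin.
move: h2; rewrite poweR_EFin lee_fin powR12_sqrt // => h2.
by rewrite -(sqr_sqrtr S0) ler_sqr ?nnegrE ?sqrtr_ge0 // (le_trans _ h2) ?sqrtr_ge0.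
Qed.

(** The points 0, o, o + h, ..., o + (M-1) h, 1. When M h = 1 and 0 < o < h, all cells have length h
    except the two end cells, which are shorter but nondegenerate. *)
Definition breakpoint (o h : R) (M i : nat) : R :=
  if i == 0%N then 0 else if (i <= M)%N then o + i.-1%:R * h else 1.

Lemma breakpoint_incr o h M i : 0 < o -> o < h -> M%:R * h = 1 -> (i <= M)%N ->
  breakpoint o h M i < breakpoint o h M i.+1.
Proof.
move=> o0 oh Mh iM; rewrite /breakpoint /= iM.
have M0 : (0 < M)%N.
  by case: M Mh {iM} => // /eqP; rewrite mul0r eq_sym oner_eq0.
case: i iM => [|i] iM /=; first by rewrite M0 mul0r addr0.
case: ifP => iM'; first by rewrite ltrD2l ltr_pM2r ?ltr_nat // (lt_trans o0).
have -> : i%:R = M%:R - 1 :> R.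
  have -> : M = i.+1 by apply/eqP; rewrite eqn_leq iM leqNgt iM'.
  by rewrite -natr1 addrK.
by rewrite mulrBl Mh mul1r; lra.
Qed.

Section shifted_boxes.
Variables (u : {set 'I_s}) (o h : 'I_s -> R) (M : 'I_s -> nat).
Hypotheses (o0 : forall j, j \in u -> 0 < o j) (oh : forall j, j \in u -> o j < h j)
  (Mh : forall j, j \in u -> (M j)%:R * h j = 1).

Definition shifted_box (i : 'I_s -> nat) : 'rV[R]_s * 'rV[R]_s :=
  (\row_j (if j \in u then breakpoint (o j) (h j) (M j) (i j) else 0),
   \row_j (if j \in u then breakpoint (o j) (h j) (M j) (i j).+1 else 0)).

Lemma shifted_box_partition :
  box_partition u [set shifted_box i | i in [set i | forall j, j \in u -> (i j <= M j)%N]].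
Proof.
have incr j i : j \in u -> (i <= M j)%N -> breakpoint (o j) (h j) (M j) i < breakpoint (o j) (h j) (M j) i.+1.
  by move=> ju; apply: breakpoint_incr; [exact: o0|exact: oh|exact: Mh].
have last j : breakpoint (o j) (h j) (M j) (M j).+1 = 1 by rewrite /breakpoint /= ltnn.
split.
- by move=> _ [i /= hi <-] j ju /=; rewrite !mxE ju; apply: incr => //; apply: hi.
- move=> _ _ [i /= hi <-] [i' /= hi' <-] [x [/= bx bx']].
  suff e j : j \in u -> i j = i' j.
    by congr (_, _); apply/rowP => j; rewrite !mxE; case: ifP => // /e ->.
  move=> ju; have := bx j ju; have := bx' j ju; rewrite !mxE ju => b' b.
  by apply: (breakpoints_disjoint _ (hi j ju) (hi' j ju) b b') => k; apply: incr.
apply/seteqP; split.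
  move=> x [_ [i /= hi <-] bx] j ju; have /= := bx j ju; rewrite !mxE ju => /andP[h1 h2].
  have mono := @breakpoints_mono _ (breakpoint (o j) (h j) (M j)) (M j) (fun k => @incr j k ju).
  apply/andP; split.
    apply: le_trans h1; case: (posnP (i j)) => [->//|ij0].
    by apply: ltW; apply: (mono 0%N) => //; apply/leqW/hi.
  apply: (lt_le_trans h2); rewrite -(last j).
  have := hi j ju; rewrite leq_eqVlt => /predU1P[->//|ij].
  by apply: ltW; apply: mono.
move=> x bx.
have ex j : exists i, j \in u -> (i <= M j)%N /\
    breakpoint (o j) (h j) (M j) i <= x 0 j < breakpoint (o j) (h j) (M j) i.+1.
  case ju: (j \in u); last by exists 0%N.
  have := bx j ju; rewrite /= !mxE -(last j) => bxj.
  have [i iM hi] := @breakpoints_cover R (breakpoint (o j) (h j) (M j)) (M j) _ bxj.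
  by exists i.
have [i hi] := choice ex.
exists (shifted_box i); first by exists i => // j ju; have [] := hi j ju.
by move=> j ju; rewrite /= !mxE ju; have [] := hi j ju.
Qed.

End shifted_boxes.

Section grid_variation.
Variables (N : nat) (u : {set 'I_s}) (l : 'I_s -> nat).
Hypothesis lN : forall j, (l j < N)%N.

Definition low_corner (p : {ffun 'I_s -> 'I_(2 ^ N)}) : bool :=
  [forall (j | j \in u), ~~ bit N (p j) (l j)].

Definition grid_box (p : {ffun 'I_s -> 'I_(2 ^ N)}) : 'rV[R]_s * 'rV[R]_s :=
  (\row_j (if j \in u then gridpt N (p j) else 0),
   \row_j (if j \in u then gridpt N (p j) + 2 ^- (l j).+1 else 0)).

(** Outside [u] the period is the whole grid, so that a residue there is the coordinate itself.
    Within a residue class a grid box then determines its point [p]. *)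
Let H j : nat := if j \in u then (2 ^ (N - (l j).+1))%N else (2 ^ N)%N.

Let H_le j : (H j <= 2 ^ N)%N.
Proof. by rewrite /H; case: ifP => // _; rewrite leq_exp2l // leq_subr. Qed.

Let H_gt0 j : (0 < H j)%N.
Proof. by rewrite /H; case: ifP => _; rewrite expn_gt0. Qed.

(* Grid boxes with the same residue are cells of one shifted equispaced partition. *)
Definition residue (p : {ffun 'I_s -> 'I_(2 ^ N)}) : {ffun 'I_s -> 'I_(2 ^ N)} :=
  [ffun j => insubd (p j) (p j %% H j)%N].

Let val_residue p j : residue p j = (p j %% H j)%N :> nat.
Proof. by rewrite ffunE val_insubd (leq_trans _ (H_le j)) // ltn_mod. Qed.

Let vol := \prod_(j in u) 2 ^- (l j).+1 : R.

Let P0 n : 0 < (2 : R) ^+ n. Proof. by rewrite exprn_gt0. Qed.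

Let HE j : j \in u -> (H j)%:R / 2 ^+ N = 2 ^- (l j).+1 :> R.
Proof.
move=> ju; rewrite /H ju natrX; apply: (@mulfI _ (2 ^+ (l j).+1)); first exact: lt0r_neq0.
by rewrite mulrA -exprD subnKC // !divff // lt0r_neq0.
Qed.

Lemma grid_box_shifted (p : {ffun 'I_s -> 'I_(2 ^ N)}) : low_corner p ->
  grid_box p = shifted_box u (fun j => gridpt N (residue p j)) (fun j => 2 ^- (l j).+1)
      (fun j => 2 ^ (l j).+1)%N (fun j => (p j %/ H j).+1).
Proof.
move=> /forall_inP lp.
have e j : j \in u -> gridpt N (p j) = gridpt N (residue p j) + (p j %/ H j)%:R * 2 ^- (l j).+1 :> R.
  move=> ju; rewrite -HE // val_residue {1}(divn_eq (p j) (H j)) /gridpt.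
  by rewrite natrD natrM; field; rewrite lt0r_neq0.
(* Digit [l j] of a low corner is 0, so the quotient is even. The cell is thus never the last one,
   whose right end is cut off at 1. *)
have small j : j \in u -> ((p j %/ H j).+2 <= 2 ^ (l j).+1)%N.
  move=> ju; have := lp j ju; rewrite /bit.
  have -> : (2 ^ (N - (l j).+1))%N = H j by rewrite /H ju.
  have : (p j %/ H j < 2 ^ (l j).+1)%N.
    by rewrite ltn_divLR // /H ju -expnD subnKC.
  rewrite expnS; move: (p j %/ H j)%N (2 ^ l j)%N => q m qm nq.
  by have := odd_double_half q; rewrite (negPf nq) add0n -mul2n; lia.
congr (_, _); apply/rowP => j; rewrite !mxE; case: ifP => // ju.
  by rewrite /breakpoint /= (ltnW (small j ju)) e.
rewrite /breakpoint /= small // e //.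
by have -> : (p j %/ H j).+1%:R = (p j %/ H j)%:R + 1 :> R; [rewrite natr1|ring].
Qed.

Lemma volume_grid_box p : volume u (grid_box p) = vol.
Proof.
apply: eq_bigr => j ju; rewrite !mxE ju; ring.
Qed.

Lemma variation_residue_class (lambda V : R) g (r : {ffun 'I_s -> 'I_(2 ^ N)}) :
  (fractional_variation lambda u g <= V%:E)%E ->
  \sum_(p | low_corner p && (residue p == r)) alt_sum u g (grid_box p) ^+ 2
    <= V ^+ 2 * ((vol `^ lambda) ^+ 2 / vol).
Proof.
move=> hV; have vol0 : 0 < vol by apply: prodr_gt0 => j _; rewrite invr_gt0.
have vl0 : 0 < vol `^ lambda by exact: powR_gt0.
have c0 : 0 < (vol `^ lambda) ^+ 2 / vol by rewrite divr_gt0 // exprn_gt0.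
rewrite -ler_pdivrMr // mulr_suml.
have [[p0 hp0]|none] := pselect (exists p, low_corner p && (residue p == r)); last first.
  rewrite big_pred0 ?sqr_ge0 // => p; apply/negP => hp; apply: none; by exists p.
pose A : {set {ffun 'I_s -> 'I_(2 ^ N)}} := [set p | low_corner p && (residue p == r)]%SET.
have part := @shifted_box_partition u (fun j => gridpt N (r j)) (fun j => 2 ^- (l j).+1)
      (fun j => 2 ^ (l j).+1)%N.
have r_lt j : j \in u -> gridpt N (r j) < 2 ^- (l j).+1 :> R.
  move=> ju; rewrite -HE // /gridpt ltr_pM2r ?invr_gt0 //.
  have : ((r j).+1 <= H j)%N.
    by case/andP: hp0 => _ /eqP <-; rewrite val_residue ltn_mod.
  by rewrite -(ler_nat R) -natr1; lra.
have {}part := part _ r_lt _.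
have {}part : box_partition u [set shifted_box u (fun j => gridpt N (r j)) (fun j => 2 ^- (l j).+1)
      (fun j => 2 ^ (l j).+1)%N i | i in [set i | forall j, j \in u -> (i j <= 2 ^ (l j).+1)%N]].
  apply: part => j ju; first by have /andP[] := @gridpt_itv R N (r j) (ltn_ord _).
  by rewrite natrX divff // lt0r_neq0.
have inQ p : p \in A -> [set shifted_box u (fun j => gridpt N (r j)) (fun j => 2 ^- (l j).+1)
      (fun j => 2 ^ (l j).+1)%N i | i in [set i | forall j, j \in u -> (i j <= 2 ^ (l j).+1)%N]] (grid_box p).
  rewrite !inE => /andP[lp /eqP pr]; rewrite grid_box_shifted // pr.
  exists (fun j => (p j %/ H j).+1) => //= j ju.
  by rewrite ltn_divLR // /H ju -expnD subnKC.
have inj : {in A &, injective grid_box}.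
  move=> p p'; rewrite !inE => /andP[lp /eqP pr] /andP[lp' /eqP pr'] /(congr1 fst) /= e.
  apply/ffunP => j; apply: val_inj => /=; case ju: (j \in u).
    move/rowP/(_ j): e; rewrite !mxE ju => /(mulIf (invr_neq0 (lt0r_neq0 (P0 N)))).
    by move/addIr/eqP; rewrite eqr_nat => /eqP.
  have : residue p j = residue p' j :> nat by rewrite pr pr'.
  by rewrite !val_residue /H ju !modn_small.
have := variation_sum part inQ inj hV.
apply: le_trans; rewrite le_eqVlt; apply/orP; left; apply/eqP.
apply: eq_big => [p|p _]; first by rewrite !inE.
rewrite volume_grid_box real_normK ?num_real // expr_div_n.
by field; rewrite !lt0r_neq0.
Qed.

(** The number of residue classes is the grid size times [vol], which cancels the division by [vol]
    in the bound for one class. *)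
Lemma variation_avg (lambda V : R) g :
  (fractional_variation lambda u g <= V%:E)%E ->
  avg (fun p => if low_corner p then alt_sum u g (grid_box p) ^+ 2 else 0)
    <= V ^+ 2 * (vol `^ lambda) ^+ 2.
Proof.
move=> hV; have vol0 : 0 < vol by apply: prodr_gt0 => j _; rewrite invr_gt0.
rewrite /avg -big_mkcond /=.
have hres p : low_corner p -> [forall j, residue p j < H j]%N.
  by move=> _; apply/forallP => j; rewrite val_residue ltn_mod.
rewrite (partition_big residue (fun r => [forall j, r j < H j]%N)) //=.
rewrite ler_pdivrMl; last by rewrite ltr0n card_ffun !card_ord expn_gt0 expn_gt0.
apply: le_trans (ler_sum _ _) _ => [r _|]; first exact: (variation_residue_class r hV).
have -> : \sum_(r : {ffun 'I_s -> 'I_(2 ^ N)} | [forall j, r j < H j]%N) V ^+ 2 * ((vol `^ lambda) ^+ 2 / vol)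
   = (\prod_j (H j)%:R) * (V ^+ 2 * ((vol `^ lambda) ^+ 2 / vol)).
  rewrite big_mkcond /=.
  transitivity (\sum_(r : {ffun 'I_s -> 'I_(2 ^ N)}) (\prod_j (r j < H j)%N%:R) * (V ^+ 2 * ((vol `^ lambda) ^+ 2 / vol)) : R).
    apply: eq_bigr => r _; case: ifP => [/forallP h|/negbT].
      by rewrite big1 ?mul1r // => j _; rewrite h.
    by rewrite negb_forall => /existsP[j /negPf h]; rewrite (bigD1 j) //= h !mul0r.
  rewrite -mulr_suml -(bigA_distr_bigA (fun j (t : 'I_(2 ^ N)) => (t < H j)%N%:R)) /=; congr (_ * _).
  apply: eq_bigr => j _; rewrite -natr_sum; congr (_%:R).
  transitivity (\sum_(t < 2 ^ N | (t < H j)%N) 1)%N.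
    by rewrite [RHS]big_mkcond /=; apply: eq_bigr => t _; case: ltnP.
  by rewrite -(big_ord_widen _ (fun=> 1%N) (H_le j)) sum1_card card_ord.
have -> : \prod_j (H j)%:R = #|{ffun 'I_s -> 'I_(2 ^ N)}|%:R * vol :> R.
  rewrite card_ffun !card_ord natrX natrX /vol -[X in _ ^+ X](card_ord s) -prodr_const.
  rewrite [X in _ = _ * X]big_mkcond -big_split /=; apply: eq_bigr => j _.
  case: ifP => ju; last by rewrite mulr1 /H ju natrX.
  by rewrite -HE // mulrCA divff ?mulr1 // lt0r_neq0.
rewrite -mulrA ler_wpM2l // le_eqVlt; apply/orP; left; apply/eqP.
by field; rewrite lt0r_neq0.
Qed.

End grid_variation.
End variation.

(** * Derivatives and summation by parts in each coordinate *)

Section derivatives.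
Context {R : realType} {s : nat}.
Implicit Types (f g F : 'rV[R]_s -> R) (x : 'rV[R]_s) (j : 'I_s).

(** At an interior point small increments stay in [0, 1], so the limit relative to [0, 1] is the
    two-sided derivative. *)
Lemma partial_is_derive j g x (t : R) : 0 < t < 1 ->
  partial_exists j g (subst_coord j t x) ->
  is_derive t 1 (fun t' : R => g (subst_coord j t' x)) (partial j g (subst_coord j t x)).
Proof.
move=> /andP[t0 t1]; rewrite /partial_exists /partial; set L := lim _ => /= cL.
pose G t' := g (subst_coord j t' x).
have substK t' : subst_coord j t' (subst_coord j t x) = subst_coord j t' x.
  by apply/rowP => i; rewrite !mxE; case: eqP.
have tj : subst_coord j t x 0 j = t by rewrite subst_coordE eqxx.
suff H : (fun h => h^-1 *: (G (h *: 1 + t) - G t)) @ 0^' --> L.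
  apply: DeriveDef; first by apply/cvg_ex; exists L.
  by apply: cvg_lim H.
apply/cvgrPdist_lt => e e0; move/cvgrPdist_lt/(_ _ e0): cL.
rewrite /cube_nbhs tj !near_withinE => /nbhs_ballP[d /= d0 hd].
apply/nbhs_ballP; exists (Num.min d (Num.min t (1 - t))) => /=.
  by rewrite !lt_min d0 t0 subr_gt0.
move=> h; rewrite /ball /= sub0r normrN !lt_min => /andP[hd1 /andP[ht ht1]] h0.
have := hd (h + t); rewrite /ball /= (_ : t - (h + t) = - h); last by ring.
rewrite normrN => /(_ hd1).
have -> : h + t != t by rewrite -subr_eq0 addrK.
move=> /(_ isT); rewrite in_itv /=.
have /andP[ha hb] : - t < h < t by rewrite -ltr_norml.
have /andP[hc hd'] : - (1 - t) < h < 1 - t by rewrite -ltr_norml.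
have -> : 0 <= h + t <= 1 by apply/andP; split; lra.
move=> /(_ isT); rewrite /diff_quot tj substK addrK /G.
by rewrite /GRing.scale /= mulr1 mulrC.
Qed.

Lemma partial_MVT j g x (a b : R) : 0 < a -> b < 1 -> a < b -> unit_cube x ->
  (forall y, unit_cube y -> partial_exists j g y) ->
  exists2 c, a < c < b &
    g (subst_coord j b x) - g (subst_coord j a x) = partial j g (subst_coord j c x) * (b - a).
Proof.
move=> a0 b1 ab cx ex.
have der (t : R) : 0 < t < 1 -> is_derive t 1 (fun t' : R => g (subst_coord j t' x))
    (partial j g (subst_coord j t x)).
  move=> t01; apply: partial_is_derive => //; apply: ex; apply: subst_cube => //.
  by case/andP: t01 => /ltW-> /ltW->.
have [||c cab e] := @MVT R (fun t => g (subst_coord j t x))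
   (fun t => partial j g (subst_coord j t x)) a b ab.
- by move=> t; rewrite in_itv /= => /andP[at' tb]; apply: der; apply/andP; split; lra.
- apply: derivable_within_continuous => t; rewrite in_itv /= => /andP[at' tb].
  have : is_derive t 1 (fun t' : R => g (subst_coord j t' x)) (partial j g (subst_coord j t x)).
    by apply: der; apply/andP; split; lra.
  by case.
by exists c; move: cab; rewrite ?in_itv.
Qed.

(** Mean value theorem between neighbouring midpoints, which are interior; the intermediate point is
    within one mesh of the left one. *)
Lemma partial_increment j g x om N q : unit_cube x ->
  (forall y, unit_cube y -> partial_exists j g y) ->
  modulus (partial j g) om (2 ^- N) -> (q.+1 < 2 ^ N)%N ->
  `|g (subst_coord j (gridpt N q.+1) x) - g (subst_coord j (gridpt N q) x)
    - partial j g (subst_coord j (gridpt N q) x) / 2 ^+ N| <= om / 2 ^+ N.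
Proof.
move=> cx ex mom qN; have P0 : 0 < (2 : R) ^+ N by rewrite exprn_gt0.
have /andP[g0 g1] := @gridpt_itv R N q (ltnW qN).
have /andP[g2 g3] := @gridpt_itv R N q.+1 qN.
have gg : gridpt N q.+1 = gridpt N q + 2 ^- N :> R.
  by rewrite /gridpt -natr1; ring.
have q0 : 0 < 2 ^- N :> R by rewrite invr_gt0.
have [|c /andP[c1 c2] ->] := @partial_MVT j g x (gridpt N q) (gridpt N q.+1) g0 g3 _ cx ex.
  by rewrite gg ltrDl.
rewrite gg [gridpt N q + _]addrC addrK -mulrBl normrM (ger0_norm (ltW q0)) ler_pM2r //.
have c01 : 0 <= c <= 1 by apply/andP; split; lra.
apply: mom; try apply: subst_cube => //.
  by rewrite (ltW g0) (ltW g1).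
move=> i; apply: le_trans (subst_dist_same _ _ _ _ _) _.
by rewrite ger0_norm; lra.
Qed.

Lemma mixed_partial_foldr_id (a : 'I_s -> nat) f (v : seq 'I_s) :
  (forall i, i \in v -> a i = 0%N) ->
  foldr (fun i g => iter (a i) (partial i) g) f v = f.
Proof.
elim: v => //= i v IH h; rewrite h ?mem_head //= IH // => k kv.
by rewrite h // inE kv orbT.
Qed.

Lemma eq_mixed_partial (a b : 'I_s -> nat) f : a =1 b -> mixed_partial a f = mixed_partial b f.
Proof. by move=> ab; rewrite /mixed_partial; elim: (enum _) => //= i v ->; rewrite ab. Qed.

Lemma mixed_partial0 (a : 'I_s -> nat) f : (forall i, a i = 0%N) -> mixed_partial a f = f.
Proof. by move=> a0; apply: mixed_partial_foldr_id. Qed.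

(** With order 0 in all coordinates before [j], the operators of [j] are the outermost ones in the
    fold, so one more can be put in front. *)
Lemma partial_mixed_partial (a b : 'I_s -> nat) f j : (forall i : 'I_s, (i < j)%N -> a i = 0%N) ->
  (forall i, b i = a i + (i == j))%N ->
  partial j (mixed_partial a f) = mixed_partial b f.
Proof.
move=> a0 ba; rewrite /mixed_partial.
have ej : j \in enum 'I_s by rewrite mem_enum.
have : pairwise (fun i k : 'I_s => (i < k)%N) (enum 'I_s).
  have := iota_ltn_sorted 0 s; rewrite -val_enum_ord sorted_pairwise; last exact: ltn_trans.
  by rewrite pairwise_map.
have := enum_uniq 'I_s.
case/splitPr: ej => p1 p2; rewrite pairwise_cat /= cat_uniq /= => /and3P[_ _ /andP[jp2 _]].
move=> /and3P[/allrelP lt12 _ _].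
have lt1 i : i \in p1 -> (i < j)%N by move=> ip; apply: lt12 => //; apply: mem_head.
rewrite !foldr_cat /= (@mixed_partial_foldr_id a _ p1); last by move=> i ip; apply/a0/lt1.
rewrite (@mixed_partial_foldr_id b _ p1); last first.
  by move=> i /lt1 ij; rewrite ba a0 // -val_eqE /= ltn_eqF.
rewrite ba eqxx addn1 iterS; congr (partial j (iter _ _ _)).
elim: p2 jp2 {lt12} => //= i p2 IH; rewrite inE negb_or => /andP[ji jp2].
by rewrite ba eq_sym (negPf ji) addn0 IH.
Qed.

(* [mixed_partial] differentiates in the last coordinate first; introducing the
   derivatives from the last coordinate down makes each new one a [partial j] of
   a mixed partial whose existence [mixed_C] asserts. *)
Definition stage (a : 'I_s -> nat) (k : nat) (i : 'I_s) : nat := if (k <= i)%N then a i else 0%N.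

Definition stage_at (a : 'I_s -> nat) (j : 'I_s) (n : nat) (i : 'I_s) : nat :=
  if i == j then n else stage a j.+1 i.

Lemma stage_at_zero a j f : mixed_partial (stage_at a j 0) f = mixed_partial (stage a j.+1) f.
Proof.
by apply: eq_mixed_partial => i; rewrite /stage_at; case: eqP => // ->; rewrite /stage ltnn.
Qed.

Lemma stage_at_full a j f : mixed_partial (stage_at a j (a j)) f = mixed_partial (stage a j) f.
Proof.
apply: eq_mixed_partial => i; rewrite /stage_at /stage; case: eqP => [->|/eqP ij]; first by rewrite leqnn.
by rewrite ltn_neqAle -val_eqE /= eq_sym in ij *; rewrite ij.
Qed.

Section parts.
Variables (alpha : nat) (f : 'rV[R]_s -> R) (N : nat) (om : R).
Hypotheses (fC : mixed_C alpha f) (om0 : 0 <= om)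
  (f_mod : forall a : 'I_s -> nat, (forall j, (a j <= alpha)%N) ->
     modulus (mixed_partial a f) om (2 ^- N)).
Variables (t : 'I_s -> seq nat) (c : 'I_s -> nat -> R).
Hypotheses (t_sorted : forall j, sorted ltn (t j)) (t_N : forall j, all (gtn N) (t j))
  (t_alpha : forall j, (size (t j) <= alpha)%N)
  (c_const : forall j l, l \in t j -> forall p p',
     (p %/ 2 ^ (N - l) = p' %/ 2 ^ (N - l))%N -> c j p = c j p')
  (c_le1 : forall j p, `|c j p| <= 1).

Let a j := size (t j).
Let phi j p : R := (\prod_(l <- t j) (-1) ^+ bit N p l) * c j p.
Let psi j p : R := tentw N (t j) p * c j p.
Let d j : R := (-1) ^+ size (t j) * \prod_(l <- t j) 2 ^- l.+1.

Let phi1 j p : `|phi j p| <= 1.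
Proof.
rewrite normrM normr_prod big1 ?mul1r // => l _; by rewrite normrX normrN1 expr1n.
Qed.

Let psi1 j p : `|psi j p| <= 1.
Proof.
have /andP[w0 w1] := @tentw_bounds R N (t j) (t_sorted j) (t_N j) p.
by rewrite normrM mulr_ile1 // ger0_norm.
Qed.

Let d1 j : `|d j| <= 1.
Proof.
rewrite normrM normrX normrN1 expr1n mul1r normr_prod; apply: prodr_ile1 => i _.
by rewrite normr_ge0 normfV normrX ger0_norm // invf_le1 ?exprn_gt0 // exprn_ege1 // ler1n.
Qed.

Lemma parts_coord j x : unit_cube x ->
  `|avg (fun q : 'I_(2 ^ N) => mixed_partial (stage a j.+1) f (subst_coord j (gridpt N q) x) * phi j q)
    - d j * avg (fun q : 'I_(2 ^ N) => mixed_partial (stage a j) f (subst_coord j (gridpt N q) x) * psi j q)|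
  <= (a j)%:R * om.
Proof.
move=> cx.
pose h n (r : R) := mixed_partial (stage_at a j n) f (subst_coord j r x).
have h_incr n q : (n < size (t j))%N -> (q.+1 < 2 ^ N)%N ->
  `|h n (gridpt N q.+1) - h n (gridpt N q) - h n.+1 (gridpt N q) / 2 ^+ N| <= om / 2 ^+ N.
  move=> nt qN; rewrite /h.
  have low (i : 'I_s) : (i < j)%N -> stage_at a j n i = 0%N.
    move=> ij; rewrite /stage_at -val_eqE /= ltn_eqF // /stage.
    by rewrite leqNgt ltnS (ltnW ij).
  have e : partial j (mixed_partial (stage_at a j n) f) = mixed_partial (stage_at a j n.+1) f.
    apply: partial_mixed_partial => // i; rewrite /stage_at.
    by case: eqP; rewrite ?addn1 ?addn0.
  have le_alpha m (i : 'I_s) : (m <= alpha)%N -> (stage_at a j m i <= alpha)%N.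
    by move=> ma; rewrite /stage_at /stage; case: eqP => // _; case: ifP => // _; apply: t_alpha.
  have na : (n < alpha)%N by apply: leq_trans (t_alpha j).
  have [_ ex] := fC (fun i => le_alpha n i (ltnW na)).
  rewrite -e; apply: partial_increment => //.
    by move=> y cy; apply: ex => //; rewrite /stage_at eqxx.
  by rewrite e; apply: f_mod => i; apply: le_alpha.
have := @parts_iter R N h (t j) (c j) om (t_sorted j) (t_N j) (@c_const j) (c_le1 j) h_incr om0.
rewrite /h stage_at_zero stage_at_full; congr (`|_ - _ * _| <= _).
  by apply: eq_avg => q; rewrite mulrA.
by apply: eq_avg => q; rewrite mulrA.
Qed.

(** An estimate in coordinate [j], uniform in the other coordinates, survives averaging over them:
    their factors do not involve [p j] and are bounded by 1. *)
Lemma avg_swap j F F' (u v : nat -> R) (e err : R) (W : 'I_s -> nat -> R) :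
  (forall i p, `|W i p| <= 1) ->
  (forall x, unit_cube x ->
    `|avg (fun q : 'I_(2 ^ N) => F (subst_coord j (gridpt N q) x) * u q)
      - e * avg (fun q : 'I_(2 ^ N) => F' (subst_coord j (gridpt N q) x) * v q)| <= err) ->
  `|avg (fun p : {ffun 'I_s -> 'I_(2 ^ N)} => F (gridrow p) * (u (p j) * \prod_(i | i != j) W i (p i)))
   - e * avg (fun p : {ffun 'I_s -> 'I_(2 ^ N)} => F' (gridrow p) * (v (p j) * \prod_(i | i != j) W i (p i)))|
  <= err.
Proof.
move=> W1 hF.
have card0 : (0 < #|'I_(2 ^ N)|)%N by rewrite card_ord expn_gt0.
have card1 : (0 < #|{ffun 'I_s -> 'I_(2 ^ N)}|)%N by rewrite card_ffun expn_gt0 card0.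
have split (G : 'rV[R]_s -> R) (w : nat -> R) : avg (fun p : {ffun 'I_s -> 'I_(2 ^ N)} => G (gridrow p) * (w (p j) * \prod_(i | i != j) W i (p i)))
   = avg (fun p : {ffun 'I_s -> 'I_(2 ^ N)} => \prod_(i | i != j) W i (p i) *
       avg (fun q : 'I_(2 ^ N) => G (subst_coord j (gridpt N q) (gridrow p)) * w q)) :> R.
  rewrite (avg_upd j) //; apply: eq_avg => p; rewrite -avgZ; apply: eq_avg => q.
  rewrite gridrow_upd ffunE eqxx mulrA mulrC; congr (_ * _).
  by apply: eq_bigr => i ij; rewrite ffunE (negPf ij).
rewrite (split F u) (split F' v) -avgZ -avgB; apply: norm_avg_le => // p.
rewrite [e * _]mulrCA -mulrBr normrM -[leRHS]mul1r ler_pM //.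
  by rewrite normr_prod; apply: prodr_ile1 => i _; rewrite normr_ge0 W1.
by apply: hF; apply: gridrow_cube.
Qed.

Lemma parts_all :
  `|avg (fun p : {ffun 'I_s -> 'I_(2 ^ N)} => f (gridrow p) * \prod_j phi j (p j))
    - (\prod_j d j) * avg (fun p : {ffun 'I_s -> 'I_(2 ^ N)} =>
        mixed_partial a f (gridrow p) * \prod_j psi j (p j))|
  <= s%:R * (alpha%:R * om).
Proof.
(* Hybrid terms: the coordinates from k on have been summed by parts, those before k have not. Going
   from [E s] down to [E 0] introduces derivatives in the order that [stage] allows. *)
pose E (k : nat) : R := (\prod_(j : 'I_s) (if (j < k)%N then 1 else d j)) *
  avg (fun p : {ffun 'I_s -> 'I_(2 ^ N)} => mixed_partial (stage a k) f (gridrow p) *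
     \prod_(j : 'I_s) (if (j < k)%N then phi j (p j) else psi j (p j))).
have ES : E s = avg (fun p : {ffun 'I_s -> 'I_(2 ^ N)} => f (gridrow p) * \prod_j phi j (p j)).
  rewrite /E big1 ?mul1r; last by move=> j _; rewrite ltn_ord.
  apply: eq_avg => p; rewrite mixed_partial0; last by move=> i; rewrite /stage leqNgt ltn_ord.
  by congr (_ * _); apply: eq_bigr => j _; rewrite ltn_ord.
have E0 : E 0%N = (\prod_j d j) * avg (fun p : {ffun 'I_s -> 'I_(2 ^ N)} =>
        mixed_partial a f (gridrow p) * \prod_j psi j (p j)).
  by [].
have step (j : 'I_s) : `|E j.+1 - E j| <= alpha%:R * om.
  pose W (i : 'I_s) p := if (i < j)%N then phi i p else psi i p.
  pose D := \prod_(i | i != j) (if (i < j)%N then 1 else d i).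
  have W1 (i : 'I_s) p : `|W i p| <= 1 by rewrite /W; case: ifP.
  have D1 : `|D| <= 1.
    rewrite normr_prod; apply: prodr_ile1 => i _; rewrite normr_ge0 /=.
    by case: ifP => // _; rewrite normr1.
  have ne (i : 'I_s) : i != j -> (i < j.+1)%N = (i < j)%N.
    by rewrite -val_eqE /= => ij; rewrite ltnS leq_eqVlt (negPf ij).
  have -> : E j.+1 = D * avg (fun p : {ffun 'I_s -> 'I_(2 ^ N)} => mixed_partial (stage a j.+1) f (gridrow p) *
      (phi j (p j) * \prod_(i | i != j) W i (p i))).
    rewrite /E (bigD1 j) //= ltnSn mul1r; congr (_ * _); first by apply: eq_bigr => i /ne ->.
    apply: eq_avg => p; congr (_ * _); rewrite (bigD1 j) //= ltnSn; congr (_ * _).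
    by apply: eq_bigr => i /ne ->.
  have -> : E j = D * (d j * avg (fun p : {ffun 'I_s -> 'I_(2 ^ N)} => mixed_partial (stage a j) f (gridrow p) *
      (psi j (p j) * \prod_(i | i != j) W i (p i)))).
    rewrite /E (bigD1 j) //= ltnn mulrA [d j * _]mulrC; congr (_ * _).
    by apply: eq_avg => p; congr (_ * _); rewrite (bigD1 j) //= ltnn.
  rewrite -mulrBr normrM -[leRHS]mul1r ler_pM //.
  apply: avg_swap => // x cx; apply: le_trans (parts_coord j cx) _.
  by rewrite ler_wpM2r // ler_nat t_alpha.
rewrite -ES -E0.
suff H k : (k <= s)%N -> `|E k - E 0%N| <= k%:R * (alpha%:R * om) by apply: H.
elim: k => [|k IH] ks; first by rewrite subrr normr0 mul0r.
rewrite (_ : E k.+1 - E 0%N = (E k.+1 - E k) + (E k - E 0%N)); last by ring.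
apply: le_trans (ler_normD _ _) _.
rewrite -natr1 mulrDl mul1r addrC lerD ?IH ?(ltnW ks) //.
exact: (step (Ordinal ks)).
Qed.

End parts.
End derivatives.

(** * Walsh coefficients of smooth functions *)

Section mcshane.
Context {R : realType}.
Variables (N : nat) (c : R) (w : nat -> R).
Hypotheses (c0 : 0 <= c) (w01 : forall q, 0 <= w q <= 1)
  (w_lip : forall q, `|w q.+1 - w q| <= c / 2 ^+ N).

(* The discrete weights produced by summation by parts extend to Lipschitz
   functions on [0, 1], hence are admissible in [weighted_variation]. *)
Definition mcshane (x : R) : R :=
  \big[Num.max/0]_(q < 2 ^ N) (w q - c * `|x - gridpt N q|).

Lemma gridpt_sub q n : gridpt N (q + n) - gridpt N q = n%:R / 2 ^+ N :> R.
Proof. by rewrite /gridpt natrD; ring. Qed.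

Lemma grid_lip_far q n : `|w (q + n)%N - w q| <= c * (n%:R / 2 ^+ N).
Proof.
elim: n => [|n IH]; first by rewrite addn0 subrr normr0 mul0r mulr0.
rewrite addnS (_ : w _ - _ = (w (q + n).+1 - w (q + n)%N) + (w (q + n)%N - w q)); last by ring.
apply: le_trans (ler_normD _ _) _.
rewrite (_ : c * _ = c / 2 ^+ N + c * (n%:R / 2 ^+ N)); last by rewrite -natr1; ring.
exact: lerD.
Qed.

Lemma grid_lip q q' : w q - w q' <= c * `|gridpt N q - gridpt N q'|.
Proof.
apply: le_trans (ler_norm _) _.
have [/subnKC <-|/ltnW/subnKC <-] := leqP q q'.
  rewrite distrC (distrC (gridpt _ _)) gridpt_sub [X in c * X]ger0_norm ?divr_ge0 ?exprn_ge0 //.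
  exact: grid_lip_far.
rewrite gridpt_sub [X in c * X]ger0_norm ?divr_ge0 ?exprn_ge0 //; exact: grid_lip_far.
Qed.

Lemma mcshane_grid q : (q < 2 ^ N)%N -> mcshane (gridpt N q) = w q.
Proof.
move=> qN; apply/eqP; rewrite eq_le; apply/andP; split.
  apply/bigmax_leP; split; first by case/andP: (w01 q).
  by move=> i _; have := grid_lip i q; rewrite distrC; lra.
apply: le_trans (le_bigmax _ _ (Ordinal qN)).
by rewrite /= subrr normr0 mulr0 subr0.
Qed.

Lemma mcshane_bounds x : 0 <= mcshane x <= 1.
Proof.
rewrite bigmax_ge_id /=; apply/bigmax_leP; split => // q _.
have /andP[_ wq] := w01 q; have : 0 <= c * `|x - gridpt N q| by rewrite mulr_ge0.
by lra.
Qed.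

Lemma mcshane_lip x y : `|mcshane x - mcshane y| <= c * `|x - y|.
Proof.
have aux a b : mcshane a - mcshane b <= c * `|a - b|.
  have cab : 0 <= c * `|a - b| by rewrite mulr_ge0.
  rewrite lerBlDr; apply/bigmax_leP; split.
    by rewrite addr_ge0 //; case/andP: (mcshane_bounds b).
  move=> q _; have := le_bigmax 0 (fun q : 'I_(2 ^ N) => w q - c * `|b - gridpt N q|) q.
  rewrite -/(mcshane b); suff : c * `|b - gridpt N q| <= c * `|a - b| + c * `|a - gridpt N q| by lra.
  rewrite -mulrDr ler_wpM2l // (_ : b - _ = (b - a) + (a - gridpt N q)); last by ring.
  by rewrite (distrC a b) ler_normD.
by rewrite ler_norml; have := aux x y; have := aux y x; rewrite (distrC y x); lra.
Qed.

Lemma mcshane_continuous (A : set R) : {within A, continuous mcshane}.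
Proof.
apply: continuous_subspaceT => x; apply/cvgrPdist_le => e e0.
have c1 : 0 < c + 1 by rewrite ltr_wpDl.
apply/nbhs_ballP; exists (e / (c + 1)) => /=; first by rewrite divr_gt0.
move=> y; rewrite /ball /= ltr_pdivlMr // => h; apply: le_trans (mcshane_lip _ _) _.
have h' : `|x - y| * (c + 1) < e := h; have h0 : 0 <= `|x - y| := normr_ge0 _.
lra.
Qed.

End mcshane.

Section bounds.
Context {R : realType} {s : nat}.
Implicit Types (f g : 'rV[R]_s -> R).

Lemma prod_dist (I : finType) (A : pred I) (u v : I -> R) (d : R) :
  (forall i, A i -> `|u i| <= 1) -> (forall i, A i -> `|v i| <= 1) ->
  (forall i, A i -> `|u i - v i| <= d) -> 0 <= d ->
  `|\prod_(i | A i) u i - \prod_(i | A i) v i| <= #|I|%:R * d.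
Proof.
move=> u1 v1 uv d0.
suff H : forall r : seq I, `|\prod_(i <- r | A i) v i| <= 1 /\
    `|\prod_(i <- r | A i) u i - \prod_(i <- r | A i) v i| <= (size r)%:R * d.
  by have [_] := H (enum I); rewrite -cardE big_enum_cond /= [X in _ - X]big_enum_cond.
elim=> [|i r [IH1 IH]]; first by rewrite !big_nil subrr normr1 normr0 mul0r.
rewrite !big_cons; case: ifP => Ai; last first.
  by split => //; apply: le_trans IH _; rewrite ler_wpM2r // ler_nat /=.
split; first by rewrite normrM mulr_ile1 // v1.
set U := \prod_(j <- r | A j) u j in IH *; set W := \prod_(j <- r | A j) v j in IH IH1 *.
rewrite (_ : _ - _ = u i * (U - W) + (u i - v i) * W); last by ring.
have -> : (size (i :: r))%:R * d = (size r)%:R * d + d by rewrite /= -[in LHS]natr1 mulrDl mul1r.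
apply: le_trans (ler_normD _ _) _; rewrite lerD // normrM.
  by rewrite -[leRHS]mul1r ler_pM // u1.
by rewrite -[leRHS]mulr1 ler_pM // uv.
Qed.

(** Both suprema and the sum of squares over multi-indices have nonnegative or dominated terms, so
    the one number N bounds each individual variation. *)
Lemma fractional_variation_bounded alpha lambda f :
  (variation_norm alpha lambda f < +oo)%E ->
  exists2 V : R, 0 <= V & forall (u : {set 'I_s}) (a : 'I_s -> nat) (rho : 'I_s -> R -> R),
    u != finset.set0 -> (forall j, (a j <= alpha)%N) -> weights (~: u) rho ->
    (fractional_variation lambda u (int_coords (~: u)
      (fun x => mixed_partial a f x * \prod_(j in ~: u) rho j (x 0 j))%R) <= V%:E)%E.
Proof.
set n := variation_norm _ _ _ => noo; exists `|fine n| => // u a rho u0 aalpha wrho.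
have nle : (n <= `|fine n|%:E)%E.
  case: n noo => [r| |] //= _; last by rewrite leNye.
  by rewrite lee_fin ler_norm.
pose a' : {ffun 'I_s -> 'I_alpha.+1} := [ffun j => inord (a j)].
have -> : mixed_partial a f = mixed_partial (fun j => a' j) f.
  by apply: eq_mixed_partial => j; rewrite ffunE inordK // ltnS.
set y := fractional_variation _ _ _.
pose wv := weighted_variation lambda u (mixed_partial (fun j => a' j) f).
have ywv : (y <= wv)%E by apply: ereal_sup_ubound; exists rho.
apply: le_trans ywv _.
have sq0 (z : \bar R) : (0 <= z ^+ 2)%E.
  by case: z => [r| |] //=; rewrite -?EFin_expe ?lee_fin ?sqr_ge0 // expe2 ?mulyy ?mulNyNy leey.
have le1 : (((wv ^+ 2) `^ 2^-1) <= n)%E.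
  apply: le_trans (ereal_sup_ubound _); last by exists u.
  have le2 : (wv ^+ 2 <= \sum_(b : {ffun 'I_s -> 'I_alpha.+1})
      (weighted_variation lambda u (mixed_partial (fun j => b j) f)) ^+ 2)%E.
    by rewrite (bigD1 a') //=; apply: leeDl; apply: sume_ge0 => b _; exact: sq0.
  apply: gt0_ler_poweR => //; rewrite ?in_itv /= ?leey ?sq0 ?andbT //.
  exact: le_trans le2.
have {}le1 := le_trans le1 nle.
case: wv le1 => [r| |]; last by rewrite leNye.
  rewrite -EFin_expe poweR_EFin !lee_fin powR12_sqrt ?sqr_ge0 // sqrtr_sqr.
  by apply: le_trans; apply: ler_norm.
by rewrite expe2 mulyy poweRyr ?invr_eq0.
Qed.

End bounds.

Section flipping.
Context {R : realType} {s N : nat}.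
Variables (u : {set 'I_s}) (l : 'I_s -> nat).
Hypothesis lN : forall j, (l j < N)%N.
Implicit Types (p : {ffun 'I_s -> 'I_(2 ^ N)}) (v : {set 'I_s}).

Definition flipv v p : {ffun 'I_s -> 'I_(2 ^ N)} :=
  [ffun j => if j \in v then flipo (l j) (p j) else p j].

Lemma flipvK v : involutive (flipv v).
Proof.
by move=> p; apply/ffunP => j; rewrite !ffunE; case: (j \in v); rewrite ?flipoK.
Qed.

(** Every grid point is [flipv v p] for a unique low corner p, where [v] is the set of [j] in [u]
    whose digit [l j] is 1. *)
Lemma avg_flip (H : {ffun 'I_s -> 'I_(2 ^ N)} -> R) :
  avg H = avg (fun p => if low_corner u l p then \sum_(v : {set 'I_s} | v \subset u) H (flipv v p) else 0).
Proof.
pose hi p : {set 'I_s} := [set j in u | bit N (p j) (l j)]%SET.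
rewrite /avg; congr (_ * _); rewrite -big_mkcond /= exchange_big /=.
rewrite (partition_big hi (fun v => v \subset u)) /=; last first.
  by move=> p _; apply/fintype.subsetP => j; rewrite inE => /andP[].
apply: eq_bigr => v vu; rewrite (reindex_inj (can_inj (flipvK v))).
apply: eq_bigl => p; apply/eqP/forall_inP => [e j ju|h].
  have := congr1 (fun A : {set 'I_s} => j \in A) e; rewrite inE ju ffunE /=.
  by case: ifP => jv; rewrite ?val_flipo ?bit_flip // => ->.
apply/finset.setP => j; rewrite inE ffunE.
case ju: (j \in u) => /=; last by apply/esym/negP => /(fintype.subsetP vu); rewrite ju.
by have := h j ju; case: ifP => jv; rewrite ?val_flipo ?bit_flip // => /negPf.
Qed.

(** Flips of a low corner are the corners of its grid box. A flip in [v] moves to the upper end on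
    [v], while [select] takes the lower end on its set, hence the reindexing by complements in
    [u]. *)
Lemma alt_sum_flip (g : 'rV[R]_s -> R) p : low_corner u l p ->
  (forall x y : 'rV[R]_s, (forall j, j \in u -> x 0 j = y 0 j) -> g x = g y) ->
  \sum_(v : {set 'I_s} | v \subset u) (-1) ^+ #|v| * g (gridrow (flipv v p)) =
  alt_sum u g (grid_box u l p).
Proof.
move=> /forall_inP lp gloc; rewrite /alt_sum.
have hinj : {in [pred v : {set 'I_s} | v \subset u], involutive (fun v => u :\: v)}.
  by move=> v vu; rewrite finset.setDDr finset.setDv finset.set0U; apply/finset.setIidPr.
rewrite (reindex_onto (fun v => u :\: v) (fun v => u :\: v)) /=; last first.
  by move=> v; apply: hinj.
apply: eq_big => [v|v].
  rewrite finset.subsetDl /=; apply/eqP/idP => [<-|vu]; [exact: finset.subsetDl|exact: hinj].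
rewrite finset.subsetDl /= => /eqP e; have vu : v \subset u by rewrite -e finset.subsetDl.
have -> : #|u :\: v| = (#|u| - #|v|)%N by rewrite cardsD (finset.setIidPr vu).
congr (_ * _); apply: gloc => j ju; rewrite !mxE ffunE !inE ju andbT.
case: (j \in v) => //=; rewrite val_flipo // /flip (negPf (lp j ju)).
have P0 n : (2 : R) ^+ n != 0 by rewrite expf_neq0 ?pnatr_eq0.
have -> : 2 ^- (l j).+1 = (2 ^ (N - (l j).+1))%N%:R / 2 ^+ N :> R.
  apply: (@mulfI _ (2 ^+ (l j).+1)) => //.
  by rewrite divff // mulrA natrX -exprD subnKC // divff.
by rewrite /gridpt natrD; ring.
Qed.

End flipping.

Section blocks.
Context {R : realType} {s L : nat}.
Variable alpha : nat.
Implicit Types (k t : {set 'I_L}).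

(** The digit of rank [alpha], whose flip produces box differences. The default 0 still satisfies
    the bound [pv_lt], as N is positive. *)
Definition pivot t : nat := if [pick l in tops alpha t :\: lead alpha t] is Some l then val l else 0%N.

Lemma pivotP k (t := tops alpha k) : t != lead alpha t -> exists2 l : 'I_L,
  l \in k :\: lead alpha t & [/\ pivot t = l, t :\: lead alpha t = [set l]%SET,
    (forall l', l' \in k :\: lead alpha t -> l' != l -> (l' < l)%N) &
    (forall l', l' \in lead alpha t -> (l < l')%N)].
Proof.
rewrite /t lead_tops => tl.
have [full|[l e kl]] := lead_full_or_pivot alpha k.
  case/negP: tl; rewrite full finset.eqEsubset tops_sub -{1}full; exact: lead_sub_tops.
have lt : l \in tops alpha k :\: lead alpha k by rewrite e finset.set11.
move: (lt); rewrite inE => /andP[ll ltk].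
exists l; first by rewrite inE ll.
split => //.
- rewrite /pivot topsK lead_tops e; case: pickP => [x|/(_ l)]; rewrite inE ?eqxx //.
  by move/eqP->.
- move=> l'; rewrite inE => /andP[l'l kl'] ne.
  apply: (below_tops kl' _ ltk); apply/negP => l't.
  have : l' \in tops alpha k :\: lead alpha k by rewrite inE l'l.
  by rewrite e inE (negPf ne).
- by move=> l'; apply: below_lead kl ll.
Qed.

Lemma no_pivot k (t := tops alpha k) : t = lead alpha t -> k :\: lead alpha t = finset.set0.
Proof.
rewrite /t lead_tops => e; have [full|[l el _]] := lead_full_or_pivot alpha k.
  by rewrite full finset.setDv.
by have := finset.set11 l; rewrite -el e finset.setDv inE.
Qed.

(* Each leading digit l gains 2 ^- l.+1 from a derivative of order one, the next
   digit gains (2 ^- l.+1) `^ lambda from the fractional variation. *)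
Definition block_weight (lambda : R) (tau : {ffun 'I_s -> {set 'I_L}}) : R :=
  (\prod_j \prod_(l in lead alpha (tau j)) 2 ^- l.+1) *
  (\prod_j \prod_(l in tau j :\: lead alpha (tau j)) 2 ^- l.+1) `^ lambda.

Definition block (tau : {ffun 'I_s -> {set 'I_L}}) : pred {ffun 'I_s -> {set 'I_L}} :=
  fun kk => [forall j, tops alpha (kk j) == tau j].

End blocks.

(** The flip moves the point by 2^(N-l-1), a period of a weight built from digits finer than [l]. *)
Lemma tentw_flip (R : realFieldType) N (l : nat) (t : seq nat) (q : nat) : (l < N)%N ->
  all (ltn l) t -> all (gtn N) t -> tentw N t (flip N l q) = tentw N t q :> R.
Proof.
move=> lN lt tN.
have per k y : tentw N t (y + k * 2 ^ (N - l.+1)) = tentw N t y :> R.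
  elim: k y => [|k IH] y; first by rewrite addn0.
  by rewrite mulSn addnCA addnC tentw_periodic.
rewrite (divn_eq (flip N l q) (2 ^ (N - l.+1))) flip_mod // addnC per.
by rewrite [in RHS](divn_eq q (2 ^ (N - l.+1))) addnC per.
Qed.

Section block_bound.
Context {R : realType} {s L : nat}.
Variables (alpha : nat) (lambda : R) (f : 'rV[R]_s -> R) (N : nat) (om M V : R).
Hypotheses (LN : (L <= N)%N) (N0 : (0 < N)%N) (om0 : 0 <= om) (fC : mixed_C alpha f)
  (f_uc : forall a : 'I_s -> nat, (forall j, (a j <= alpha)%N) -> ucont (mixed_partial a f))
  (f_mod : forall a : 'I_s -> nat, (forall j, (a j <= alpha)%N) ->
     modulus (mixed_partial a f) om (2 ^- N))
  (f_bnd : forall a : 'I_s -> nat, (forall j, (a j <= alpha)%N) ->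
     forall x, unit_cube x -> `|mixed_partial a f x| <= M)
  (M0 : 0 <= M) (MV : M <= V)
  (f_var : forall (u : {set 'I_s}) (a : 'I_s -> nat) (rho : 'I_s -> R -> R),
    u != finset.set0 -> (forall j, (a j <= alpha)%N) -> weights (~: u) rho ->
    (fractional_variation lambda u (int_coords (~: u)
      (fun x => mixed_partial a f x * \prod_(j in ~: u) rho j (x 0 j))%R) <= V%:E)%E).

Definition coef (k : {ffun 'I_s -> {set 'I_L}}) : R :=
  avg (fun p : {ffun 'I_s -> 'I_(2 ^ N)} => f (gridrow p) * chi k (fun j => bit N (p j))).

(** The first summand comes from difference quotients, the second from integrating out coordinates
    by midpoint sums. For fixed L both become small as [om] decreases and N grows. *)
Definition block_error : R :=
  s%:R * (alpha%:R * om) + s%:R * (om + M * (s%:R * (2 ^+ L / 2 ^+ N))).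

Variable tau : {ffun 'I_s -> {set 'I_L}}.
Hypothesis tau_tops : forall j, tops alpha (tau j) = tau j.

Let tl j : seq nat := [seq val l | l <- enum (lead alpha (tau j))].

Let tl_sorted j : sorted ltn (tl j).
Proof.
rewrite /tl; have -> : enum (lead alpha (tau j)) = [seq x <- enum 'I_L | x \in lead alpha (tau j)].
  by rewrite enumT /enum_mem.
apply: (subseq_sorted ltn_trans (map_subseq _ (filter_subseq _ _))).
by rewrite val_enum_ord iota_ltn_sorted.
Qed.

Let tl_lt j : all (gtn L) (tl j).
Proof. by apply/allP => _ /mapP[l _ ->] /=. Qed.

Let tl_N j : all (gtn N) (tl j).
Proof. by apply: sub_all (tl_lt j) => x /= xL; apply: leq_trans LN. Qed.

Let size_tl j : (size (tl j) <= alpha)%N.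
Proof. by rewrite size_map -cardE card_lead. Qed.

(** The coordinates that keep a pivot after summation by parts. In the others only a tent weight
    remains, and they are integrated against its extension [rho]. *)
Let u : {set 'I_s} := [set j | tau j != lead alpha (tau j)]%SET.
Let pv j : nat := pivot alpha (tau j).
Let W j : nat -> R := tentw N (tl j).
Let rho j : R -> R := mcshane N (2 ^+ L) (W j).
Let a j := size (tl j).
Let D x := mixed_partial a f x.
Let G x := D x * \prod_(j in ~: u) rho j (x 0 j).
Let g := int_coords (~: u) G.

Let L0 : 0 <= (2 : R) ^+ L. Proof. by rewrite exprn_ge0. Qed.

Let W01 j q : 0 <= W j q <= 1. Proof. exact: tentw_bounds. Qed.

Let W_lip j q : `|W j q.+1 - W j q| <= 2 ^+ L / 2 ^+ N. Proof. exact: tentw_lip. Qed.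

Let rho_grid j (q : 'I_(2 ^ N)) : rho j (gridpt N q) = W j q.
Proof. by apply: mcshane_grid. Qed.

Let rho01 j x : 0 <= rho j x <= 1. Proof. by apply: mcshane_bounds. Qed.

Let rho_le1 j x : `|rho j x| <= 1.
Proof. by have /andP[r0 r1] := rho01 j x; rewrite ger0_norm. Qed.

Let pv_lt j : (pv j < N)%N.
Proof.
rewrite /pv /pivot; case: pickP => [l _|_]; last exact: N0.
by apply: leq_trans LN; apply: ltn_ord.
Qed.

Let rho_prod_dist (x y : 'rV[R]_s) d : 0 <= d -> (forall j, `|x 0 j - y 0 j| <= d) ->
  `|\prod_(j in ~: u) rho j (x 0 j) - \prod_(j in ~: u) rho j (y 0 j)| <= s%:R * (2 ^+ L * d).
Proof.
move=> d0 xy; rewrite -[s in s%:R]card_ord; apply: prod_dist => [j _|j _|j _|].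
- exact: rho_le1.
- exact: rho_le1.
- by apply: le_trans (mcshane_lip N L0 (W01 j) _ _) _; rewrite ler_wpM2l.
- by rewrite mulr_ge0.
Qed.

Let rho_prod_le1 (x : 'rV[R]_s) : `|\prod_(j in ~: u) rho j (x 0 j)| <= 1.
Proof. by rewrite normr_prod; apply: prodr_ile1 => j; rewrite normr_ge0 rho_le1. Qed.

Let G_dist om' d : 0 <= d -> modulus D om' d ->
  modulus G (om' + M * (s%:R * (2 ^+ L * d))) d.
Proof.
move=> d0 hD x y cx cy xy; rewrite /G.
set p := \prod_(j in ~: u) rho j (x 0 j); set q := \prod_(j in ~: u) rho j (y 0 j).
rewrite (_ : _ - _ = (D x - D y) * p + D y * (p - q)); last by ring.
apply: le_trans (ler_normD _ _) _; rewrite !normrM; apply: lerD.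
  by rewrite -[leRHS]mulr1 ler_pM ?hD ?rho_prod_le1.
by rewrite ler_pM ?f_bnd ?rho_prod_dist.
Qed.

Let G_uc : ucont G.
Proof.
move=> e e0; have [d d0 hd] := f_uc size_tl (divr_gt0 e0 (ltr0n R 2)).
pose B := M * (s%:R * 2 ^+ L).
have B0 : 0 <= B by rewrite !mulr_ge0.
have B1 : 0 < B + 1 by rewrite ltr_wpDl.
pose d' := Num.min d (e / 2 / (B + 1)).
have d'0 : 0 < d' by rewrite lt_min d0 !divr_gt0.
exists d' => // x y cx cy xy.
have hD : modulus D (e / 2) d'.
  move=> x' y' cx' cy' xy'; apply: hd => // j; apply: le_trans (xy' j) _.
  by rewrite ge_min lexx.
apply: le_trans (G_dist (ltW d'0) hD cx cy xy) _.
rewrite (_ : M * _ = B * d'); last by rewrite /B; ring.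
have : d' * (B + 1) <= e / 2 by rewrite -ler_pdivlMr // ge_min lexx orbT.
by rewrite mulrDr mulr1 mulrC; lra.
Qed.

Let u_mem j : (j \in u) = (tau j != lead alpha (tau j)).
Proof. by rewrite inE. Qed.

Let scal : R := \prod_j ((-1) ^+ size (tl j) * \prod_(l <- tl j) 2 ^- l.+1).

Let prod_lead j (F : nat -> R) : \prod_(l <- tl j) F l = \prod_(l in lead alpha (tau j)) F l.
Proof. by rewrite big_map big_enum. Qed.

(** Weighted box differences, depending on [tau] alone: all members of the block are, up to [scal]
    and an error, Walsh coefficients of this one function. *)
Let A (p : {ffun 'I_s -> 'I_(2 ^ N)}) : R :=
  if low_corner u pv p then (\prod_(j in u) W j (p j)) * alt_sum u g (grid_box u pv p) else 0.

Let restf (k : {ffun 'I_s -> {set 'I_L}}) : {ffun 'I_s -> {set 'I_L}} :=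
  [ffun j => k j :\: lead alpha (tau j)].

Let scal_le1 : `|scal| <= 1.
Proof.
rewrite normr_prod; apply: prodr_ile1 => j _; rewrite normr_ge0 normrM normrX normrN1 expr1n mul1r.
rewrite normr_prod; apply: prodr_ile1 => l _.
by rewrite normr_ge0 normfV normrX ger0_norm // invf_le1 ?exprn_gt0 // exprn_ege1 // ler1n.
Qed.

Section member.
Variable k : {ffun 'I_s -> {set 'I_L}}.
Hypothesis kB : block alpha tau k.

Let rest := restf k.
Let c j q : R := chi1 (rest j) (bit N q).

Let tauE j : tau j = tops alpha (k j). Proof. by have /forallP/(_ j)/eqP-> := kB. Qed.

Let rest_out j : j \notin u -> rest j = finset.set0.
Proof.
by rewrite u_mem negbK ffunE tauE => /eqP; apply: no_pivot.
Qed.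

Let rest_in j : j \in u -> exists2 l : 'I_L,
  l \in rest j & [/\ pv j = l,
    (forall l', l' \in rest j -> l' != l -> (l' < l)%N) &
    (forall l', l' \in lead alpha (tau j) -> (l < l')%N)].
Proof.
rewrite u_mem tauE => /pivotP [l lr [pl _ h1 h2]].
by exists l; rewrite ?ffunE ?tauE //; split => //; rewrite /pv tauE.
Qed.

Let chi1_le1 (t : {set 'I_L}) q : `|chi1 t (bit N q)| <= 1 :> R.
Proof. by rewrite chi1_normr. Qed.

Let c_const j l : l \in tl j -> forall p p',
  (p %/ 2 ^ (N - l) = p' %/ 2 ^ (N - l))%N -> c j p = c j p'.
Proof.
case/mapP=> l0; rewrite mem_enum => ll -> p p' e.
apply: eq_bigr => l'; rewrite ffunE inE => /andP[l'l kl'].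
rewrite (@bit_coarser N p p' (val l0) l') //.
by move: ll l'l; rewrite tauE lead_tops => ll l'l; apply: below_lead kl' l'l ll.
Qed.

Let T : R := avg (fun p : {ffun 'I_s -> 'I_(2 ^ N)} => D (gridrow p) * \prod_j (W j (p j) * c j (p j))).

Let coef_T : `|coef k - scal * T| <= s%:R * (alpha%:R * om).
Proof.
have := parts_all fC om0 f_mod tl_sorted tl_N size_tl c_const (fun j q => chi1_le1 _ _).
congr (`|_ - _| <= _); apply: eq_avg => p; congr (_ * _); apply: eq_bigr => j _.
rewrite prod_lead /c /rest ffunE /chi1.
have sub : lead alpha (tau j) \subset k j by rewrite tauE lead_tops lead_sub.
by rewrite [RHS](big_setID (lead alpha (tau j))) /= (finset.setIidPr sub).
Qed.

Let psi (p : {ffun 'I_s -> 'I_(2 ^ N)}) : R := (\prod_(j in u) W j (p j)) * \prod_j c j (p j).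

Let psi_le1 p : `|psi p| <= 1.
Proof.
rewrite normrM mulr_ile1 // normr_prod; apply: prodr_ile1 => j; rewrite normr_ge0 ?chi1_le1 //=.
by rewrite ger0_norm; have /andP[] := W01 j (p j).
Qed.

Let T' : R := avg (fun p : {ffun 'I_s -> 'I_(2 ^ N)} => g (gridrow p) * psi p).

Let q0 : 0 <= 2 ^- N :> R. Proof. by rewrite invr_ge0 exprn_ge0. Qed.

(** Outside [u] a member of the block has leading digits only, so [psi] is constant in these
    coordinates and the average may be replaced by the integral. *)
Let T_T' : `|T - T'| <= s%:R * (om + M * (s%:R * (2 ^+ L / 2 ^+ N))).
Proof.
have psi_upd p j t : j \in enum (~: u) -> psi (upd p j t) = psi p.
  rewrite mem_enum inE => ju; congr (_ * _).
    by apply: eq_bigr => i iu; rewrite ffunE; case: eqP => // e; rewrite -e iu in ju.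
  apply: eq_bigr => i _; rewrite ffunE; case: eqP => // e.
  by rewrite /c e rest_out // /chi1 !big_set0.
have G_mod := G_dist q0 (f_mod size_tl).
have := avg_fold_int_coord G_uc G_mod psi_le1 psi_upd.
have -> : avg (fun p => G (gridrow p) * psi p) = T.
  rewrite /T; apply: eq_avg => p; rewrite /G /= -mulrA; congr (_ * _); rewrite big_split /= mulrA; congr (_ * _).
  rewrite [RHS](bigID (mem u)) /= mulrC; congr (_ * _); apply: eq_big => j; first by rewrite inE.
  by move=> _; rewrite mxE rho_grid.
move/le_trans; apply; rewrite ler_wpM2r //.
  by rewrite addr_ge0 // !mulr_ge0 // ?exprn_ge0.
by rewrite ler_nat -cardE -[leqRHS]card_ord max_card.
Qed.

Let g_local (x y : 'rV[R]_s) : (forall j, j \in u -> x 0 j = y 0 j) -> g x = g y.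
Proof.
move=> xy; apply: fold_int_coord_local => j; rewrite mem_enum inE negbK; exact: xy.
Qed.

(** The weights involve only digits finer than the pivot and do not change. The pivot is the finest
    remaining digit, so its flip changes just one sign per coordinate of [v]. *)
Let psi_flip (v : {set 'I_s}) (p : {ffun 'I_s -> 'I_(2 ^ N)}) : v \subset u -> psi (flipv pv v p) = (-1) ^+ #|v| * psi p.
Proof.
move=> /fintype.subsetP vu; rewrite /psi mulrCA; congr (_ * _).
  apply: eq_bigr => j ju; rewrite ffunE; case: ifP => // jv.
  have [l lr [pl _ h2]] := rest_in ju.
  rewrite val_flipo // /W tentw_flip //; apply/allP => _ /mapP[l0 + ->].
  by rewrite mem_enum => /h2 /=; rewrite pl.
have -> : (-1) ^+ #|v| = \prod_j (if j \in v then -1 else 1) :> R.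
  by rewrite -prodr_const big_mkcond.
rewrite -big_split /=; apply: eq_bigr => j _.
rewrite ffunE; case: ifP => jv; rewrite ?mul1r //.
have [l lr [pl h1 _]] := rest_in (vu _ jv).
rewrite /c /chi1 (bigD1 l) //= [in RHS](bigD1 l) //= mulrA; congr (_ * _).
  by rewrite val_flipo // pl bit_flip -?pl //; case: bit; rewrite ?expr0 ?expr1; ring.
apply: eq_bigr => l' /andP[l'r ne]; rewrite val_flipo // bit_flip_coarser // pl.
exact: h1.
Qed.

Let T'_bessel : T' = avg (fun p => A p * chi rest (fun j => bit N (p j))).
Proof.
rewrite /T' (@avg_flip _ _ _ u pv pv_lt); apply: eq_avg => p.
rewrite /A; case: ifP => lp; last by rewrite mul0r.
rewrite -(alt_sum_flip pv_lt lp g_local) mulrAC mulr_sumr.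
by apply: eq_bigr => v vu; rewrite psi_flip // -[chi _ _]/(\prod_j c j (p j)) /psi; ring.
Qed.

Lemma coef_approx :
  `|coef k - scal * avg (fun p => A p * chi (restf k) (fun j => bit N (p j)))| <= block_error.
Proof.
rewrite -T'_bessel (_ : _ - _ = (coef k - scal * T) + scal * (T - T')); last by ring.
apply: le_trans (ler_normD _ _) _; apply: lerD; first exact: coef_T.
by rewrite normrM -[leRHS]mul1r ler_pM.
Qed.

End member.

Let vol : R := \prod_(j in u) 2 ^- (pv j).+1.

Let A_sq : avg (fun p => A p ^+ 2) <= V ^+ 2 * (vol `^ lambda) ^+ 2.
Proof.
have W_prod p : 0 <= \prod_(j in u) W j (nat_of_ord (p j : 'I_(2 ^ N))) <= 1.
  apply/andP; split; first by apply: prodr_ge0 => j _; case/andP: (W01 j (p j)).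
  by apply: prodr_ile1 => j _; apply: W01.
apply: (@le_trans _ _ (avg (fun p => if low_corner u pv p then alt_sum u g (grid_box u pv p) ^+ 2 else 0))).
  apply: avg_le => p; rewrite /A; case: ifP => _; last by rewrite expr0n.
  have /andP[w0 w1] := W_prod p; rewrite exprMn -[leRHS]mul1r ler_wpM2r ?sqr_ge0 //.
  by rewrite exprn_ile1.
(* For empty [u] the variation says nothing: the alternating sum is the full integral of [G],
   bounded by M. This is where [M <= V] enters. *)
have [u0|un0] := eqVneq u finset.set0; last first.
  apply: variation_avg => //; apply: f_var => // j _; split; last by move=> t _; apply: rho01.
  exact: mcshane_continuous.
have -> : vol = 1 by rewrite /vol u0 big_set0.
rewrite powR1 expr1n mulr1.
have card1 : (0 < #|{ffun 'I_s -> 'I_(2 ^ N)}|)%N by rewrite card_ffun !card_ord expn_gt0 expn_gt0.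
rewrite -[leRHS](@avg_const _ {ffun 'I_s -> 'I_(2 ^ N)}) //; apply: avg_le => p.
case: ifP => _; last by rewrite sqr_ge0.
have -> : alt_sum u g (grid_box u pv p) = g 0.
  rewrite /alt_sum u0 (big_pred1 finset.set0) => [|v]; last by rewrite finset.subset0.
  rewrite cards0 expr0 mul1r; congr g; apply/rowP => j.
  by rewrite !mxE !inE.
rewrite -real_normK ?num_real // ler_sqr ?nnegrE //; last exact: le_trans MV.
apply: le_trans MV.
have c0 : unit_cube (0 : 'rV[R]_s) by move=> j; rewrite mxE lexx ler01.
have G_bnd x : unit_cube x -> `|G x| <= M.
  by move=> cx; rewrite normrM -[leRHS]mulr1 ler_pM // ?f_bnd ?rho_prod_le1.
rewrite /g /int_coords; elim: (enum _) (0 : 'rV[R]_s) c0 => [|j v IH] x cx /=; first exact: G_bnd.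
rewrite -[int_coord _ _ _]subr0 -[X in _ - X](_ : \int[lebesgue_measure]_(t in `[0, 1]) (0 : R) = 0); last first.
  by rewrite Rintegral_cst ?mul0r.
apply: Rintegral_unit_dist.
- by apply: section_continuous => //; apply: ucont_fold.
- by move=> t; apply: cst_continuous.
- by move=> t t01; rewrite subr0; apply: IH; apply: subst_cube.
Qed.

Let volE : vol = \prod_j \prod_(l in tau j :\: lead alpha (tau j)) 2 ^- l.+1.
Proof.
rewrite /vol big_mkcond /=; apply: eq_bigr => j _; rewrite u_mem.
have [e|ne] := eqVneq; first by rewrite /= -e finset.setDv big_set0.
rewrite /pv; have := @pivotP _ alpha (tau j); rewrite /= tau_tops => /(_ ne)[l _ [-> -> _ _]].
by rewrite big_set1.
Qed.

(** The error is counted once for every index family of depth L, a crude factor that is harmless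
    because N is chosen after L. *)
Lemma block_sum_pos : \sum_(k | block alpha tau k) coef k ^+ 2 <=
  2 * (V ^+ 2 * block_weight alpha lambda tau ^+ 2)
  + 2 * (#|{ffun 'I_s -> {set 'I_L}}|%:R * block_error ^+ 2).
Proof.
pose T k : R := avg (fun p => A p * chi (restf k) (fun j => bit N (p j))).
apply: (@le_trans _ _ (\sum_(k | block alpha tau k) (2 * (scal ^+ 2 * T k ^+ 2) + 2 * block_error ^+ 2))).
  apply: ler_sum => k kB; have := coef_approx kB; rewrite -/(T k) -exprMn.
  move: (coef k) (scal * T k) (block_error) => x y z xyz.
  have : (x - y) ^+ 2 <= z ^+ 2.
    by rewrite -real_normK ?num_real // ler_sqr ?nnegrE // (le_trans _ xyz).
  by have := sqr_ge0 (x - 2 * y); nra.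
rewrite big_split /=; apply: lerD; rewrite -mulr_sumr; last first.
  by rewrite ler_wpM2l // sumr_const -[block_error ^+ 2 *+ _]mulr_natl ler_wpM2r ?sqr_ge0 // ler_nat max_card.
rewrite -mulr_sumr ler_wpM2l // /block_weight exprMn mulrCA -volE.
have -> : scal ^+ 2 = (\prod_j \prod_(l in lead alpha (tau j)) 2 ^- l.+1) ^+ 2.
  rewrite -!prodrXl; apply: eq_bigr => j _; rewrite exprMn -exprM mulnC exprM sqrrN expr1n expr1n mul1r.
  by rewrite prod_lead.
rewrite ler_wpM2l ?sqr_ge0 //; apply: le_trans A_sq.
apply: le_trans (bessel (fun k => avg_chi_grid k LN) A).
pose F (k : {ffun 'I_s -> {set 'I_L}}) : R := avg (fun p => A p * chi k (fun j => bit N (p j))) ^+ 2.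
(* Members of a block share their leading digits, so removing these is injective and each Walsh
   coefficient of [A] is used at most once. *)
have inj : {in [set k | block alpha tau k]%SET &, injective restf}.
  move=> k k'; rewrite !inE => /forallP kB /forallP kB' e; apply/ffunP => j.
  have sub k1 : tops alpha (k1 j) == tau j -> lead alpha (tau j) \subset k1 j.
    by move/eqP <-; rewrite lead_tops lead_sub.
  have := congr1 (fun h : {ffun 'I_s -> {set 'I_L}} => h j) e; rewrite !ffunE => e'.
  rewrite -(finset.setID (k j) (lead alpha (tau j))) -(finset.setID (k' j) (lead alpha (tau j))) e'.
  by rewrite (finset.setIidPr (sub _ (kB j))) (finset.setIidPr (sub _ (kB' j))).
have -> : \sum_(k | block alpha tau k) T k ^+ 2 = \sum_(k in [set k | block alpha tau k]%SET) F (restf k).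
  by apply: eq_bigl => k; rewrite inE.
rewrite -(big_imset F inj) /= [leRHS](bigID (mem (restf @: [set k | block alpha tau k]%SET))) /=.
by rewrite lerDl sumr_ge0 // => k _; apply: sqr_ge0.
Qed.

End block_bound.

Section dyadic_digits.
Context {R : realType}.

Definition dyadic_prefix (L : nat) (b : nat -> bool) : R := \sum_(l < L) (b l)%:R * 2 ^- l.+1.

Lemma dyadic_prefix_bit N L p : (L <= N)%N -> (p < 2 ^ N)%N ->
  dyadic_prefix L (bit N p) = (p %/ 2 ^ (N - L))%N%:R / 2 ^+ L.
Proof.
move=> + pN; elim: L => [|L IH] LN.
  by rewrite /dyadic_prefix big_ord0 subn0 divn_small // mul0r.
rewrite /dyadic_prefix big_ord_recr /= -/(dyadic_prefix L _) IH ?(ltnW LN) //.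
have H0 : (0 < 2 ^ (N - L.+1))%N by rewrite expn_gt0.
rewrite (expn_half LN); set H := (2 ^ (N - L.+1))%N in H0 *.
have -> : (p %/ H = 2 * (p %/ (2 * H)) + bit N p L)%N.
  by rewrite (mulnC 2 H) divnMA divn2 /bit -/H mul2n addnC odd_double_half.
rewrite natrD natrM exprS invfM; set x := (_%:R : R); set y := (nat_of_bool _)%:R.
by field; rewrite expf_neq0 ?pnatr_eq0.
Qed.

Lemma dyadic_prefix_gridpt N L p : (L <= N)%N -> (p < 2 ^ N)%N ->
  dyadic_prefix L (bit N p) <= gridpt N p <= dyadic_prefix L (bit N p) + 2 ^- L.
Proof.
move=> LN pN; rewrite dyadic_prefix_bit // /gridpt.
have P0 n : 0 < (2 : R) ^+ n by rewrite exprn_gt0.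
have H0 : (0 < 2 ^ (N - L))%N by rewrite expn_gt0.
have -> : (2 : R) ^+ N = 2 ^+ (N - L) * 2 ^+ L by rewrite -exprD subnK.
have pE : p%:R = (p %/ 2 ^ (N - L))%N%:R * 2 ^+ (N - L) + (p %% 2 ^ (N - L))%N%:R :> R.
  by rewrite {1}(divn_eq p (2 ^ (N - L))) natrD natrM natrX.
have := ltn_pmod p H0; rewrite pE -(ler_nat R) -natr1 natrX.
have := P0 (N - L)%N; have := P0 L; move: (p %/ _)%N (p %% _)%N => q r.
move: (2 ^+ (N - L)) (2 ^+ L) => H K K0 H0' rH.
have r0 : 0 <= r%:R :> R by [].
rewrite ler_pdivlMr ?mulr_gt0 // (_ : q%:R / K * (H * K) = q%:R * H); last by field; rewrite lt0r_neq0.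
rewrite ler_pdivrMr ?mulr_gt0 // (_ : (q%:R / K + K^-1) * (H * K) = q%:R * H + H); last by field; rewrite lt0r_neq0.
by apply/andP; split; lra.
Qed.

End dyadic_digits.

Section approximation.
Context {R : realType} {s : nat}.
Implicit Types (f : 'rV[R]_s -> R).

Lemma exists_small_pow2 (d : R) (n : nat) : 0 < d -> exists2 N, (n <= N)%N & 2 ^- N <= d.
Proof.
move=> d0; have [m hm] : exists m : nat, d^-1 < m%:R.
  by exists (Num.bound d^-1); rewrite archi_boundP // invr_ge0 ltW.
exists (maxn n m); first exact: leq_maxl.
rewrite -[d]invrK lef_pV2 ?posrE ?exprn_gt0 ?invr_gt0 //.
apply: le_trans (ltW hm) _; rewrite -natrX ler_nat.
by apply: leq_trans (leq_maxr n m) (ltnW (ltn_expl _ _)).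
Qed.

Lemma modulus_le G om d d' : d' <= d -> @modulus R s G om d -> modulus G om d'.
Proof. by move=> dd mG x y cx cy xy; apply: mG => // j; apply: le_trans dd. Qed.

Lemma mixed_partial_ucont alpha f : mixed_C alpha f ->
  forall a : 'I_s -> nat, (forall j, (a j <= alpha)%N) -> ucont (mixed_partial a f).
Proof. by move=> fC a /fC[cf _]; apply: continuous_ucont. Qed.

Lemma finite_multiindex alpha f (a : 'I_s -> nat) : (forall j, (a j <= alpha)%N) ->
  exists b : {ffun 'I_s -> 'I_alpha.+1}, mixed_partial a f = mixed_partial (fun j => b j) f.
Proof.
move=> aalpha; exists [ffun j => inord (a j)]; apply: eq_mixed_partial => j.
by rewrite ffunE inordK // ltnS.
Qed.

Lemma mixed_partial_bound alpha f : mixed_C alpha f -> exists2 M, 0 <= M &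
  forall a : 'I_s -> nat, (forall j, (a j <= alpha)%N) ->
    forall x, unit_cube x -> `|mixed_partial a f x| <= M.
Proof.
move=> fC.
have /choice[B hB] (b : {ffun 'I_s -> 'I_alpha.+1}) : exists M, 0 <= M /\
    forall x, unit_cube x -> `|mixed_partial (fun j => b j) f x| <= M.
  have [|M M0 hM] := @ucont_bounded R s (mixed_partial (fun j => b j) f); last by exists M.
  by apply: (mixed_partial_ucont fC) => j; rewrite -ltnS.
exists (\sum_b B b); first by apply: sumr_ge0 => b _; case: (hB b).
move=> a /(finite_multiindex f)[b ->] x cx; have [_ h] := hB b; apply: le_trans (h x cx) _.
by rewrite (bigD1 b) //= lerDl sumr_ge0 // => b' _; case: (hB b').
Qed.

Lemma mixed_partial_modulus alpha f om : mixed_C alpha f -> 0 < om -> exists2 d, 0 < d &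
  forall a : 'I_s -> nat, (forall j, (a j <= alpha)%N) -> modulus (mixed_partial a f) om d.
Proof.
move=> fC om0.
have /choice[B hB] (b : {ffun 'I_s -> 'I_alpha.+1}) : exists d, 0 < d /\
    modulus (mixed_partial (fun j => b j) f) om d.
  have [|d d0 hd] := mixed_partial_ucont fC (a := fun j => b j) _ om0; last by exists d.
  by move=> j; rewrite -ltnS.
exists (\big[Num.min/1]_b B b).
  by apply/bigmin_gtP; split => // b _; case: (hB b).
move=> a /(finite_multiindex f)[b ->]; have [_] := hB b; apply: modulus_le; exact: bigmin_le.
Qed.

Lemma block_weight_gt0 L alpha lambda (tau : {ffun 'I_s -> {set 'I_L}}) :
  0 < block_weight alpha lambda tau :> R.
Proof.
rewrite mulr_gt0 ?powR_gt0 //; apply: prodr_gt0 => j _; apply: prodr_gt0 => l _;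
  by rewrite invr_gt0 exprn_gt0.
Qed.

(** Points come with digit sequences [b] since dyadic rationals have two expansions; the closed
    upper bound allows a tail of ones. [B] precedes [eta], hence is independent of the depth L. *)
Lemma walsh_approximation alpha lambda f :
  mixed_C alpha f -> (variation_norm alpha lambda f < +oo)%E ->
  exists2 B : R, 0 < B & forall eta : R, 0 < eta ->
  exists L (c : {ffun 'I_s -> {set 'I_L}} -> R),
  [/\ forall (x : 'rV[R]_s) (b : 'I_s -> nat -> bool), unit_cube x ->
        (forall j, dyadic_prefix L (b j) <= x 0 j <= dyadic_prefix L (b j) + 2 ^- L) ->
        `|f x - \sum_k c k * chi k b| <= eta,
      `|c [ffun _ => finset.set0] - cube_integral f| <= eta &
      forall tau, \sum_(k | block alpha tau k) c k ^+ 2 <= B * block_weight alpha lambda tau ^+ 2].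
Proof.
move=> fC fV.
have [M M0 hM] := mixed_partial_bound fC.
have [V0 V00 hV0] := fractional_variation_bounded fV.
(* The summand M ensures [M <= V], the summand 1 ensures [1 <= V]. In the constant below, two copies
   of V^2 come from [block_sum_pos] and the third absorbs the discretization error. *)
pose V := V0 + M + 1; have V1 : 1 <= V by rewrite /V; lra.
exists (3 * V ^+ 2); first by rewrite mulr_gt0 // exprn_gt0 //; lra.
move=> eta eta0.
have f_uc : ucont f.
  by rewrite -(@mixed_partial0 R s (fun=> 0%N) f) //; apply: (mixed_partial_ucont fC).
have [d0 d00 hd0] := f_uc _ eta0.
have [L _ Ld] := exists_small_pow2 0 d00.
pose K := #|{ffun 'I_s -> {set 'I_L}}|%:R : R.
(* At fixed depth there are finitely many weights, so their squares have a positive minimum, and an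
   error below it is absorbed in every block at once. *)
have [bw bw0 hbw] : exists2 bw : R, 0 < bw & forall tau : {ffun 'I_s -> {set 'I_L}},
    bw <= block_weight alpha lambda tau ^+ 2.
  exists (\big[Num.min/1]_(tau : {ffun 'I_s -> {set 'I_L}}) block_weight alpha lambda tau ^+ 2).
    by apply/bigmin_gtP; split => // tau _; rewrite exprn_gt0 ?block_weight_gt0.
  by move=> tau; apply: bigmin_le.
pose e0 := Num.min 1 (bw / (2 * (K + 1))).
have K0 : 0 <= K by [].
have e00 : 0 < e0 by rewrite lt_min ltr01 divr_gt0 // mulr_gt0 // ltr_wpDl.
have e0K : 2 * (K * e0 ^+ 2) <= bw.
  have : e0 <= bw / (2 * (K + 1)) by rewrite ge_min lexx orbT.
  rewrite ler_pdivlMr ?mulr_gt0 ?ltr_wpDl // => h.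
  have : e0 <= 1 by rewrite ge_min lexx.
  have : 0 <= K * e0 by rewrite mulr_ge0 // ltW.
  rewrite expr2; nra.
pose S := s%:R : R; have S0 : 0 <= S by [].
pose om := Num.min (eta / (S + 1)) (e0 / 2 / (S * alpha%:R + S + 1)).
have C0 : 0 < S * alpha%:R + S + 1 by rewrite ltr_wpDl // addr_ge0 // mulr_ge0.
have S1 : 0 < S + 1 by rewrite ltr_wpDl.
have om0 : 0 < om by rewrite lt_min !divr_gt0.
have [d1 d10 hd1] := mixed_partial_modulus fC om0.
pose C1 := S * (M * (S * 2 ^+ L)); have C10 : 0 <= C1 by rewrite !mulr_ge0 // exprn_ge0.
have C11 : 0 < C1 + 1 by rewrite ltr_wpDl.
pose d2 := Num.min d1 (e0 / 2 / (C1 + 1)).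
have d20 : 0 < d2 by rewrite lt_min d10 !divr_gt0.
have [N LN Nd] := exists_small_pow2 L.+1 d20.
have hmod a : (forall j, (a j <= alpha)%N) -> modulus (mixed_partial a f) om (2 ^- N).
  by move=> aa; apply: modulus_le (hd1 a aa); apply: le_trans Nd _; rewrite ge_min lexx.
have err : block_error (s := s) (L := L) alpha N om M <= e0.
  rewrite /block_error -/S.
  have h1 : om * (S * alpha%:R + S + 1) <= e0 / 2.
    by rewrite -ler_pdivlMr // ge_min lexx orbT.
  have h2 : 2 ^- N * (C1 + 1) <= e0 / 2.
    by rewrite -ler_pdivlMr //; apply: le_trans Nd _; rewrite ge_min lexx orbT.
  have q0 : 0 <= 2 ^- N :> R by rewrite invr_ge0 exprn_ge0.
  rewrite (_ : _ + _ = om * (S * alpha%:R + S) + 2 ^- N * C1); last by rewrite /C1; ring.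
  by rewrite mulrDr mulr1 in h1; rewrite mulrDr mulr1 in h2; lra.
have err0 : 0 <= block_error (s := s) (L := L) alpha N om M.
  by rewrite /block_error addr_ge0 ?mulr_ge0 // ?addr_ge0 ?mulr_ge0 ?divr_ge0 ?exprn_ge0 // ltW.
have N0 : (0 < N)%N by apply: leq_trans LN.
have {}LN : (L <= N)%N by apply: ltnW.
have card1 : (0 < #|{ffun 'I_s -> 'I_(2 ^ N)}|)%N by rewrite card_ffun !card_ord expn_gt0 expn_gt0.
exists L, (coef f N (L := L)); split.
- move=> x b cx xb.
  (* The truncated Walsh sum is the mean of [f] over the grid points in the dyadic cell of depth L
     selected by [b]. *)
  have -> : \sum_(k : {ffun 'I_s -> {set 'I_L}}) coef f N k * chi k b =
     avg (fun p : {ffun 'I_s -> 'I_(2 ^ N)} => f (gridrow p) * wkernel L b (fun j => bit N (p j))).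
    transitivity (\sum_(k : {ffun 'I_s -> {set 'I_L}}) avg (fun p : {ffun 'I_s -> 'I_(2 ^ N)} =>
       chi k b * (f (gridrow p) * chi k (fun j => bit N (p j))))).
      by apply: eq_bigr => k _; rewrite avgZ mulrC.
    rewrite -avg_sum; apply: eq_avg => p; rewrite wkernelE mulr_sumr.
    by apply: eq_bigr => k _; ring.
  have one := @avg_wkernel R s L _ _ (fun k => avg_chi_grid k LN) b.
  rewrite -[f x]mulr1 -one -avgZ -avgB.
  apply: le_trans (le_norm_avg _) _; rewrite -[leRHS]mulr1 -one -avgZ; apply: avg_le => p.
  rewrite -mulrBl normrM (ger0_norm (wkernel_ge0 _ _ _)).
  have [->|/wkernel_neq0 bb] := eqVneq (wkernel L b (fun j => bit N (p j)) : R) 0; first by rewrite !mulr0.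
  rewrite ler_wpM2r ?wkernel_ge0 //; apply: hd0 => // [|j]; first exact: gridrow_cube.
  apply: le_trans Ld; rewrite mxE.
  have /andP[x1 x2] := xb j; have /andP[g1 g2] := @dyadic_prefix_gridpt R N L (p j) LN (ltn_ord (p j)).
  have e : dyadic_prefix L (b j) = dyadic_prefix L (bit N (p j)) :> R.
    by apply: eq_bigr => l _; rewrite bb.
  by rewrite e in x1 x2; rewrite ler_norml; apply/andP; split; lra.
- have mf : modulus f om (2 ^- N).
    by rewrite -(@mixed_partial0 R s (fun=> 0%N) f) //; apply: hmod.
  have := @avg_fold_int_coord R s N f (enum [set: 'I_s]%SET) om (fun=> 1) f_uc mf _ _.
  rewrite normr1 => /(_ (fun=> lexx _) (fun _ _ _ _ => erefl)).
  have -> : avg (fun p : {ffun 'I_s -> 'I_(2 ^ N)} => foldr int_coord f (enum [set: 'I_s]%SET) (gridrow p) * 1) = cube_integral f.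
    rewrite -[RHS](@avg_const _ {ffun 'I_s -> 'I_(2 ^ N)}) //; apply: eq_avg => p.
    by rewrite mulr1; apply: fold_int_coord_local => i; rewrite mem_enum inE.
  have -> : avg (fun p : {ffun 'I_s -> 'I_(2 ^ N)} => f (gridrow p) * 1) = coef f N [ffun _ : 'I_s => finset.set0 : {set 'I_L}].
    by apply: eq_avg => p; rewrite chi0.
  move/le_trans; apply; rewrite -cardE cardsT card_ord -/S.
  have : om * (S + 1) <= eta by rewrite -ler_pdivlMr // ge_min lexx.
  by rewrite mulrDr mulr1 mulrC; lra.
- move=> tau.
  (* A family [tau] that is not of the form [tops alpha] has an empty block. *)
  have [[k0 k0B]|none] := pselect (exists k, block alpha tau k); last first.
    rewrite big_pred0 => [|k]; last by apply/negP => kB; apply: none; exists k.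
    by rewrite mulr_ge0 ?sqr_ge0 // mulr_ge0 ?sqr_ge0.
  have tt j : tops alpha (tau j) = tau j by have /forallP/(_ j)/eqP<- := k0B; rewrite topsK.
  have hV u a rho : u != finset.set0 -> (forall j, (a j <= alpha)%N) -> weights (~: u) rho ->
    (fractional_variation lambda u (int_coords (~: u)
      (fun x => mixed_partial a f x * \prod_(j in ~: u) rho j (x 0 j))%R) <= V%:E)%E.
    by move=> u0 aa wr; apply: le_trans (hV0 u a rho u0 aa wr) _; rewrite lee_fin /V; lra.
  have MV : M <= V by rewrite /V; lra.
  have := block_sum_pos LN N0 (ltW om0) fC (mixed_partial_ucont fC) hmod hM M0 MV hV tt.
  move/le_trans; apply; rewrite -/K.
  have := hbw tau; have := block_weight_gt0 alpha lambda tau.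
  set w := block_weight _ _ _ => w0 bww.
  have ee : block_error (s := s) (L := L) alpha N om M ^+ 2 <= e0 ^+ 2 by rewrite ler_sqr ?nnegrE // ltW.
  have e1 : 2 * (K * block_error (s := s) (L := L) alpha N om M ^+ 2) <= w ^+ 2.
    by apply: le_trans bww; apply: le_trans e0K; rewrite ler_wpM2l // ler_wpM2l.
  have V2 : 1 <= V ^+ 2 by rewrite exprn_ege1.
  have w2 : 0 <= w ^+ 2 by rewrite sqr_ge0.
  nra.
Qed.

End approximation.

(** * Counting blocks of Walsh coefficients *)

Section block_sums.
Context {R : realType} {s : nat}.
Variables (alpha : nat) (lambda : R).
Hypothesis lambda01 : 0 < lambda <= 1.

Lemma powR_prod (I : Type) (r : seq I) (Q : pred I) (F : I -> R) (x : R) :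
  (forall i, 0 <= F i) -> (\prod_(i <- r | Q i) F i) `^ x = \prod_(i <- r | Q i) F i `^ x.
Proof.
move=> F0; elim: r => [|i r IH]; first by rewrite !big_nil powR1.
rewrite !big_cons; case: ifP => // Qi; rewrite powRM ?IH ?prodr_ge0 //.
Qed.

Lemma half_pow_bounds n : 0 < (2 ^- n : R) <= 1.
Proof. by rewrite invr_gt0 exprn_gt0 //= invf_le1 ?exprn_gt0 // exprn_ege1 // ler1n. Qed.

Lemma prod_half_bounds L (t : {set 'I_L}) : 0 < \prod_(l in t) (2 ^- l.+1 : R) <= 1.
Proof.
apply/andP; split.
  by apply: prodr_gt0 => l _; have /andP[] := half_pow_bounds l.+1.
by apply: prodr_ile1 => l _; have /andP[/ltW-> ->] := half_pow_bounds l.+1.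
Qed.

Definition digit_weight L (t : {set 'I_L}) : R :=
  \prod_(l in lead alpha t) 2 ^- l.+1 * (\prod_(l in t :\: lead alpha t) 2 ^- l.+1) `^ lambda.

Lemma block_weightE L (tau : {ffun 'I_s -> {set 'I_L}}) :
  block_weight alpha lambda tau = \prod_j digit_weight (tau j).
Proof.
rewrite /block_weight powR_prod ?big_split // => j.
by have /andP[/ltW] := prod_half_bounds (tau j :\: lead alpha (tau j)).
Qed.

Lemma digit_weight_gt0 L (t : {set 'I_L}) : 0 < digit_weight t.
Proof.
have /andP[h1 _] := prod_half_bounds (lead alpha t).
by have /andP[h2 _] := prod_half_bounds (t :\: lead alpha t); rewrite mulr_gt0 ?powR_gt0.
Qed.

Lemma digit_weight_le L (t : {set 'I_L}) :
  digit_weight t <= (\prod_(l in t) 2 ^- l.+1) `^ lambda.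
Proof.
rewrite [X in _ <= X `^ _](big_setID (lead alpha t)) /= (finset.setIidPr (lead_sub _ _)).
have h1 := prod_half_bounds (lead alpha t).
have /andP[/ltW h2 _] := prod_half_bounds (t :\: lead alpha t).
rewrite powRM //; last by case/andP: h1 => /ltW.
by rewrite ler_wpM2r ?powR_ge0 // ger1_powR //; case/andP: lambda01.
Qed.

Lemma digit_weight_le1 L (t : {set 'I_L}) : digit_weight t <= 1.
Proof.
apply: le_trans (digit_weight_le t) _; have /andP[p0 p1] := prod_half_bounds t.
have /andP[l0 _] := lambda01; have one : 1 `^ lambda = 1 :> R by rewrite powR1.
rewrite -[leRHS]one.
by rewrite ge0_ler_powR ?nnegrE ?(ltW l0) ?(ltW p0).
Qed.

(** Each weight is at most the product of (2^-(l+1))^lambda over its digits. Summed over all sets of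
    digits this factors into the product of 1 + q^(l+1), at most exp(1/(1-q)) whatever L is. *)
Lemma sum_block_weight_le (del : R) : 0 < del -> exists2 S : R, 0 < S & forall L,
  \sum_(tau : {ffun 'I_s -> {set 'I_L}}) block_weight alpha lambda tau `^ del <= S.
Proof.
move=> del0; have /andP[l0 l1] := lambda01.
pose q : R := 2^-1 `^ (lambda * del).
have q0 : 0 < q by rewrite powR_gt0 // invr_gt0.
have q1 : q < 1.
  have one : 1 `^ (lambda * del) = 1 :> R by rewrite powR1.
  rewrite -one gt0_ltr_powR ?mulr_gt0 ?nnegrE ?invr_ge0 //.
  by rewrite invf_lt1 // ltr1n.
have hq l : (2 ^- l.+1) `^ (lambda * del) = q ^+ l.+1.
  by rewrite -exprVn -[2^-1 ^+ _]powR_mulrn ?invr_ge0 // powRAC powR_mulrn ?powR_ge0.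
pose C := (1 - q)^-1.
have sumq L : \sum_(l < L) q ^+ l.+1 <= C.
  apply: (@le_trans _ _ (\sum_(l < L) q ^+ l)).
    by apply: ler_sum => l _; rewrite exprS ler_piMl ?exprn_ge0 ?ltW.
  rewrite -[leRHS]mul1r ler_pdivlMr ?subr_gt0 //.
  have := subrX1 q L; have := exprn_ge0 L (ltW q0); nra.
exists (expR C ^+ s) => [|L]; first by rewrite exprn_gt0 ?expR_gt0.
apply: (@le_trans _ _ (\sum_(tau : {ffun 'I_s -> {set 'I_L}}) \prod_j \prod_(l in tau j) q ^+ l.+1)).
  apply: ler_sum => tau _; rewrite block_weightE powR_prod => [|j]; last exact/ltW/digit_weight_gt0.
  apply: ler_prod => j _; rewrite powR_ge0 /=.
  have := digit_weight_le (tau j); move/(ge0_ler_powR (ltW del0)).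
  rewrite !nnegrE powR_ge0 ltW ?digit_weight_gt0 // => /(_ isT isT)/le_trans; apply.
  rewrite -powRrM powR_prod => [|l]; last by have /andP[/ltW] := half_pow_bounds l.+1.
  by rewrite le_eqVlt; apply/orP; left; apply/eqP/eq_bigr => l _.
rewrite -(bigA_distr_bigA (fun (j : 'I_s) (t : {set 'I_L}) => \prod_(l in t) q ^+ l.+1)) /=.
rewrite prodr_const card_ord lerXn2r ?nnegrE ?expR_ge0 //.
  by apply: sumr_ge0 => t _; apply: prodr_ge0 => l _; rewrite exprn_ge0 // ltW.
have -> : \sum_(t : {set 'I_L}) \prod_(l in t) q ^+ l.+1 = \prod_(l < L) (q ^+ l.+1 + 1).
  by rewrite bigA_distr; apply: eq_bigr => t _; rewrite big_mkcond.
apply: (@le_trans _ _ (expR (\sum_(l < L) q ^+ l.+1))); last by rewrite ler_expR.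
suff : 0 <= \prod_(l < L) (q ^+ l.+1 + 1) <= expR (\sum_(l < L) q ^+ l.+1) by case/andP.
elim/big_ind2: _ => [|x1 x2 y1 y2 /andP[a b] /andP[c d]|l _].
- by rewrite expR0 ler01 lexx.
- by rewrite mulr_ge0 //= expRD ler_pM.
- by rewrite addr_ge0 ?exprn_ge0 ?(ltW q0) //= addrC expR_ge1Dx.
Qed.

Let A := alpha%:R + lambda.

Let A0 : 0 < A. Proof. by have /andP[l0 _] := lambda01; rewrite ltr_wpDl. Qed.

(** With pivot l there are [alpha] leading digits, all finer than l, so the weight is at most
    2^(-(l+1) A), while the fiber has at most 2^(l+1) elements. *)
Lemma card_fiber_le L (t : {set 'I_L}) :
  #|[set k | tops alpha k == t]%SET|%:R <= digit_weight t `^ (- A^-1).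
Proof.
have [->|[k0]] := set_0Vmem [set k | tops alpha k == t]%SET; first by rewrite cards0 powR_ge0.
rewrite inE => /eqP tk0; have tt : tops alpha t = t by rewrite -tk0 topsK.
have [e ce he] := card_fiber_tops alpha t.
apply: (@le_trans _ _ (2 ^+ e)); first by rewrite -natrX ler_nat.
have w0 := digit_weight_gt0 t.
suff h : digit_weight t <= (2 ^+ e) `^ (- A).
  rewrite powRN -[X in X <= _]invrK lef_pV2 ?posrE ?invr_gt0 ?exprn_gt0 ?powR_gt0 //.
  have : 0 <= A^-1 by rewrite invr_ge0 ltW.
  move/ge0_ler_powR => /(_ _ _ _ _ h); rewrite !nnegrE powR_ge0 ltW // => /(_ isT isT)/le_trans; apply.
  rewrite -powRrM mulNr divff ?lt0r_neq0 // powR_inv1 ?exprn_ge0 //.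
case: he => [->|[l tl [el cl]]]; first by rewrite expr0 powR1 digit_weight_le1.
rewrite tt in tl.
have lt : l \in t :\: lead alpha t by rewrite tl finset.set11.
move: lt; rewrite inE => /andP[ll lt].
apply: (@le_trans _ _ ((2 ^- l.+1) `^ A)).
  rewrite /digit_weight tl big_set1 powRD; last by rewrite lt0r_neq0 ?implybT // invr_gt0 exprn_gt0.
  rewrite ler_wpM2r ?powR_ge0 // powR_mulrn ?invr_ge0 ?exprn_ge0 // -{2}cl -prodr_const.
  apply: ler_prod => l' l't; have /andP[/ltW -> _] := half_pow_bounds l'.+1.
  rewrite lef_pV2 ?posrE ?exprn_gt0 // ler_weXn2l ?ler1n // ltnS ltnW //.
  exact: below_lead l't.
rewrite powRN -(powR_inv1 (_ : 0 <= (2 ^+ e) `^ A)) ?powR_ge0 // -powRrM mulrN1 -mulN1r powRrM powR_inv1 ?exprn_ge0 //.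
apply: ge0_ler_powR; rewrite ?nnegrE ?(ltW A0) ?invr_ge0 ?exprn_ge0 //.
by rewrite lef_pV2 ?posrE ?exprn_gt0 // ler_weXn2l ?ler1n.
Qed.

Lemma card_block_le L (tau : {ffun 'I_s -> {set 'I_L}}) :
  #|block alpha tau|%:R <= block_weight alpha lambda tau `^ (- A^-1).
Proof.
rewrite block_weightE powR_prod => [|j]; last exact/ltW/digit_weight_gt0.
have -> : #|block alpha tau|%:R = \prod_j #|[set k | tops alpha k == tau j]%SET|%:R :> R.
  have -> : \prod_j #|[set k | tops alpha k == tau j]%SET|%:R =
      \prod_j \sum_(k : {set 'I_L}) (tops alpha k == tau j)%:R :> R.
    apply: eq_bigr => j _; rewrite -sum1_card natr_sum big_mkcond /=; apply: eq_bigr => k _.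
    by rewrite inE; case: eqP.
  rewrite bigA_distr_bigA -sum1_card natr_sum big_mkcond /=; apply: eq_bigr => k _.
  rewrite unfold_in /block; case: ifP => [/forallP h|/negbT].
    by rewrite big1 // => j _; rewrite h.
  by rewrite negb_forall => /existsP[j /negPf h]; rewrite (bigD1 j) //= h mul0r.
by apply: ler_prod => j _; rewrite ler0n card_fiber_le.
Qed.

Definition block_of L (k : {ffun 'I_s -> {set 'I_L}}) : {ffun 'I_s -> {set 'I_L}} :=
  [ffun j => tops alpha (k j)].

Lemma block_ofE L (k tau : {ffun 'I_s -> {set 'I_L}}) : (block_of k == tau) = block alpha tau k.
Proof.
apply/eqP/forallP => [<- j|h]; first by rewrite ffunE.
by apply/ffunP => j; rewrite ffunE; apply/eqP.
Qed.

(* Rankin's trick: block weights to the power [del] are summable uniformly in L,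
   and a block of weight w has at most w `^ (- A^-1) elements. *)
Lemma block_tail (del : R) : 0 < del -> del <= 2 -> exists2 S : R, 0 < S &
  forall L (theta B : R) (c : {ffun 'I_s -> {set 'I_L}} -> R), 0 < theta -> 0 <= B ->
    (forall tau, \sum_(k | block alpha tau k) c k ^+ 2 <= B * block_weight alpha lambda tau ^+ 2) ->
    #|[set k : {ffun 'I_s -> {set 'I_L}} | theta <= block_weight alpha lambda (block_of k)]%SET|%:R <=
        S * theta `^ (- (A^-1 + del)) /\
    \sum_(k : {ffun 'I_s -> {set 'I_L}} | block_weight alpha lambda (block_of k) < theta) c k ^+ 2
        <= B * S * theta `^ (2 - del).
Proof.
move=> del0 del2; have [S S0 hS] := sum_block_weight_le del0.
exists S => // L th B c th0 B0 hB.
pose w (tau : {ffun 'I_s -> {set 'I_L}}) : R := block_weight alpha lambda tau.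
have w0 tau : 0 < w tau by apply: block_weight_gt0.
have Ai0 : 0 <= A^-1 by rewrite invr_ge0 ltW.
split.
  rewrite -sum1_card natr_sum.
  rewrite (partition_big (@block_of L) (fun tau => th <= w tau)) /=; last by move=> k; rewrite inE.
  apply: (@le_trans _ _ (\sum_tau w tau `^ del * th `^ (- (A^-1 + del)))); last first.
    by rewrite -mulr_suml ler_wpM2r ?powR_ge0 //; apply: hS.
  rewrite [leRHS](bigID (fun tau => th <= w tau)) /=.
  rewrite -[leLHS]addr0; apply: lerD; last by apply: sumr_ge0 => tau _; rewrite mulr_ge0 ?powR_ge0.
  apply: ler_sum => tau thw.
  apply: (@le_trans _ _ #|block alpha tau|%:R).
    rewrite -natr_sum ler_nat sum1_card; apply: subset_leq_card; apply/fintype.subsetP => k.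
    by rewrite !unfold_in => /andP[_]; rewrite block_ofE.
  apply: le_trans (card_block_le _) _; rewrite -/(w tau).
  rewrite opprD powRD; last by rewrite lt0r_neq0 ?implybT.
  rewrite mulrCA -[leLHS]mulr1; apply: ler_pM; rewrite ?powR_ge0 ?ler01 //.
    by rewrite !powRN lef_pV2 ?posrE ?powR_gt0 //; apply: ge0_ler_powR; rewrite ?nnegrE ?(ltW th0) ?(ltW (w0 _)).
  by rewrite powRN ler_pdivlMr ?powR_gt0 // mul1r; apply: ge0_ler_powR; rewrite ?nnegrE ?(ltW th0) ?(ltW (w0 _)) ?(ltW del0).
rewrite (partition_big (@block_of L) (fun tau => w tau < th)) //=.
apply: (@le_trans _ _ (\sum_tau B * (w tau `^ del * th `^ (2 - del)))); last first.
  by rewrite -mulr_sumr -mulr_suml mulrA ler_wpM2r ?powR_ge0 // ler_wpM2l.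
rewrite [leRHS](bigID (fun tau => w tau < th)) /=.
rewrite -[leLHS]addr0; apply: lerD; last first.
  by apply: sumr_ge0 => tau _; rewrite !mulr_ge0 ?powR_ge0.
apply: ler_sum => tau thw.
apply: (@le_trans _ _ (\sum_(k | block alpha tau k) c k ^+ 2)).
  rewrite big_mkcond [leRHS]big_mkcond /=; apply: ler_sum => k _.
  rewrite block_ofE; case: (block alpha tau k); first by case: ifP; rewrite ?sqr_ge0.
  by rewrite andbF.
apply: le_trans (hB tau) _; rewrite ler_wpM2l // -/(w tau).
have -> : w tau ^+ 2 = w tau `^ del * w tau `^ (2 - del).
  rewrite -powRD; last by rewrite lt0r_neq0 ?implybT.
  by rewrite addrC subrK -powR_mulrn // ltW.
by rewrite ler_wpM2l ?powR_ge0 // ge0_ler_powR ?nnegrE ?subr_ge0 ?(ltW th0) ?(ltW (w0 _)) // ltW.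
Qed.

End block_sums.

(** * Walsh sums over digital nets *)

Section binary_numerals.

Lemma digit_sum (b : nat -> bool) (L l : nat) :
  digit (\sum_(i < L) b i * 2 ^ i)%N l = (l < L)%N && b l.
Proof.
have bound n : (\sum_(i < n) b i * 2 ^ i < 2 ^ n)%N.
  elim: n => [|n IH]; first by rewrite big_ord0.
  rewrite big_ord_recr /= expnS; move: IH; move: (\sum_(i < n) _)%N (2 ^ n)%N => x y.
  by case: (b n) => /=; lia.
elim: L => [|L IH]; first by rewrite big_ord0 /digit div0n.
rewrite big_ord_recr /= ltnS leq_eqVlt.
have [->|lL] := eqVneq l L.
  by rewrite /digit addnC divnMDl ?expn_gt0 // (divn_small (bound L)) addn0 oddb.
rewrite /=; case: (ltnP l L) => hl.
  rewrite hl /= in IH; rewrite -IH /digit.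
  have -> : (2 ^ L = 2 ^ (L - l) * 2 ^ l)%N by rewrite -expnD subnK // ltnW.
  rewrite mulnA addnC divnMDl ?expn_gt0 // oddD oddM oddX -(subnSK hl) /=.
  by rewrite ?andbF ?addFb ?addbF.
have {}hl : (L < l)%N by rewrite ltn_neqAle eq_sym lL.
rewrite /digit divn_small //; apply: (@leq_trans (2 ^ L.+1)); last by rewrite leq_exp2l.
have := bound L; rewrite expnS; move: (\sum_(i < L) _)%N (2 ^ L)%N => x y.
by case: (b L) => /=; lia.
Qed.

Lemma big_addb_widen (F : nat -> bool) n d : (forall l, (n <= l)%N -> F l = false) ->
  \big[addb/false]_(l < n + d) F l = \big[addb/false]_(l < n) F l.
Proof.
move=> h; rewrite big_split_ord /= [X in _ (+) X]big1 ?addbF // => i _.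
by rewrite h // leq_addr.
Qed.

Lemma digit_small k l : (k <= l)%N -> digit k l = false.
Proof. by move=> kl; rewrite /digit divn_small // (leq_ltn_trans kl) // ltn_expl. Qed.

Lemma big_addb_digit L (k : {set 'I_L}) (F : nat -> bool) :
  let n := (\sum_(l in k) 2 ^ l)%N in
  \big[addb/false]_(l < n) (digit n l && F l) = \big[addb/false]_(l in k) F l.
Proof.
move=> n.
pose mk (i : nat) := if insub i is Some i' then (i' : 'I_L) \in k else false.
have nE : n = (\sum_(i < L) mk i * 2 ^ i)%N.
  by rewrite /n big_mkcond /=; apply: eq_bigr => i _; rewrite /mk valK; case: (i \in k); rewrite ?mul1n.
have dE l : digit n l = mk l.
  rewrite nE digit_sum /mk.
  by case: insubP => [l' lL _|]; [rewrite lL|rewrite andbF].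
pose G l := digit n l && F l.
have GL l : (L <= l)%N -> G l = false by move=> Ll; rewrite /G dE /mk insubF // ltnNge Ll.
have Gn l : (n <= l)%N -> G l = false by move=> nl; rewrite /G digit_small.
(* [Z] runs over positions below the numeral, [chi] over positions below L; both ranges are widened
   to n + L, where the extra digits vanish. *)
rewrite -[LHS](@big_addb_widen G n L Gn) addnC (@big_addb_widen G L n GL).
rewrite [RHS]big_mkcond /=; apply: eq_bigr => l _.
by rewrite /G dE /mk valK; case: ifP.
Qed.

End binary_numerals.

Section net_sums.
Context {R : realType} {s m L : nat}.
Implicit Types (k : {ffun 'I_s -> {set 'I_L}}) (C : 'I_s * nat * 'I_m -> bool) (D : 'I_s * nat -> bool).

Definition numeral k : 'I_s -> nat := fun j => (\sum_(l in k j) 2 ^ l)%N.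

Lemma numeral_neq0 k : k != [ffun _ => finset.set0] -> exists j, numeral k j <> 0%N.
Proof.
move=> kn0; have [j kj] : exists j, k j != finset.set0.
  apply/existsP; rewrite -negb_forall; apply: contra kn0 => /forallP h.
  by apply/eqP/ffunP => j; rewrite ffunE; apply/eqP/h.
exists j; have /set0Pn[l lk] := kj; rewrite /numeral (bigD1 l) //=.
by move/eqP; rewrite addn_eq0 expn_eq0.
Qed.

Lemma ZE k (C : 'I_s * nat * 'I_m -> bool) :
  Z (numeral k) C = [forall p : 'I_m, ~~ \big[addb/false]_j \big[addb/false]_(l in k j) C (j, val l, p)].
Proof.
apply: eq_forallb => p; congr (~~ _); apply: eq_bigr => j _.
exact: (@big_addb_digit L (k j) (fun l => C (j, l, p))).
Qed.

Lemma sign_big_addb (I : Type) (r : seq I) (Q : pred I) (F : I -> bool) :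
  (-1) ^+ (\big[addb/false]_(i <- r | Q i) F i) = \prod_(i <- r | Q i) (-1) ^+ F i :> R.
Proof.
by apply: (big_morph (fun b : bool => (-1) ^+ b : R)) => // a b; rewrite signr_addb.
Qed.

(** This is orthogonality on a one-dimensional grid of 2^m points. The set K reverses positions
    because [digit] counts from the least significant digit and [bit m] from the most significant
    one. *)
Lemma avg_sign_digits (v : 'I_m -> bool) :
  avg (fun i : 'I_(2 ^ m) => \prod_(p < m) (-1) ^+ (v p && digit i p)) = [forall p, ~~ v p]%:R :> R.
Proof.
pose K : {set 'I_m} := [set q | v (rev_ord q)]%SET.
have -> : avg (fun i : 'I_(2 ^ m) => \prod_(p < m) (-1) ^+ (v p && digit i p)) =
   avg (fun i : 'I_(2 ^ m) => chi1 K (bit m i)) :> R.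
  apply: eq_avg => i; rewrite (reindex_inj rev_ord_inj) /chi1 [RHS]big_mkcond /=.
  apply: eq_bigr => q _; rewrite inE; case: (v _) => //=.
have [K0|Kn0] := eqVneq K finset.set0.
  have -> : [forall p, ~~ v p].
    apply/forallP => p; apply/negP => vp; have : rev_ord p \in K by rewrite inE rev_ordK.
    by rewrite K0 inE.
  rewrite -[RHS](@avg_const R 'I_(2 ^ m)) ?card_ord ?expn_gt0 //; apply: eq_avg => i.
  by rewrite K0 /chi1 big_set0.
rewrite /avg sum_chi1 // mulr0; case: forallP => // h.
by have /set0Pn[q] := Kn0; rewrite inE; have := h (rev_ord q); case: (v _).
Qed.

(** Before the shift, a Walsh function of the net is a character of the digits of i; it averages to
    1 when [Z] holds and to 0 otherwise. The shift contributes a sign independent of i. *)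
Lemma avg_chi_net k C (D : 'I_s * nat -> bool) :
  avg (fun i : 'I_(2 ^ m) => chi k (net_digit C D i)) =
  (Z (numeral k) C)%:R * chi k (fun j l => D (j, l)) :> R.
Proof.
pose v p := \big[addb/false]_j \big[addb/false]_(l in k j) C (j, val l, p).
rewrite ZE -(avg_sign_digits v) [RHS]mulrC -avgZ; apply: eq_avg => i.
have -> : \prod_(p < m) (-1) ^+ (v p && digit i p) =
   \prod_j \prod_(l in k j) \prod_(p < m) (-1) ^+ (C (j, val l, p) && digit i p) :> R.
  transitivity (\prod_(p < m) \prod_j \prod_(l in k j) (-1) ^+ (C (j, val l, p) && digit i p) : R).
    apply: eq_bigr => p _; case: (digit i p); last first.
      by rewrite andbF expr0 big1 // => j _; rewrite big1 // => l _; rewrite andbF.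
    rewrite andbT /v sign_big_addb; apply: eq_bigr => j _; rewrite sign_big_addb.
    by apply: eq_bigr => l _; rewrite andbT.
  rewrite exchange_big /=; apply: eq_bigr => j _; exact: exchange_big.
rewrite /chi -big_split /=; apply: eq_bigr => j _; rewrite /chi1 -big_split /=.
by apply: eq_bigr => l _; rewrite /net_digit signr_addb sign_big_addb mulrC.
Qed.

Section limits.
Variable b : nat -> bool.

Let u : nat -> R := series (fun l => (b l)%:R * 2 ^- l.+1).

Let uE n : u n = dyadic_prefix n b.
Proof. by rewrite /u /series /= big_mkord. Qed.

Lemma dyadic_prefix_tail n d :
  dyadic_prefix n b <= (dyadic_prefix (n + d) b : R) <= dyadic_prefix n b + (2 ^- n - 2 ^- (n + d)).
Proof.
elim: d => [|d /andP[IH1 IH2]]; first by rewrite addn0 subrr addr0 lexx.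
rewrite addnS /dyadic_prefix big_ord_recr /= -/(dyadic_prefix (n + d) b).
have e : 2 ^- (n + d) = 2 * 2 ^- (n + d).+1 :> R.
  by rewrite exprS invfM mulrA divff ?mul1r ?pnatr_eq0.
have q0 : 0 < 2 ^- (n + d).+1 :> R by rewrite invr_gt0 exprn_gt0.
move: IH2; rewrite e; move: (2 ^- (n + d).+1) q0 (dyadic_prefix (n + d) b) IH1 => q q0 x.
rewrite -/(dyadic_prefix n b); case: (b (n + d)%N); rewrite ?mul1r ?mul0r => h1 h2; apply/andP; split; lra.
Qed.

Lemma dyadic_prefix_lim n : dyadic_prefix n b <= limn u <= dyadic_prefix n b + 2 ^- n.
Proof.
have mono : nondecreasing_seq u.
  apply/nondecreasing_seqP => k; rewrite !uE -addn1; by have /andP[] := dyadic_prefix_tail k 1.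
have ub : has_ubound (range u).
  exists 1 => _ [k _ <-]; rewrite uE; have /andP[_] := dyadic_prefix_tail 0 k.
  rewrite add0n /dyadic_prefix big_ord0 expr0 invr1 add0r => /le_trans; apply.
  by rewrite gerBl invr_ge0 exprn_ge0.
have cu := nondecreasing_is_cvgn mono ub.
apply/andP; split; first by rewrite -uE; apply: nondecreasing_cvgn_le.
apply: limr_le => //; near=> k.
have nk : (n <= k)%N by near: k; exists n.
rewrite uE -(subnKC nk); have /andP[_ /le_trans] := dyadic_prefix_tail n (k - n); apply.
by rewrite lerD2l gerBl invr_ge0 exprn_ge0.
Unshelve. all: by end_near. Qed.

End limits.

Lemma net_point_dyadic C D i j n :
  dyadic_prefix n (net_digit C D i j) <= (net_point C D i 0 j : R) <= dyadic_prefix n (net_digit C D i j) + 2 ^- n.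
Proof. by rewrite mxE; apply: dyadic_prefix_lim. Qed.

Lemma net_point_cube C D i : unit_cube (net_point C D i : 'rV[R]_s).
Proof.
move=> j; have := net_point_dyadic C D i j 0.
by rewrite /dyadic_prefix big_ord0 expr0 invr1 add0r.
Qed.

Lemma net_estimator_approx (f : 'rV[R]_s -> R) (c : {ffun 'I_s -> {set 'I_L}} -> R) eta C D :
  (forall (x : 'rV[R]_s) (b : 'I_s -> nat -> bool), unit_cube x ->
        (forall j, dyadic_prefix L (b j) <= x 0 j <= dyadic_prefix L (b j) + 2 ^- L) ->
        `|f x - \sum_k c k * chi k b| <= eta) ->
  `|net_estimator f C D - \sum_k c k * (Z (numeral k) C)%:R * chi k (fun j l => D (j, l))| <= eta.
Proof.
move=> h.
have card0 : (0 < #|'I_(2 ^ m)|)%N by rewrite card_ord expn_gt0.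
have -> : net_estimator f C D = avg (fun i : 'I_(2 ^ m) => f (net_point C D i)).
  by rewrite /net_estimator /avg card_ord natrX.
have -> : \sum_k c k * (Z (numeral k) C)%:R * chi k (fun j l => D (j, l)) =
    avg (fun i : 'I_(2 ^ m) => \sum_k c k * chi k (net_digit C D i)).
  by rewrite avg_sum; apply: eq_bigr => k _; rewrite avgZ avg_chi_net mulrA.
rewrite -avgB; apply: norm_avg_le => // i; apply: h => [|j]; first exact: net_point_cube.
exact: net_point_dyadic.
Qed.

Lemma net_estimator_bounded (f : 'rV[R]_s -> R) M C D :
  (forall x, unit_cube x -> `|f x| <= M) -> `|net_estimator f C D| <= M.
Proof.
move=> fM; have -> : net_estimator f C D = avg (fun i : 'I_(2 ^ m) => f (net_point C D i)).
  by rewrite /net_estimator /avg card_ord natrX.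
apply: norm_avg_le => [|i]; first by rewrite card_ord expn_gt0.
by apply: fM; apply: net_point_cube.
Qed.

End net_sums.

(** * Failure of a single copy *)

Section boolean_events.
Context {I : Type}.

Lemma measurable_bit_event (i : I) : measurable [set b : bits I | b i].
Proof. by apply: sub_sigma_algebra; exists i. Qed.

Lemma measurable_bool_not d (T : measurableType d) (A : T -> bool) :
  measurable [set b | A b] -> measurable [set b | ~~ A b].
Proof.
move=> mA; rewrite (_ : [set b | ~~ A b] = ~` [set b | A b]); first exact: measurableC.
by apply/seteqP; split => b /= /negP.
Qed.

Lemma measurable_bool_and d (T : measurableType d) (A B : T -> bool) :
  measurable [set b | A b] -> measurable [set b | B b] -> measurable [set b | A b && B b].
Proof.
move=> mA mB; rewrite (_ : [set b | A b && B b] = [set b | A b] `&` [set b | B b]); first exact: measurableI.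
by apply/seteqP; split => b /= /andP.
Qed.

Lemma measurable_bool_addb d (T : measurableType d) (A B : T -> bool) :
  measurable [set b | A b] -> measurable [set b | B b] -> measurable [set b | A b (+) B b].
Proof.
move=> mA mB; rewrite (_ : [set b | A b (+) B b] = [set b | ~~ (~~ (A b && ~~ B b) && ~~ (~~ A b && B b))]).
  by apply/measurable_bool_not/measurable_bool_and; apply/measurable_bool_not/measurable_bool_and => //;
    apply: measurable_bool_not.
by apply/seteqP; split => b /=; case: (A b); case: (B b).
Qed.

Lemma measurable_bool_const d (T : measurableType d) (c : bool) : measurable [set b : T | c].
Proof.
case: c.
  by rewrite (_ : [set b : T | true] = setT); [exact: measurableT|apply/seteqP; split].
by rewrite (_ : [set b : T | false] = set0); [exact: measurable0|apply/seteqP; split].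
Qed.

Lemma measurable_bool_big d (T : measurableType d) (op : bool -> bool -> bool) (x : bool)
    (J : Type) (r : seq J) (Q : pred J) (A : J -> T -> bool) :
  (forall A B : T -> bool, measurable [set b | A b] -> measurable [set b | B b] ->
     measurable [set b | op (A b) (B b)]) ->
  (forall j, measurable [set b | A j b]) ->
  measurable [set b | \big[op/x]_(j <- r | Q j) A j b].
Proof.
move=> hop mA; elim: r => [|j r IH].
  under eq_set do rewrite big_nil.
  exact: measurable_bool_const.
under eq_set do rewrite big_cons.
by case: (Q j) => //; apply: hop.
Qed.

Lemma measurable_bool_forall d (T : measurableType d) (J : finType) (A : J -> T -> bool) :
  (forall j, measurable [set b | A j b]) -> measurable [set b | [forall j, A j b]].
Proof.
move=> mA; rewrite (_ : [set b | [forall j, A j b]] = [set b | \big[andb/true]_j A j b]).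
  by apply: measurable_bool_big => // *; apply: measurable_bool_and.
by apply/seteqP; split => b /=; rewrite big_andE.
Qed.

End boolean_events.

Section measurable_states.
Context {d : measure_display} {T : measurableType d}.
Variables (S : finType) (phi : T -> S).
Hypothesis mphi : forall x, measurable [set w | phi w = x].

Lemma mem_seq_cons_set (x : S) (s : seq S) :
  [set w | phi w \in x :: s] = [set w | phi w = x] `|` [set w | phi w \in s].
Proof.
apply/seteqP; split => w /=; rewrite inE; first by case/predU1P; [left|right].
by case=> [->|->]; rewrite ?eqxx ?orbT.
Qed.

Lemma measurable_mem_seq (s : seq S) : measurable [set w | phi w \in s].
Proof.
elim: s => [|x s IH]; first by rewrite (_ : [set _ | _] = set0) //; apply/seteqP; split.
by rewrite mem_seq_cons_set; apply: measurableU.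
Qed.

Lemma mem_enum_set (Q : pred S) : [set w | Q (phi w)] = [set w | phi w \in enum Q].
Proof. by apply/seteqP; split => w /=; rewrite mem_enum. Qed.

Lemma measurable_state (Q : pred S) : measurable [set w | Q (phi w)].
Proof. by rewrite mem_enum_set; apply: measurable_mem_seq. Qed.

End measurable_states.

Section finite_states.
Context {R : realType} {d : measure_display} {T : measurableType d} (P : probability T R).

Definition pr (A : set T) : R := fine (P A).

Lemma pr_ge0 A : 0 <= pr A. Proof. exact: fine_ge0. Qed.

Lemma prE A : measurable A -> P A = (pr A)%:E.
Proof. by move=> mA; rewrite fineK // fin_num_measure. Qed.

Lemma prU A B : measurable A -> measurable B -> A `&` B = set0 -> pr (A `|` B) = pr A + pr B.
Proof.
move=> mA mB AB; apply: EFin_inj; rewrite EFinD -!prE ?measureU //; exact: measurableU.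
Qed.

Lemma pr_le_union A B : measurable A -> measurable B -> pr (A `|` B) <= pr A + pr B.
Proof.
move=> mA mB; rewrite -lee_fin EFinD -!prE //; first exact: measureU2.
exact: measurableU.
Qed.

Section state.
Variables (S : finType) (phi : T -> S).
Hypothesis mphi : forall x, measurable [set w | phi w = x].

Lemma pr_mem_seq (s : seq S) : uniq s ->
  pr [set w | phi w \in s] = \sum_(x <- s) pr [set w | phi w = x].
Proof.
elim: s => [_|x s IH /= /andP[xs us]].
  rewrite big_nil (_ : [set _ | _] = set0); last by apply/seteqP; split => w //=.
  by rewrite /pr measure0.
rewrite mem_seq_cons_set big_cons -IH // prU //; first exact: measurable_mem_seq.
apply/seteqP; split => w //= -[/= e ws].
by rewrite -e ws in xs.
Qed.

Lemma pr_state (Q : pred S) : pr [set w | Q (phi w)] = \sum_(x | Q x) pr [set w | phi w = x].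
Proof. by rewrite mem_enum_set pr_mem_seq ?enum_uniq // big_enum. Qed.

End state.
End finite_states.

Section digit_states.
Context {R : realType} {s m L : nat}.
Local Notation KT := {ffun 'I_s -> {set 'I_L}}.
Local Notation BT := {ffun 'I_s * 'I_L -> bool}.
Implicit Types (c : KT -> R) (z : {set KT}) (b : BT).

Definition zeros (C : gen_matrices s m) : {set KT} := [set k | Z (numeral k) C]%SET.
Definition digits (D : shifts s) : BT := [ffun jl => D (jl.1, val jl.2)].
Definition digits_of b (j : 'I_s) (l : nat) : bool :=
  if insub l is Some l' then b (j, l') else false.

Lemma chi_digits (k : KT) (D : shifts s) :
  chi k (digits_of (digits D)) = chi k (fun j l => D (j, l)) :> R.
Proof.
apply: eq_bigr => j _; apply: eq_bigr => l _.
by rewrite /digits_of valK ffunE.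
Qed.

Lemma avg_chi_digits (k : KT) :
  avg (fun b : BT => chi k (digits_of b)) = (k == [ffun _ => finset.set0])%:R :> R.
Proof.
have -> : avg (fun b : BT => chi k (digits_of b)) =
  avg (fun b : BT => \prod_jl (if jl.2 \in k jl.1 then (-1) ^+ b jl else 1)) :> R.
  apply: eq_avg => b; rewrite /chi.
  transitivity (\prod_(j < s) \prod_(l < L) (if l \in k j then (-1) ^+ b (j, l) else 1) : R); last first.
    by rewrite pair_bigA /=; apply: eq_bigr => -[j l] _.
  apply: eq_bigr => j _; rewrite /chi1 big_mkcond /=; apply: eq_bigr => l _.
  by rewrite /digits_of valK.
rewrite (avg_ffun_prod (fun (jl : 'I_s * 'I_L) (t : bool) => if jl.2 \in k jl.1 then (-1) ^+ t else 1)).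
have [->|kn0] := eqVneq k.
  by rewrite big1 // => jl _; rewrite ffunE inE /= avg_const ?card_bool.
have [j kj] : exists j, k j != finset.set0.
  apply/existsP; rewrite -negb_forall; apply: contra kn0 => /forallP h.
  by apply/eqP/ffunP => j; rewrite ffunE; apply/eqP/h.
have /set0Pn[l lk] := kj; rewrite (bigD1 (j, l)) //= lk /avg big_bool /= expr1 expr0.
by rewrite addNr mulr0 mul0r.
Qed.

Lemma measurable_Z (k : 'I_s -> nat) : measurable [set C : gen_matrices s m | Z k C].
Proof.
apply: measurable_bool_forall => p; apply: measurable_bool_not.
apply: measurable_bool_big => [A B mA mB|j]; first exact: measurable_bool_addb.
apply: measurable_bool_big => [A B mA mB|l]; first exact: measurable_bool_addb.
apply: measurable_bool_and; first exact: measurable_bool_const.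
exact: measurable_bit_event.
Qed.

Lemma measurable_zeros z : measurable [set C : gen_matrices s m | zeros C = z].
Proof.
rewrite (_ : [set C | _] = [set C : gen_matrices s m | [forall k, Z (numeral k) C == (k \in z)]]).
  apply: measurable_bool_forall => k; case: (k \in z).
    rewrite (_ : [set C | _] = [set C : gen_matrices s m | Z (numeral k) C]); first exact: measurable_Z.
    by apply/seteqP; split => C /=; rewrite eqb_id.
  rewrite (_ : [set C | _] = [set C : gen_matrices s m | ~~ Z (numeral k) C]); last first.
    by apply/seteqP; split => C /=; rewrite eqbF_neg.
  by apply: measurable_bool_not; apply: measurable_Z.
apply/seteqP; split => C /= => [<-|/forallP h]; first by apply/forallP => k; rewrite inE.
apply/finset.setP => k; by rewrite inE (eqP (h k)).
Qed.

Lemma measurable_digits b : measurable [set D : shifts s | digits D = b].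
Proof.
rewrite (_ : [set D | _] = [set D : shifts s | [forall jl : 'I_s * 'I_L, D (jl.1, val jl.2) == b jl]]).
  apply: measurable_bool_forall => jl; case: (b jl).
    rewrite (_ : [set D | _] = [set D : shifts s | D (jl.1, val jl.2)]); first exact: measurable_bit_event.
    by apply/seteqP; split => D /=; rewrite eqb_id.
  rewrite (_ : [set D | _] = [set D : shifts s | ~~ D (jl.1, val jl.2)]); last first.
    by apply/seteqP; split => D /=; rewrite eqbF_neg.
  by apply: measurable_bool_not; apply: measurable_bit_event.
apply/seteqP; split => D /= => [<-|/forallP h]; first by apply/forallP => jl; rewrite ffunE.
by apply/ffunP => jl; rewrite ffunE (eqP (h jl)).
Qed.

End digit_states.

Section one_copy.
Context {R : realType} {s m n L : nat} {d : measure_display} {T : measurableType d}.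
Variables (Q : probability (gen_matrices s m) R) (P : probability T R).
Variables (C : 'I_n -> T -> gen_matrices s m) (D : 'I_n -> T -> shifts s).
Hypothesis NC : net_copies Q P C D.
Local Notation KT := {ffun 'I_s -> {set 'I_L}}.
Local Notation BT := {ffun 'I_s * 'I_L -> bool}.
Variable i : 'I_n.

(** Up to [eta], a copy enters only through this finite datum, so its failure is a union of finitely
    many measurable events. *)
Definition copy_state (w : T) : {set KT} * BT := (zeros (C i w), digits (D i w)).

Lemma measurable_preC (A : set (gen_matrices s m)) : measurable A -> measurable (C i @^-1` A).
Proof. by move=> mA; rewrite -[_ @^-1` _]setTI; apply: (measurable_C NC). Qed.

Lemma measurable_preD (A : set (shifts s)) : measurable A -> measurable (D i @^-1` A).
Proof. by move=> mA; rewrite -[_ @^-1` _]setTI; apply: (measurable_D NC). Qed.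

Let rho (z : {set KT}) : R := pr P [set w | zeros (C i w) = z].
Let beta (b : BT) : R := pr P [set w | digits (D i w) = b].

Lemma measurable_copy_zeros (z : {set KT}) : measurable [set w | zeros (C i w) = z].
Proof. exact: (measurable_preC (measurable_zeros z)). Qed.

Lemma measurable_copy_digits (b : BT) : measurable [set w | digits (D i w) = b].
Proof. exact: (measurable_preD (measurable_digits b)). Qed.

Lemma copy_state_split (z : {set KT}) (b : BT) :
  [set w | copy_state w = (z, b)] = [set w | zeros (C i w) = z] `&` [set w | digits (D i w) = b].
Proof. by apply/seteqP; split => w; rewrite /copy_state /=; case=> -> ->. Qed.

Lemma measurable_copy_state x : measurable [set w | copy_state w = x].
Proof.
case: x => z b; rewrite copy_state_split.
by apply: measurableI; [exact: measurable_copy_zeros|exact: measurable_copy_digits].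
Qed.

Lemma pr_copy_state (z : {set KT}) (b : BT) :
  pr P [set w | copy_state w = (z, b)] = rho z * beta b.
Proof.
rewrite copy_state_split; apply: EFin_inj; rewrite EFinM /rho /beta -!prE.
- exact: (independent_CD NC i (measurable_zeros z) (measurable_digits b)).
- exact: measurable_copy_digits.
- exact: measurable_copy_zeros.
- by apply: measurableI; [exact: measurable_copy_zeros|exact: measurable_copy_digits].
Qed.

Lemma pr_bit (jl : 'I_s * nat) (v : bool) : P [set w | D i w jl = v] = (2^-1)%:E.
Proof.
have ht := uniform_D NC i jl; case: v => //.
have mt : measurable [set w | D i w jl = true].
  exact: (measurable_preD (measurable_bit_event jl)).
rewrite (_ : [set w | D i w jl = false] = ~` [set w | D i w jl = true]); last first.
  by apply/seteqP; split => w /=; [move->|move/negP/negbTE].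
by rewrite probability_setC // ht -EFinB; congr (_%:E); lra.
Qed.

Lemma beta_const (b b' : BT) : beta b = beta b'.
Proof.
pose J : {fset 'I_s * nat} := [fset (jl.1, val jl.2) | jl in [set: 'I_s * 'I_L]%SET]%fset.
suff h (b0 : BT) : P [set w | digits (D i w) = b0] = (\prod_(jl <- enum_fset J) (2^-1 : R)%:E)%E.
  by rewrite /beta /pr !h.
pose A (jl : 'I_s * nat) : set bool := [set digits_of b0 jl.1 jl.2].
rewrite (_ : [set w | digits (D i w) = b0] =
    \bigcap_(jl in [set` J]) ((fun w => D i w jl : bool) @^-1` A jl)); last first.
  apply/seteqP; split => w /=.
    by move=> e jl /imfsetP[[j l] /= _ ->]; rewrite /A /= /digits_of valK -e ffunE.
  move=> h; apply/ffunP => -[j l]; rewrite ffunE.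
  have : (j, val l) \in J by apply/imfsetP; exists (j, l); rewrite ?inE.
  by move/h; rewrite /A /= /digits_of valK.
rewrite (independent_D NC) //; apply: eq_bigr => jl _.
by rewrite -(pr_bit jl (digits_of b0 jl.1 jl.2)); congr (P _); apply/seteqP; split.
Qed.

Lemma sum_rho (Phi : pred {set KT}) : \sum_(z | Phi z) rho z = pr P [set w | Phi (zeros (C i w))].
Proof. by rewrite (pr_state P measurable_copy_zeros). Qed.

Lemma sum_beta : \sum_b beta b = 1.
Proof.
have := pr_state P measurable_copy_digits predT => /= <-.
rewrite (_ : [set _ | _] = setT); last by apply/seteqP; split.
by rewrite /pr probability_setT.
Qed.

(** All patterns of shift digits are equally likely, so an expectation over the shift is an [avg]
    and [bessel_dual] applies to it. *)
Lemma sum_beta_avg (F : BT -> R) : \sum_b beta b * F b = avg F.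
Proof.
have bE b : beta b = #|BT|%:R^-1.
  have := sum_beta; rewrite (eq_bigr (fun=> beta b)) => [|b' _]; last exact: beta_const.
  rewrite sumr_const -[beta b *+ _]mulr_natl => e.
  have c0 : #|BT|%:R != 0 :> R.
    by apply/negP => /eqP c0; move: e; rewrite c0 mul0r => /eqP; rewrite eq_sym oner_eq0.
  by apply: (mulfI c0); rewrite e divff.
by rewrite /avg mulr_sumr; apply: eq_bigr => b _; rewrite bE.
Qed.

Variables (c : KT -> R) (K : {set KT}) (q t : R).
Hypotheses (t0 : 0 < t) (K0 : [ffun _ => finset.set0] \notin K)
  (full_rank : forall k : KT, k != [ffun _ => finset.set0] -> (Q [set M | Z (numeral k) M] <= q%:E)%E).

Definition tail_sum (x : {set KT} * BT) : R :=
  \sum_(k | (k != [ffun _ => finset.set0]) && (k \notin K))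
     c k * (k \in x.1)%:R * chi k (digits_of x.2).

Definition bad_state (x : {set KT} * BT) : bool :=
  (K :&: x.1 != finset.set0) || (t < tail_sum x ^+ 2).

Lemma pr_zero (k : KT) : k != [ffun _ => finset.set0] -> \sum_(z : {set KT} | k \in z) rho z <= q.
Proof.
move=> k0; rewrite (sum_rho (fun z => k \in z)).
rewrite (_ : [set w | _] = C i @^-1` [set M | Z (numeral k) M]); last first.
  by apply/seteqP; split => w /=; rewrite inE.
rewrite -lee_fin -prE; last by apply: measurable_preC; apply: measurable_Z.
by rewrite (law_C NC) ?full_rank //; apply: measurable_Z.
Qed.

Lemma pr_bad_state : pr P [set w | bad_state (copy_state w)] <=
  q * (#|K|%:R + (\sum_(k | (k != [ffun _ => finset.set0]) && (k \notin K)) c k ^+ 2) / t).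
Proof.
have rho0 z : 0 <= rho z by apply: pr_ge0.
have beta0 b : 0 <= beta b by apply: pr_ge0.
rewrite (pr_state P measurable_copy_state).
have -> : \sum_(x | bad_state x) pr P [set w | copy_state w = x] =
    \sum_(x | bad_state x) rho x.1 * beta x.2.
  by apply: eq_bigr => -[z b] _; rewrite pr_copy_state.
(* Union bound and Markov's inequality in one: the indicator of a bad state is at most the last
   factor. *)
apply: (@le_trans _ _ (\sum_(x : {set KT} * BT) rho x.1 * beta x.2 *
    (\sum_(k in K) (k \in x.1)%:R + tail_sum x ^+ 2 / t))).
  rewrite [leRHS](bigID bad_state) /= -[leLHS]addr0; apply: lerD; last first.
    apply: sumr_ge0 => x _; rewrite !mulr_ge0 // addr_ge0 ?divr_ge0 ?sqr_ge0 ?(ltW t0) //.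
    by apply: sumr_ge0.
  apply: ler_sum => x bx; rewrite -[leLHS]mulr1 ler_wpM2l ?mulr_ge0 //.
  have h1 : 0 <= \sum_(k in K) (k \in x.1)%:R :> R by apply: sumr_ge0.
  have h2 : 0 <= tail_sum x ^+ 2 / t by rewrite divr_ge0 ?sqr_ge0 ?(ltW t0).
  case/orP: bx => [/set0Pn[k]|tx].
    rewrite inE => /andP[kK kx].
    have : 1 <= \sum_(k in K) (k \in x.1)%:R :> R.
      by rewrite (bigD1 k) //= kx lerDl sumr_ge0.
    by lra.
  have : 1 <= tail_sum x ^+ 2 / t by rewrite ler_pdivlMr // mul1r ltW.
  by lra.
rewrite -(pair_bigA _ (fun z b => rho z * beta b * (\sum_(k in K) (k \in z)%:R + tail_sum (z, b) ^+ 2 / t))) /=.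
apply: (@le_trans _ _ (\sum_z rho z * (\sum_(k in K) (k \in z)%:R +
   (\sum_(k | (k != [ffun _ => finset.set0]) && (k \notin K)) c k ^+ 2 * (k \in z)%:R) / t))).
  apply: ler_sum => z _.
  have -> : \sum_b rho z * beta b * (\sum_(k in K) (k \in z)%:R + tail_sum (z, b) ^+ 2 / t) =
     rho z * (\sum_(k in K) (k \in z)%:R + avg (fun b => tail_sum (z, b) ^+ 2) / t).
    rewrite -sum_beta_avg mulr_suml -[X in _ * (X + _)]mul1r -sum_beta mulr_suml -big_split mulr_sumr /=.
    by apply: eq_bigr => b _; ring.
  rewrite ler_wpM2l // lerD2l ler_wpM2r ?invr_ge0 ?(ltW t0) //.
  (* For fixed matrices the tail is a Walsh sum in the shift alone, with these coefficients. *)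
  pose dd (k : KT) := if (k != [ffun _ => finset.set0]) && (k \notin K) then c k * (k \in z)%:R else 0.
  have cardB : (0 < #|BT|)%N by rewrite card_ffun card_bool expn_gt0.
  have := bessel_dual (B := @digits_of s L) (@avg_chi_digits R s L) dd.
  have -> : avg (fun b : BT => (\sum_k dd k * chi k (digits_of b)) ^+ 2) = avg (fun b : BT => tail_sum (z, b) ^+ 2).
    apply: eq_avg => b; congr (_ ^+ 2); rewrite /tail_sum [RHS]big_mkcond /=; apply: eq_bigr => k _.
    by rewrite /dd; case: ifP; rewrite ?mul0r.
  move/le_trans; apply; rewrite [leRHS]big_mkcond /=; apply: ler_sum => k _.
  rewrite /dd; case: ifP => _; last by rewrite expr0n.
  by rewrite exprMn; case: (k \in z); rewrite ?expr1n ?expr0n.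
have -> : \sum_z rho z * (\sum_(k in K) (k \in z)%:R +
   (\sum_(k | (k != [ffun _ => finset.set0]) && (k \notin K)) c k ^+ 2 * (k \in z)%:R) / t) =
   \sum_(k in K) (\sum_(z : {set KT} | k \in z) rho z) +
   (\sum_(k | (k != [ffun _ => finset.set0]) && (k \notin K)) c k ^+ 2 * (\sum_(z : {set KT} | k \in z) rho z)) / t.
  have ind k : \sum_(z : {set KT} | k \in z) rho z = \sum_z rho z * (k \in z)%:R.
    by rewrite big_mkcond /=; apply: eq_bigr => z _; case: (k \in z); rewrite ?mulr1 ?mulr0.
  under [X in X + _]eq_bigr do rewrite ind.
  under [X in _ + X / _]eq_bigr do rewrite ind mulr_sumr.
  rewrite exchange_big /= [X in _ + X / _]exchange_big /= mulr_suml -big_split /=.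
  apply: eq_bigr => z _; rewrite mulrDr mulr_sumr; congr (_ + _).
  rewrite mulrA mulr_sumr; congr (_ / _); apply: eq_bigr => k _; ring.
rewrite mulrDr; apply: lerD.
  rewrite mulrC mulr_natl -sumr_const; apply: ler_sum => k kK; apply: pr_zero.
  by apply: contraNneq K0 => <-.
rewrite mulrA ler_wpM2r ?invr_ge0 ?(ltW t0) // mulr_sumr; apply: ler_sum => k /andP[k0 _].
by rewrite mulrC ler_wpM2r ?sqr_ge0 // pr_zero.
Qed.

End one_copy.

(** * The median *)

Section median_bounds.
Context {R : realType}.

(** If the median is off, all entries on its side of [mu] beyond it are off as well: the first r
    sorted entries if it is too low, the last r if it is too high. *)
Lemma median_close (e : seq R) (r : nat) (mu tau : R) : size e = (2 * r - 1)%N -> (0 < r)%N ->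
  (count (fun x => tau < `|x - mu|)%R e < r)%N -> `|median e - mu| <= tau.
Proof.
move=> se r0; set bad := fun x => _ => cr; rewrite leNgt; apply/negP => mb.
pose o := sort <=%O e; have so : size o = (2 * r - 1)%N by rewrite size_sort.
have sorted_o : sorted <=%O o by apply: sort_sorted; exact: le_total.
have half : (size e)./2 = r.-1 by rewrite se; case: r r0 {se cr so} => // r _; rewrite mulnS add2n subn1 /= mul2n uphalf_double.
have co p : count p e = count p o.
  by have /permP := (permEl (perm_sort <=%O e)); move=> /(_ p).
have mono i j : (i <= j)%N -> (j < 2 * r - 1)%N -> nth 0 o i <= nth 0 o j.
  move=> ij jr; apply: (sorted_leq_nth le_trans le_refl) => //; rewrite inE so //.
  exact: leq_ltn_trans jr.
have me : median e = nth 0 o r.-1 by rewrite /median half.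
rewrite me in mb.
have full s : (r <= size s)%N -> all bad s -> (r <= count bad s)%N.
  by move=> rs; rewrite all_count => /eqP->.
have [lt0|ge0] := ltP (nth 0 o r.-1 - mu) 0.
  have := full (take r o); rewrite size_take so.
  have -> : (if (r < 2 * r - 1)%N then r else (2 * r - 1)%N) = r by case: ltnP; lia.
  move=> /(_ (leqnn _)) h.
  have al : all bad (take r o).
    apply/(all_nthP 0) => i; rewrite size_take so => hi.
    have ir : (i < r)%N by move: hi; case: ifP; lia.
    rewrite nth_take // /bad; have h1 : nth 0 o i <= nth 0 o r.-1 by apply: mono; lia.
    have h2 : nth 0 o i - mu < 0 by lra.
    by rewrite (ltr0_norm lt0) in mb; rewrite (ltr0_norm h2); lra.
  have := h al; rewrite leqNgt => /negP; apply.
  by apply: leq_ltn_trans cr; rewrite co -[in leqRHS](cat_take_drop r o) count_cat leq_addr.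
have := full (drop r.-1 o); rewrite size_drop so => h.
have al : all bad (drop r.-1 o).
  apply/(all_nthP 0) => i; rewrite size_drop so nth_drop => hi.
  rewrite /bad; have h1 : nth 0 o r.-1 <= nth 0 o (r.-1 + i) by apply: mono; lia.
  have h2 : 0 <= nth 0 o (r.-1 + i) - mu by lra.
  by rewrite (ger0_norm ge0) in mb; rewrite (ger0_norm h2); lra.
have : (r <= count bad (drop r.-1 o))%N by apply: h => //; lia.
rewrite leqNgt => /negP; apply.
by apply: leq_ltn_trans cr; rewrite co -[in leqRHS](cat_take_drop r.-1 o) count_cat leq_addl.
Qed.

Lemma median_mem (e : seq R) : (0 < size e)%N -> median e \in e.
Proof.
move=> e0; rewrite -(mem_sort <=%O) mem_nth // size_sort.
by rewrite ltn_half_double -addnn -[X in (X < _)%N]addn0 ltn_add2l.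
Qed.

(** The integral of a nonnegative function is a supremum over simple functions below it, hence
    monotone by definition; this applies directly to the squared error of the median. *)
Lemma expectation_le d (T : measurableType d) (P : probability T R) (X : T -> R) (a b : R) (E : set T) :
  measurable E -> 0 <= a -> 0 <= b -> (forall w, 0 <= X w) ->
  (forall w, X w <= a + b * \1_E w) -> ('E_P[X] <= (a + b * pr P E)%:E)%E.
Proof.
move=> mE a0 b0 X0 hX; rewrite unlock.
apply: (@le_trans _ _ (\int[P]_w (a + b * \1_E w)%:E)%E).
  rewrite !ge0_integralTE; last 2 first.
  - by move=> w; rewrite lee_fin addr_ge0 // mulr_ge0.
  - by move=> w; rewrite lee_fin.
  apply: le_ereal_sup => _ [h /= hh <-]; exists h => // w.
  by apply: le_trans (hh w) _; rewrite lee_fin.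
under eq_integral do rewrite EFinD EFinM.
have I0 w : [set: T] w -> (0 <= (\1_E w : R)%:E)%E by move=> _; rewrite lee_fin.
rewrite ge0_integralD //; last 2 first.
- by move=> w /I0; apply: mule_ge0.
- by apply: emeasurable_funM; [exact: measurable_cst|apply/measurable_EFinP; exact: measurable_indic].
rewrite integral_cst // ge0_integralZl //; last by apply/measurable_EFinP; exact: measurable_indic.
rewrite integral_indic // setIT EFinD EFinM -(prE P mE) leeD2r //.
by rewrite -[leRHS]mule1 -(probability_setT P).
Qed.

End median_bounds.

Section copies.
Context {R : realType} {s m n L : nat} {d : measure_display} {T : measurableType d}.
Variables (Q : probability (gen_matrices s m) R) (P : probability T R).
Variables (C : 'I_n -> T -> gen_matrices s m) (D : 'I_n -> T -> shifts s).
Hypothesis NC : net_copies Q P C D.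
Local Notation KT := {ffun 'I_s -> {set 'I_L}}.
Local Notation BT := {ffun 'I_s * 'I_L -> bool}.
Variables (Bad : pred ({set KT} * BT)) (p : R).
Hypothesis bad_le : forall i, pr P [set w | Bad (copy_state C D i w)] <= p.

Let bad_event i : set T := [set w | Bad (copy_state C D i w)].

Let p0 (i : 'I_n) : 0 <= p. Proof. exact: le_trans (pr_ge0 _ _) (bad_le i). Qed.

Let measurable_bad i : measurable (bad_event i).
Proof. exact: measurable_state (measurable_copy_state NC i) Bad. Qed.

Let measurable_bad_all (J : {set 'I_n}) : measurable [set w | [forall i in J, Bad (copy_state C D i w)]].
Proof.
apply: measurable_bool_forall => i; case: (i \in J) => /=; first exact: measurable_bad.
exact: measurable_bool_const.
Qed.

Let measurable_pair_state (x : {set KT} * BT) :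
  measurable [set cd : gen_matrices s m * shifts s | (zeros cd.1, digits cd.2) = x].
Proof.
case: x => z b.
rewrite (_ : [set cd : _ * _ | _] = (fst @^-1` [set c | zeros c = z]) `&` (snd @^-1` [set e | digits e = b])); last first.
  by apply/seteqP; split => -[c e] /=; case=> -> ->.
by apply: measurableI; rewrite -[_ @^-1` _]setTI;
  [apply: measurable_fst => //; exact: measurable_zeros|apply: measurable_snd => //; exact: measurable_digits].
Qed.

Lemma pr_all_bad (J : {set 'I_n}) :
  pr P [set w | [forall i in J, Bad (copy_state C D i w)]] <= p ^+ #|J|.
Proof.
pose A := [set cd : gen_matrices s m * shifts s | Bad (zeros cd.1, digits cd.2)].
have mA : measurable A by exact: measurable_state measurable_pair_state Bad.
pose F : {fset 'I_n} := [fset i in J]%fset.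
rewrite (_ : [set w | _] = \bigcap_(i in [set` F]) ((fun w => (C i w, D i w)) @^-1` A)); last first.
  apply/seteqP; split => w /=.
    by move/forall_inP => h i /=; rewrite inE => /h.
  by move=> h; apply/forall_inP => i iJ; apply: (h i); rewrite /= inE.
rewrite /pr (independent_copies NC) //.
rewrite (eq_bigr (fun i => (pr P (bad_event i))%:E)); last by move=> i _; rewrite -prE.
rewrite prodEFin /= -(card_finset (mem J)) -/F.
rewrite [#|` F|]/(size (enum_fset F)); elim: (enum_fset F) => [|i t IH]; first by rewrite big_nil.
rewrite big_cons /= exprS; apply: ler_pM => //; [exact: pr_ge0| |exact: bad_le].
by apply: prodr_ge0 => j _; exact: pr_ge0.
Qed.

Lemma many_bad (r : nat) :
  measurable [set w | (r <= #|[set i | Bad (copy_state C D i w)]%SET|)%N] /\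
  (0 <= p -> pr P [set w | (r <= #|[set i | Bad (copy_state C D i w)]%SET|)%N] <= 2 ^+ n * p ^+ r).
Proof.
rewrite (_ : [set w | _] = [set w | \big[orb/false]_(J : {set 'I_n} | #|J| == r)
    [forall i in J, Bad (copy_state C D i w)]]); last first.
  apply/seteqP; split => w /=; rewrite big_orE.
    move=> h; apply/existsP; exists [set i in take r (enum [set i | Bad (copy_state C D i w)]%SET)]%SET.
    apply/andP; split.
      rewrite cardsE (card_uniqP _) ?take_uniq ?enum_uniq // size_take -cardE.
      by case: ltnP => [_|h']; rewrite ?eqxx // eqn_leq h' h.
    by apply/forall_inP => i; rewrite inE => /mem_take; rewrite mem_enum inE.
  case/existsP => J /andP[/eqP<- /forall_inP h]; apply: subset_leq_card.
  by apply/fintype.subsetP => i /h; rewrite inE.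
have orb_or (A B : T -> bool) : measurable [set w | A w] -> measurable [set w | B w] ->
    measurable [set w | A w || B w].
  move=> mA mB; rewrite (_ : [set w | _] = [set w | A w] `|` [set w | B w]); first exact: measurableU.
  by apply/seteqP; split => w /= /orP.
split; first by apply: measurable_bool_big => // J; exact: measurable_bad_all.
move=> p0'; have -> : 2 ^+ n = #|powerset [set: 'I_n]%SET|%:R :> R.
  by rewrite card_powerset cardsT card_ord natrX.
apply: (@le_trans _ _ (\sum_(J : {set 'I_n} | #|J| == r) p ^+ r)); last first.
  rewrite sumr_const -[p ^+ r *+ _]mulr_natl ler_wpM2r ?exprn_ge0 // ler_nat.
  by apply: subset_leq_card; apply/fintype.subsetP => J _; rewrite powersetE; apply/fintype.subsetP => j _; rewrite inE.
under eq_set do rewrite -big_filter.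
rewrite -[leRHS]big_filter.
set t := seq.filter _ _; have : all (fun J : {set 'I_n} => #|J| == r) t by apply: filter_all.
elim: t => [|J t IH] /=.
  rewrite !big_nil (_ : [set w | _] = set0); first by rewrite /pr measure0.
  by apply/seteqP; split => w /=; rewrite big_nil.
move=> /andP[/eqP Jr /IH {}IH]; rewrite [leRHS]big_cons.
rewrite (_ : [set w | _] = [set w | [forall i in J, Bad (copy_state C D i w)]] `|`
   [set w | \big[orb/false]_(J <- t) [forall i in J, Bad (copy_state C D i w)]]); last first.
  by apply/seteqP; split => w /=; rewrite big_cons => /orP.
apply: le_trans (pr_le_union _ _ _) _ => //.
  by apply: measurable_bool_big => // J'; exact: measurable_bad_all.
by apply: lerD => //; rewrite -Jr; exact: pr_all_bad.
Qed.

End copies.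

Section median_of_nets.
Context {R : realType} {s m r L : nat} {d : measure_display} {T : measurableType d}.
Variables (Q : probability (gen_matrices s m) R) (P : probability T R).
Variables (C : 'I_(2 * r - 1) -> T -> gen_matrices s m) (D : 'I_(2 * r - 1) -> T -> shifts s).
Hypotheses (NC : net_copies Q P C D) (r0 : (0 < r)%N).
Local Notation KT := {ffun 'I_s -> {set 'I_L}}.
Variables (f : 'rV[R]_s -> R) (mu M : R) (c : KT -> R) (eta t p : R) (K : {set KT}).
Hypotheses (eta0 : 0 <= eta) (t0 : 0 <= t) (p0 : 0 <= p) (K0 : [ffun _ => finset.set0] \notin K)
  (f_approx : forall (x : 'rV[R]_s) (b : 'I_s -> nat -> bool), unit_cube x ->
        (forall j, dyadic_prefix L (b j) <= x 0 j <= dyadic_prefix L (b j) + 2 ^- L) ->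
        `|f x - \sum_k c k * chi k b| <= eta)
  (c0_mu : `|c [ffun _ => finset.set0] - mu| <= eta)
  (f_bound : forall x, unit_cube x -> `|f x| <= M)
  (bad_le : forall i, pr P [set w | bad_state c K t (copy_state C D i w)] <= p).

Lemma good_copy i w : ~~ bad_state c K t (copy_state C D i w) ->
  `|net_estimator f (C i w) (D i w) - mu| <= Num.sqrt t + 2 * eta.
Proof.
rewrite negb_or negbK -leNgt => /andP[/eqP Kz tail].
have := net_estimator_approx (C i w) (D i w) f_approx.
have := c0_mu; set z0 : KT := [ffun _ => finset.set0] => hc0.
have -> : \sum_k c k * (Z (numeral k) (C i w))%:R * chi k (fun j l => D i w (j, l)) =
   c z0 + tail_sum c K (copy_state C D i w).
  rewrite (bigD1 z0) //= chi0 mulr1.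
  have -> : Z (numeral z0) (C i w).
    rewrite ZE; apply/forallP => q; rewrite big1 // => j _; rewrite big_pred0 // => l.
    by rewrite ffunE inE.
  rewrite mulr1; congr (_ + _); rewrite /tail_sum [RHS]big_mkcondr /=.
  apply: eq_bigr => k k0; rewrite chi_digits inE.
  case: ifPn => //; rewrite negbK => kK.
  have /negP : k \notin K :&: zeros (C i w) by rewrite Kz inE.
  by rewrite inE kK inE /= => /negP/negbTE->; rewrite mulr0 mul0r.
set x := net_estimator _ _ _; set y := tail_sum _ _ _ => h.
have hy : `|y| <= Num.sqrt t by rewrite -sqrtr_sqr ler_wsqrtr.
rewrite (_ : x - mu = (x - (c z0 + y)) + (c z0 - mu) + y); last by ring.
apply: le_trans (ler_normD _ _) _; rewrite addrC lerD //.
by apply: le_trans (ler_normD _ _) _; lra.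
Qed.

Lemma median_mse :
  ('E_P[(fun w => (median [seq net_estimator f (C i w) (D i w) | i <- enum 'I_(2 * r - 1)] - mu) ^+ 2)%R]
   <= ((Num.sqrt t + 2 * eta) ^+ 2 + (M + `|mu|) ^+ 2 * (2 ^+ (2 * r - 1) * p ^+ r))%:E)%E.
Proof.
pose E := [set w | (r <= #|[set i | bad_state c K t (copy_state C D i w)]%SET|)%N].
have [mE /(_ p0) hE] := many_bad NC bad_le r.
have tau0 : 0 <= Num.sqrt t + 2 * eta by rewrite addr_ge0 ?sqrtr_ge0 ?mulr_ge0.
apply: (@le_trans _ _ ((Num.sqrt t + 2 * eta) ^+ 2 + (M + `|mu|) ^+ 2 * pr P E)%:E); last first.
  by rewrite lee_fin lerD2l ler_wpM2l ?sqr_ge0.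
apply: expectation_le; rewrite ?sqr_ge0 // => w; first exact: sqr_ge0.
set e := [seq _ | i <- _].
have se : size e = (2 * r - 1)%N by rewrite size_map size_enum_ord.
have M0 : 0 <= M.
  apply: le_trans (normr_ge0 (f 0)) _; apply: f_bound => j; by rewrite mxE lexx ler01.
rewrite indicE; case: (boolP (w \in E)) => [wE|wE].
  rewrite mulr1 -[leLHS]add0r lerD ?sqr_ge0 //.
  (* Even on the bad event the median is one of the estimates, and these are bounded by M. *)
  have : median e \in e by apply: median_mem; rewrite se; lia.
  case/mapP => i _ ->; rewrite -real_normK ?num_real // ler_sqr ?nnegrE ?addr_ge0 //.
  by apply: le_trans (ler_normB _ _) _; rewrite lerD2r; apply: net_estimator_bounded.
rewrite mulr0 addr0 -real_normK ?num_real // ler_sqr ?nnegrE //.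
apply: (median_close se r0).
have -> : count (fun x => Num.sqrt t + 2 * eta < `|x - mu|) e =
    #|[set i | Num.sqrt t + 2 * eta < `|net_estimator f (C i w) (D i w) - mu|]%SET|.
  rewrite count_map -sum1_count big_enum_cond -sum1_card.
  by apply: eq_bigl => i; rewrite inE.
apply: (@leq_ltn_trans #|[set i | bad_state c K t (copy_state C D i w)]%SET|).
  apply: subset_leq_card; apply/fintype.subsetP => i; rewrite !inE.
  by apply: contraTT => /good_copy; rewrite -leNgt.
by move: wE; rewrite notin_setE /E /= => /negP; rewrite -ltnNge.
Qed.

End median_of_nets.

(** * Choice of exponents and conclusion *)

Section rates.
Context {R : realType}.

(** As [del] tends to 0 the right side tends to 2A. Clearing denominators leaves del (A + 2 A^2) <=
    eps + eps A del, whence the threshold. *)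
Lemma exponent_le (A eps del : R) : 0 < A -> 0 < eps -> 0 < del -> del <= eps / (A + 2 * A ^+ 2) ->
  2 * A - eps <= (2 - del) / (A^-1 + del).
Proof.
move=> A0 e0 d0; have C0 : 0 < A + 2 * A ^+ 2 by rewrite addr_gt0 ?mulr_gt0 ?exprn_gt0.
rewrite ler_pdivlMr // => h.
have Ai : 0 < A^-1 by rewrite invr_gt0.
rewrite ler_pdivlMr ?addr_gt0 // -(ler_pM2l A0).
have -> : A * ((2 * A - eps) * (A^-1 + del)) = (2 * A - eps) * (1 + A * del).
  by field; rewrite lt0r_neq0.
have : 0 <= eps * A * del by rewrite !mulr_ge0 // ltW.
rewrite expr2 in h; nra.
Qed.

Lemma powR_natpow (n : nat) (x : R) : (2 ^ n)%N%:R `^ x = 2 `^ (n%:R * x).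
Proof. by rewrite natrX -powR_mulrn // powRrM. Qed.

End rates.

Theorem theorem4 (R : realType) (s alpha : nat) (lambda : R)
    (f : 'rV[R]_s -> R)
    (Q : forall m : nat, probability (gen_matrices s m) R)
    (r : nat -> nat)
    (d : nat -> measure_display) (T : forall m : nat, measurableType (d m))
    (P : forall m : nat, probability (T m) R)
    (C : forall m : nat, 'I_(2 * r m - 1) -> T m -> gen_matrices s m)
    (D : forall m : nat, 'I_(2 * r m - 1) -> T m -> shifts s) :
  (0 < s)%N -> 0 < lambda <= 1 ->
  mixed_C alpha f -> (variation_norm alpha lambda f < +oo)%E ->
  asymptotically_full_rank Q ->
  (forall m : nat, (0 < m)%N -> (m <= r m)%N) ->
  (forall m : nat, (0 < m)%N -> net_copies (Q m) (P m) (C m) (D m)) ->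
  forall eps : R, 0 < eps ->
  exists c : R, \forall m \near \oo,
    ('E_(P m)[(fun w : T m =>
        (median [seq net_estimator f (C m i w) (D m i w)
                   | i <- enum 'I_(2 * r m - 1)] - cube_integral f) ^+ 2)%R]
     <= (c * (2 ^ m)%N%:R
               `^ (- 2 * alpha%:R - 2 * lambda - 1 + eps))%:E)%E.
Proof.
move=> _ lambda01 fC fV [R0 full] mr NC eps eps0.
have /andP[l0 l1] := lambda01.
pose A := alpha%:R + lambda; have A0 : 0 < A by rewrite ltr_wpDl.
have [B B0 approx] := walsh_approximation fC fV.
have [M M0 hM] := mixed_partial_bound fC.
have f_bound x : unit_cube x -> `|f x| <= M.
  by have := hM (fun=> 0%N) (fun=> leq0n _) x; rewrite mixed_partial0.
have C0 : 0 < A + 2 * A ^+ 2 by rewrite addr_gt0 ?mulr_gt0 ?exprn_gt0.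
pose del := Num.min 1 (eps / (A + 2 * A ^+ 2)).
have del0 : 0 < del by rewrite lt_min ltr01 divr_gt0.
have del1 : del <= 1 by rewrite ge_min lexx.
have del2 : del <= 2 by lra.
have gam0 : 0 < A^-1 + del by rewrite addr_gt0 ?invr_gt0.
set gam := A^-1 + del in gam0.
have [S S0 tail] := @block_tail R s alpha lambda lambda01 del del0 del2.
(* p0 makes (8 p0)^m, which bounds the probability that r copies fail, equal to
   n^(-2A-1); theta below is the least threshold for which the union bound over
   K costs at most p0. *)
pose p0 : R := 2 `^ (- (2 * A + 1)) / 8.
have p00 : 0 < p0 by rewrite divr_gt0 ?powR_gt0.
(* The power of q S / p0 in [t]: one factor from full rank, the others from theta^(2-del). *)
pose e := 1 + (2 - del) / gam.
have e_ge : 2 * A + 1 - eps <= e.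
  have hd : del <= eps / (A + 2 * A ^+ 2) by rewrite ge_min lexx orbT.
  have := exponent_le A0 eps0 del0 hd; rewrite -/gam => h.
  by rewrite /e; lra.
pose G : R := 2 `^ R0 * S / p0.
have G0 : 0 < G by rewrite divr_gt0 ?mulr_gt0 ?powR_gt0.
pose mu := cube_integral f.
(* The square of sqrt t + 2 eta is at most 2 t + 8 eta^2; the last summand is the squared error on
   the bad event. *)
exists (2 * (B * G `^ e) + 8 + (M + `|mu|) ^+ 2).
near=> m.
have m0 : (0 < m)%N by near: m; exists 1%N.
have r0 : (0 < r m)%N by apply: leq_trans (mr m m0).
pose q : R := 2 `^ (- m%:R + R0).
have q0 : 0 < q by rewrite powR_gt0.
pose theta := (q * S / p0) `^ gam^-1.
have g0 : 0 < q * S / p0 by rewrite divr_gt0 ?mulr_gt0.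
have theta0 : 0 < theta by rewrite powR_gt0.
(* Then eta^2 = n^(-2A-2), below the target rate. *)
pose eta : R := 2 `^ (- (m%:R * (A + 1))).
have eta0 : 0 < eta by rewrite powR_gt0.
have [L [c [f_approx c0_mu blocks]]] := approx eta eta0.
have [cardK tailK] := tail L theta B c theta0 (ltW B0) blocks.
pose w (k : {ffun 'I_s -> {set 'I_L}}) : R := block_weight alpha lambda (block_of alpha k).
pose z0 : {ffun 'I_s -> {set 'I_L}} := [ffun _ => finset.set0].
pose K := [set k : {ffun 'I_s -> {set 'I_L}} | (k != z0) && (theta <= w k)]%SET.
have K0 : z0 \notin K by rewrite inE eqxx.
(* The level at which Chebyshev's inequality for the tail costs exactly [p0]; with the union bound
   over K a copy fails with probability at most 2 p0. *)
pose t := q * (B * S * theta `^ (2 - del)) / p0.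
have t0 : 0 < t by rewrite divr_gt0 ?mulr_gt0 ?powR_gt0.
have cardK' : q * #|K|%:R <= p0.
  have -> : p0 = q * (S * theta `^ (- gam)).
    rewrite /theta -powRrM mulrN mulVf ?lt0r_neq0 // powR_inv1 ?(ltW g0) //.
    by field; rewrite !lt0r_neq0.
  rewrite ler_wpM2l ?(ltW q0) //; apply: le_trans cardK; rewrite ler_nat.
  by apply: subset_leq_card; apply/fintype.subsetP => k; rewrite !inE => /andP[].
have tailK' : \sum_(k | (k != z0) && (k \notin K)) c k ^+ 2 <= B * S * theta `^ (2 - del).
  apply: le_trans tailK; rewrite big_mkcond [leRHS]big_mkcond /=; apply: ler_sum => k _.
  case: ifP => [/andP[k0]|_]; last by case: ifP; rewrite ?sqr_ge0.
  by rewrite inE k0 /= -ltNge => ->.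
have full' (k : {ffun 'I_s -> {set 'I_L}}) : k != z0 -> (Q m [set X | Z (numeral k) X] <= q%:E)%E.
  by move=> /numeral_neq0; apply: full.
have bad_le i : pr (P m) [set x | bad_state c K t (copy_state (C m) (D m) i x)] <= 2 * p0.
  apply: le_trans (pr_bad_state (NC m m0) i c t0 K0 full') _.
  rewrite mulrDr (_ : 2 * p0 = p0 + p0); last by ring.
  apply: lerD => //.
  have -> : p0 = q * (B * S * theta `^ (2 - del)) / t.
    by rewrite /t invf_div mulrCA divff ?mulr1 // !mulf_neq0 ?lt0r_neq0 ?powR_gt0.
  by rewrite mulrA ler_wpM2r ?invr_ge0 ?(ltW t0) // ler_wpM2l ?(ltW q0).
have p0' : 0 <= 2 * p0 by rewrite mulr_ge0 // ltW.
have := median_mse (NC m m0) r0 (ltW eta0) (ltW t0) p0' K0 f_approx c0_mu f_bound bad_le.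
move/le_trans; apply; rewrite lee_fin -/mu.
have two1 : 1 <= 2 :> R by rewrite ler1n.
have exp_le (x y : R) : x <= y -> 2 `^ (m%:R * x) <= 2 `^ (m%:R * y) :> R.
  by move=> xy; apply: ler_powR => //; rewrite ler_wpM2l.
rewrite powR_natpow; set x := - 2 * alpha%:R - 2 * lambda - 1 + eps.
have xA : x = - (2 * A + 1) + eps by rewrite /x /A; ring.
set Y : R := 2 `^ (m%:R * x).
have tY : t <= B * G `^ e * Y.
  have -> : t = B * (q * S / p0) `^ e.
    rewrite /t /theta -powRrM (mulrC gam^-1) /e powRD; last by rewrite lt0r_neq0 ?implybT.
    rewrite powRr1 ?(ltW g0) //; ring.
  rewrite -[leRHS]mulrA ler_wpM2l ?(ltW B0) //.
  have -> : q * S / p0 = 2 `^ (- m%:R) * G.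
    by rewrite /q powRD ?pnatr_eq0 ?implybT // /G; ring.
  rewrite powRM ?powR_ge0 ?(ltW G0) // mulrC ler_wpM2l ?powR_ge0 //.
  by rewrite -powRrM mulNr -mulrN; apply: exp_le; rewrite xA; lra.
have etaY : eta ^+ 2 <= Y.
  have -> : eta ^+ 2 = 2 `^ (m%:R * (- (2 * A + 2))).
    by rewrite /eta -powR_mulrn ?powR_ge0 // -powRrM; congr (_ `^ _); ring.
  by apply: exp_le; rewrite xA; lra.
have pY : 2 ^+ (2 * r m - 1) * (2 * p0) ^+ r m <= Y.
  apply: (@le_trans _ _ ((8 * p0) ^+ r m)).
    rewrite (_ : 8 * p0 = 4 * (2 * p0)); last by ring.
    rewrite [leRHS]exprMn ler_wpM2r ?exprn_ge0 ?mulr_ge0 ?(ltW p00) //.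
    rewrite (_ : 4 = 2 ^+ 2 :> R); last by ring.
    by rewrite -exprM ler_weXn2l // leq_subr.
  have -> : 8 * p0 = 2 `^ (- (2 * A + 1)) by rewrite /p0; field.
  rewrite -powR_mulrn ?powR_ge0 // -powRrM.
  (* Since 8 p0 < 1, replacing r by the smaller exponent m only increases the bound. *)
  apply: (@le_trans _ _ (2 `^ (m%:R * (- (2 * A + 1))))).
    apply: ler_powR => //; rewrite mulrC ler_wnM2r ?ler_nat ?mr //; lra.
  by apply: exp_le; rewrite xA; lra.
have sq : (Num.sqrt t + 2 * eta) ^+ 2 <= 2 * t + 8 * eta ^+ 2.
  have := sqr_sqrtr (ltW t0); move: (Num.sqrt t) => z zt; rewrite -zt.
  by have := sqr_ge0 (z - 2 * eta); nra.
have h3 : (M + `|mu|) ^+ 2 * (2 ^+ (2 * r m - 1) * (2 * p0) ^+ r m) <= (M + `|mu|) ^+ 2 * Y.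
  by rewrite ler_wpM2l ?sqr_ge0.
apply: le_trans (lerD sq h3) _; rewrite [leRHS]mulrDl lerD2r [leRHS]mulrDl.
by apply: lerD; rewrite -?[leRHS]mulrA ler_pM2l.
Unshelve. all: by end_near. Qed.
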